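(* Let $X$ be a non-empty compact subset of $\mathbb{C}^n$. The Kolmogorov dimension $\mathcal{K}\text{-}\mathrm{dim}$ satisfies the following properties. (1) $0\le\mathcal{K}\text{-}\mathrm{dim}\,X\le n$. (2) $\mathcal{K}\text{-}\mathrm{dim}\,\{z\}=0$ for every point $z\in\mathbb{C}^n$. (3) $\mathcal{K}\text{-}\mathrm{dim}\,\widehat{X}=\mathcal{K}\text{-}\mathrm{dim}\,X$, where $\widehat X$ is the polynomially convex hull of $X$. (4) If $Y\subset X$ is a non-empty compact set, then $\mathcal{K}\text{-}\mathrm{dim}\,Y\le\mathcal{K}\text{-}\mathrm{dim}\,X$. (5) If $X_1,\dots,X_m$ is a finite family of non-empty compact subsets of $\mathbb{C}^n$, then $\mathcal{K}\text{-}\mathrm{dim}\bigcup_{j=1}^mX_j=\max\{\mathcal{K}\text{-}\mathrm{dim}\,X_j:j=1,\dots,m\}$. (6) If $D\subset\mathbb{C}^n$ is a domain, $X\subset D$ and $\phi:D\to\mathbb{C}^k$ is a holomorphic map, then $\mathcal{K}\text{-}\mathrm{dim}\,\phi(X)\le\mathcal{K}\text{-}\mathrm{dim}\,X$. (7) If $\mathcal{K}\text{-}\mathrm{dim}\,X<n$, then $X$ is pluripolar.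
   Context: Kolmogorov dimension: for a non-empty totally bounded metric space $E$ and $\varepsilon>0$, let $N_\varepsilon(E)$ be the smallest cardinality of a family of sets of diameter at most $2\varepsilon$ covering $E$, and let $\mathscr{H}_\varepsilon(E)=\log N_\varepsilon(E)$ (natural logarithm) be the $\varepsilon$-entropy. For a compact subset $X$ of a bounded domain $D\subset\mathbb{C}^n$, let $A_X^D\subset C(X)$ be the set of restrictions to $X$ of holomorphic functions $F$ on $D$ with $\sup_D|F|\le 1$, with the sup-norm metric of $C(X)$ (it is compact, hence totally bounded). Put $$\Psi(X,D)=\limsup_{\varepsilon\to0}\frac{\log\mathscr{H}_\varepsilon(A_X^D)}{\log\log\frac1\varepsilon}-1 .$$ The Kolmogorov dimension of a non-empty compact $X\subset\mathbb{C}^n$ is $\mathcal{K}\text{-}\mathrm{dim}\,X=\Psi(X,D)$, where $D$ is any bounded domain containing $X$ (the value does not depend on the choice of $D$). The polynomially convex hull $\widehat X$ of a compact $X\subset\mathbb{C}^n$ is the set of all $z\in\mathbb{C}^n$ such that $|P(z)|\le\sup_{\zeta\in X}|P(\zeta)|$ for all polynomials $P$ with complex coefficients. A set $E\subset\mathbb{C}^n$ is pluripolar if there exists a non-constant plurisubharmonic function $\phi$ on $\mathbb{C}^n$ such that $\phi\equiv-\infty$ on $E$. *)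

(* Defs.v *)
From HB Require Import structures.
From mathcomp Require Import all_boot all_order all_algebra.
From mathcomp Require Import all_classical all_reals all_analysis.
From mathcomp Require Import complex.
(* Not imported: the notations of mpoly clash with those of analysis. *)
From mathcomp Require mpoly.

Set Implicit Arguments.
Unset Strict Implicit.
Unset Printing Implicit Defensive.

Import Order.TTheory GRing.Theory Num.Theory.
Import numFieldNormedType.Exports.

Local Open Scope classical_set_scope.
Local Open Scope ring_scope.

(* R[i] packed as a numClosedFieldType, so that its topology and its normed
   module structure over itself are the canonical ones of a numFieldType; in
   particular [differentiable] below means complex differentiable. *)
Definition CC (R : realType) : numClosedFieldType := R[i].

(* The real-valued modulus (the norm of CC R takes its values in CC R). *)
Definition cmod (R : realType) (z : CC R) : R := ComplexField.Normc.normc z.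

Section Entropy.
Context {R : realType} {T : Type}.
Variable d : T -> T -> \bar R.
Implicit Types E U : set T.

Definition diam U : \bar R := ereal_sup [set d p.1 p.2 | p in U `*` U].

Definition covered_by (eps : R) E (k : nat) : Prop :=
  exists U : 'I_k -> set T,
    (forall i, (diam (U i) <= (2 * eps)%:E)%E) /\ \bigcup_i U i = E.

(* N_eps(E); it is +oo when E has no finite cover. *)
Definition covering_number (eps : R) E : \bar R :=
  ereal_inf [set k%:R%:E | k in covered_by eps E].

Definition entropy (eps : R) E : \bar R := lne (covering_number eps E).

End Entropy.

Section SeveralComplexVariables.
Context {R : realType}.
Local Notation C := (CC R).

Definition holomorphic_on n (D : set 'rV[C]_n) (W : normedModType C)
  (f : 'rV[C]_n -> W) : Prop := forall z, D z -> differentiable f z.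

Definition domain n (D : set 'rV[C]_n) : Prop :=
  [/\ open D, connected D & D !=set0].

(* The sup-norm metric of C(X). *)
Definition sup_dist (X : Type) (f g : X -> C) : \bar R :=
  ereal_sup (range (fun x => (cmod (f x - g x))%:E)).

(* The set A_X^D, as a set of functions on the subtype X. *)
Definition unit_ball_restr n (X D : set 'rV[C]_n) : set (X -> C) :=
  [set F \o set_val | F in [set F : 'rV[C]_n -> C |
     holomorphic_on D F /\
     (ereal_sup [set (cmod (F z))%:E | z in D] <= 1)%E]].
Arguments unit_ball_restr {n} X D _.

Definition Psi n (X D : set 'rV[C]_n) : \bar R :=
  (limf_esup (fun eps : R =>
     lne (entropy (@sup_dist X) eps (unit_ball_restr X D))
       / (ln (ln eps^-1))%:E) 0^'+ - 1)%E.

(* Psi X D for an arbitrarily chosen bounded domain D containing X. *)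
Definition Kdim n (X : set 'rV[C]_n) : \bar R :=
  Psi X (xget [set: 'rV[C]_n]
    [set D | [/\ domain D, bounded_set D & X `<=` D]]).

Definition poly_hull n (X : set 'rV[C]_n) : set 'rV[C]_n :=
  [set z : 'rV[C]_n | forall P : mpoly.mpoly n C,
     ((cmod (mpoly.meval (fun i => z ord0 i) P))%:E <=
      ereal_sup [set (cmod (mpoly.meval (fun i => w ord0 i) P))%:E
                | w in X])%E].

Definition upper_semicontinuous (T : topologicalType) (u : T -> \bar R) : Prop :=
  lower_semicontinuous (fun x => - u x)%E.

Definition circle_mean (u : C -> \bar R) (z : C) (r : R) : \bar R :=
  ((2 * pi)^-1%:E *
   \int[lebesgue_measure]_(t in `[0%R, (2 * pi)%R])
      u (z + Complex (r * cos t) (r * sin t))%R)%E.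

(* Subharmonic functions on the whole plane; u = -oo is allowed. *)
Definition subharmonic (u : C -> \bar R) : Prop :=
  [/\ forall z, (u z < +oo)%E, upper_semicontinuous u
    & forall z r, 0 < r -> (u z <= circle_mean u z r)%E].

Definition plurisubharmonic n (phi : 'rV[C]_n -> \bar R) : Prop :=
  [/\ forall z, (phi z < +oo)%E, upper_semicontinuous phi
    & forall a b : 'rV[C]_n, subharmonic (fun t : C => phi (a + t *: b))].

Definition pluripolar n (E : set 'rV[C]_n) : Prop :=
  exists phi : 'rV[C]_n -> \bar R,
    [/\ plurisubharmonic phi, exists z w, phi z <> phi w
      & forall z, E z -> phi z = -oo%E].

End SeveralComplexVariables.

(* Main.v *)
(* A cover of [A_X^D] by sets of diameter [eps] is the same as a code on the
   unit ball of bounded holomorphic functions whose fibres have diameter [eps]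
   on [X]. In these terms [Psi X D] is the infimum of the [s] for which
   [O ((log 1/eps) ^ (s + 1))] bits suffice, and this growth condition does not
   change when [eps] is replaced by [eps ^ c].

   Cauchy's formula on circles gives, on a small polydisc, an approximation of
   holomorphic functions by tensor interpolation at scaled roots of unity, with
   an error exponentially small in the number of nodes and an operator norm that
   is only exponentially large. Hence a code for one neighbourhood of [X] (or of
   a holomorphic image, or of a hull) applied to the interpolating polynomials,
   which can be rescaled into the unit ball of any other bounded domain, is a
   code for the functions on any other neighbourhood: this is independence of
   [D], and yields (1)-(6), the bound [n] coming from the number [N ^ n] of
   nodes.

   For (7), if the entropy grows with an exponent [s < n], the pigeonhole
   principle produces for each [j] a nonzero integer polynomial [P_j] of partial
   degrees less than [N_j], coefficients at most [2 ^ N_j] and size at most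
   [exp (- 4 ^ j N_j)] on [X]. The sum of the [log |P_j| / (2 ^ j N_j)] is
   plurisubharmonic and [-oo] on [X]; it is not identically [-oo] because an
   integer polynomial has Mahler measure at least [1]. *)

From mathcomp Require Import all_boot all_order all_algebra.
From mathcomp Require Import all_classical all_reals all_analysis.
From mathcomp Require Import measurable_realfun complex ring lra zify.
From mathcomp Require mpoly.
Import (canonicals) mpoly.
Require Import Defs.
Import Order.TTheory GRing.Theory Num.Theory.
Import numFieldNormedType.Exports.

Set Implicit Arguments.
Unset Strict Implicit.
Unset Printing Implicit Defensive.

Local Open Scope classical_set_scope.
Local Open Scope ring_scope.

(** [holomorphic_on] asserts complex differentiability at each point and no continuity of the
    derivative, so Cauchy's formula rests on Goursat's bisection of rectangles; circles are reached
    by a homotopy defined on a parameter rectangle. Interpolation is preferred to Taylor expansion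
    in several variables because it is a finite combination of values: it iterates over the
    variables with one-variable results only, and its values on a grid control it everywhere, with
    known growth. With [N = 4 * d] nodes per variable the error, [4 ^- N] up to a power of [N], is
    far below [exp (- d)], since [e <= 4]. Independence of the domain is [ent_growth_general] for
    the identity map. In (7) the singularities of [log |P_j|] are avoided by [ln (|P_j| ^ 2 + e)],
    continuous and sub-mean on circles; the potential is a decreasing limit of continuous functions,
    and monotone convergence carries the mean inequality to it. Continuity also permits a
    compactness argument: points where one stage of the sequence is nonnegative, which depend on the
    stage, yield a single point good for all stages. *)

Arguments cmod : simpl never.

(** * Modulus, limits and differentiability in the complex plane *)

Section Modulus.
Context {R : realType}.
Local Notation C := (CC R).
Implicit Types z w : C.
Local Notation Re := (@complex.Re R).
Local Notation Im := (@complex.Im R).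

Definition cR (x : R) : C := Complex x 0.

Lemma normCE z : `|z| = cR (cmod z).
Proof. by []. Qed.

Lemma cmod_ge0 z : 0 <= cmod z.
Proof. by case: z => a b; rewrite /cmod /=; exact: sqrtr_ge0. Qed.

Lemma cmod0 : cmod (0 : C) = 0.
Proof. exact: ComplexField.Normc.normc0. Qed.

Lemma cmod1 : cmod (1 : C) = 1.
Proof. exact: ComplexField.Normc.normc1. Qed.

Lemma cmodM z w : cmod (z * w) = cmod z * cmod w.
Proof. exact: ComplexField.Normc.normcM. Qed.

Lemma cmodN z : cmod (- z) = cmod z.
Proof. exact: normcN. Qed.

Lemma cmodD z w : cmod (z + w) <= cmod z + cmod w.
Proof. exact: le_normcD. Qed.

Lemma cmodB z w : cmod (z - w) <= cmod z + cmod w.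
Proof. by rewrite -(cmodN w) cmodD. Qed.

Lemma cmodBC z w : cmod (z - w) = cmod (w - z).
Proof. by rewrite -cmodN opprB. Qed.

Lemma cmodV z : cmod z^-1 = (cmod z)^-1.
Proof. exact: ComplexField.Normc.normcV. Qed.

Lemma cmod_eq0 z : (cmod z == 0) = (z == 0).
Proof.
apply/eqP/eqP => [/ComplexField.Normc.eq0_normc //|->]; exact: cmod0.
Qed.

Lemma cmod_gt0 z : (0 < cmod z) = (z != 0).
Proof. by rewrite lt_def cmod_ge0 cmod_eq0 andbT. Qed.

Lemma cmodX z n : cmod (z ^+ n) = cmod z ^+ n.
Proof. by elim: n => [|n IH]; rewrite ?expr0 ?cmod1// !exprS cmodM IH. Qed.

Lemma cmodR x : cmod (cR x) = `|x|.
Proof. by rewrite /cmod/= expr0n/= addr0 sqrtr_sqr. Qed.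

Lemma cRD x y : cR (x + y) = cR x + cR y.
Proof. exact: (rmorphD (real_complex R)). Qed.

Lemma cRN x : cR (- x) = - cR x.
Proof. exact: (rmorphN (real_complex R)). Qed.

Lemma cRB x y : cR (x - y) = cR x - cR y.
Proof. by rewrite cRD cRN. Qed.

Lemma cRM x y : cR (x * y) = cR x * cR y.
Proof. exact: (rmorphM (real_complex R)). Qed.

Lemma cR0 : cR 0 = 0. Proof. by []. Qed.

Lemma cR1 : cR 1 = 1. Proof. by []. Qed.

Lemma cR_nat n : cR n%:R = n%:R.
Proof. exact: (rmorph_nat (real_complex R)). Qed.

Lemma cR_le x y : (cR x <= cR y) = (x <= y).
Proof. exact: lecR. Qed.

Lemma cR_lt x y : (cR x < cR y) = (x < y).
Proof. exact: ltcR. Qed.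

Lemma cR_gt0P (e : C) : 0 < e -> e = cR (Re e) /\ 0 < Re e.
Proof. by case: e => a b; rewrite ltcE/= => /andP[/eqP -> ->]. Qed.

Lemma cmod_nat n : cmod (n%:R : C) = n%:R.
Proof. by rewrite -cR_nat cmodR ger0_norm. Qed.

Lemma cmod_sum (I : Type) (r : seq I) (P : pred I) (F : I -> C) :
  cmod (\sum_(i <- r | P i) F i) <= \sum_(i <- r | P i) cmod (F i).
Proof.
elim/big_ind2: _ => //; first by rewrite cmod0.
by move=> x1 x2 y1 y2 h1 h2; rewrite (le_trans (cmodD _ _)) ?lerD.
Qed.

Lemma cmod_prod (I : Type) (r : seq I) (P : pred I) (F : I -> C) :
  cmod (\prod_(i <- r | P i) F i) = \prod_(i <- r | P i) cmod (F i).
Proof.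
elim/big_ind2: _ => //; first by rewrite cmod1.
by move=> x1 x2 y1 y2 <- <-; rewrite cmodM.
Qed.

Lemma Re_le_cmod z : `|Re z| <= cmod z.
Proof. by have := normc_ge_Re z; rewrite lecR. Qed.

Lemma Im_le_cmod z : `|Im z| <= cmod z.
Proof.
by case: z => a b; rewrite /cmod/= -sqrtr_sqr ler_wsqrtr// lerDr sqr_ge0.
Qed.

Lemma cmod_sqr z : cmod z ^+ 2 = Re z ^+ 2 + Im z ^+ 2.
Proof. by case: z => a b; rewrite /cmod/= sqr_sqrtr// addr_ge0// sqr_ge0. Qed.

Lemma cmod_le_ReIm z : cmod z <= `|Re z| + `|Im z|.
Proof.
rewrite -(@ler_pXn2r _ 2) ?nnegrE ?cmod_ge0 ?addr_ge0// cmod_sqr.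
rewrite sqrrD !real_normK ?num_real// addrAC lerDl mulrn_wge0//.
Qed.

Lemma cReD z w : Re (z + w) = Re z + Re w.
Proof. by case: z w => [a b] [c d]. Qed.
Lemma cImD z w : Im (z + w) = Im z + Im w.
Proof. by case: z w => [a b] [c d]. Qed.
Lemma cReN z : Re (- z) = - Re z.
Proof. by case: z. Qed.
Lemma cImN z : Im (- z) = - Im z.
Proof. by case: z. Qed.
Lemma cReM z w : Re (z * w) = Re z * Re w - Im z * Im w.
Proof. by case: z w => [a b] [c d]. Qed.

(** Balls in [CC R] have radii in [CC R], because the norm takes its values there. This lemma and
    the next two pass to real radii once and for all. *)
Lemma ballCP (a : C) (e : R) z : ball a (cR e) z <-> cmod (a - z) < e.
Proof. by rewrite -ball_normE /ball_/= normCE cR_lt. Qed.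

Lemma nbhsCP (a : C) (A : set C) :
  nbhs a A <-> exists2 e : R, 0 < e & forall z, cmod (z - a) < e -> A z.
Proof.
split.
  move/nbhs_ballP => [e /= e0 eA]; have [ee e0'] := cR_gt0P e0.
  exists (Re e) => // z ze; apply: eA; rewrite ee; apply/ballCP.
  by rewrite cmodBC.
move=> [e e0 eA]; apply/nbhs_ballP; exists (cR e); first by rewrite /= -cR0 cR_lt.
by move=> z /ballCP ze; apply: eA; rewrite cmodBC.
Qed.

Lemma cvgCP (T : Type) (F : set_system T) (FF : Filter F) (f : T -> C) (a : C) :
  f @ F --> a <-> forall e : R, 0 < e -> \forall x \near F, cmod (f x - a) < e.
Proof.
split=> [fa e e0|H A /nbhsCP[e e0 eA]].
  by apply: (fa [set z | cmod (z - a) < e]); apply/nbhsCP; exists e.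
by apply: filterS (H e e0) => x; exact: eA.
Qed.

Lemma cmod_continuous : continuous (@cmod R : C -> R).
Proof.
move=> z; have FF : Filter (nbhs (z : C)) by exact: nbhs_filter.
apply/cvgrPdist_lt => e e0; apply/nbhsCP; exists e => // w wz.
apply: le_lt_trans wz; have := cmodD (z - w) w; rewrite subrK cmodBC.
have := cmodD (w - z) z; rewrite subrK ler_norml; lra.
Qed.

Lemma Re_continuous : continuous (Re : C -> R).
Proof.
move=> z; have FF : Filter (nbhs (z : C)) by exact: nbhs_filter.
apply/cvgrPdist_lt => e e0; apply/nbhsCP; exists e => // w wz.
by apply: le_lt_trans wz; rewrite -cReN -cReD (le_trans (Re_le_cmod _))// cmodBC.
Qed.

Lemma Im_continuous : continuous (Im : C -> R).
Proof.
move=> z; have FF : Filter (nbhs (z : C)) by exact: nbhs_filter.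
apply/cvgrPdist_lt => e e0; apply/nbhsCP; exists e => // w wz.
by apply: le_lt_trans wz; rewrite -cImN -cImD (le_trans (Im_le_cmod _))// cmodBC.
Qed.

Lemma cvg_Complex (T : Type) (F : set_system T) (FF : Filter F) (f g : T -> R) a b :
  f @ F --> a -> g @ F --> b -> (fun x => Complex (f x) (g x) : C) @ F --> (Complex a b : C).
Proof.
move=> fa gb; apply/cvgCP => e e0.
have e2 : 0 < e / 2 by rewrite divr_gt0.
move/cvgrPdist_lt : fa => /(_ _ e2) fa; move/cvgrPdist_lt : gb => /(_ _ e2) gb.
apply: filterS2 fa gb => x /= fx gx.
apply: (le_lt_trans (cmod_le_ReIm _)) => /=.
by rewrite (splitr e) ltrD// distrC.
Qed.

(** The differential is linear over the complex field, hence is multiplication by its value at [1]: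
    this is the complex derivative. *)
Lemma differentiable_expansion (f : C -> C) z : differentiable f z ->
  exists f' : C, forall e : R, 0 < e -> exists2 d : R, 0 < d &
    forall w, cmod (w - z) < d ->
      cmod (f w - f z - f' * (w - z)) <= e * cmod (w - z).
Proof.
move=> /diff_locallyP[dc df]; exists ('d f z 1) => e e0.
have /eqaddoP/(_ (cR e)) := df; rewrite -cR0 cR_lt => /(_ e0).
move=> /nbhsCP[d d0 dH]; exists d => // w wd.
have := dH (w - z); rewrite cR0 subr0 => /(_ wd).
have -> : (f \o shift z - (cst (f z) + 'd f z)) (w - z) =
    f w - f z - 'd f z 1 * (w - z).
  change (f (w - z + z) - (f z + 'd f z (w - z)) = f w - f z - 'd f z 1 * (w - z)).
  rewrite subrK opprD addrA; congr (_ - _).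
  have : 'd f z ((w - z) *: (1 : C)) = (w - z) *: 'd f z 1 by rewrite linearZ.
  by rewrite {1}/GRing.scale/= mulr1 => ->; rewrite mulrC.
by rewrite !normCE -cRM cR_le.
Qed.

End Modulus.

(** * Integrals of continuous functions over segments *)

Section RealIntegral.
Context {R : realType}.
Local Notation mu := (@lebesgue_measure R).
Implicit Types (f g : R -> R) (a b c : R).

Definition intab f a b : R := (\int[mu]_(x in `[a, b]) f x)%R.

(** Two-sided continuity at every point, endpoints included; it restricts to subintervals without
    any subspace topology. *)
Definition cont_on f a b := {in `[a, b], continuous f}.

Lemma cont_onS f a b a' b' : a <= a' -> b' <= b ->
  cont_on f a b -> cont_on f a' b'.
Proof.
move=> aa bb cf x; rewrite in_itv/= => /andP[xa xb]; apply: cf.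
by rewrite in_itv/= (le_trans aa)// (le_trans xb).
Qed.

Lemma cont_onD f g a b : cont_on f a b -> cont_on g a b ->
  cont_on (fun x => f x + g x) a b.
Proof. by move=> cf cg x xab; apply: continuousD; [exact: cf|exact: cg]. Qed.

Lemma cont_onB f g a b : cont_on f a b -> cont_on g a b ->
  cont_on (fun x => f x - g x) a b.
Proof. by move=> cf cg x xab; apply: continuousB; [exact: cf|exact: cg]. Qed.

Lemma cont_onZ f k a b : cont_on f a b -> cont_on (fun x => k * f x) a b.
Proof.
by move=> cf x xab; apply: continuousM; [exact: cst_continuous|exact: cf].
Qed.

Lemma cont_on_cst k a b : cont_on (fun=> k) a b.
Proof. by move=> x _; exact: cst_continuous. Qed.

Lemma cont_on_integrable f a b : cont_on f a b ->
  mu.-integrable `[a, b] (EFin \o f).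
Proof.
move=> cf; apply: continuous_compact_integrable; first exact: segment_compact.
by apply: continuous_in_subspaceT => x /set_mem xab; exact: cf.
Qed.

Lemma mu_itvE a b : a <= b -> fine (mu `[a, b]) = b - a.
Proof.
rewrite lebesgue_measure_itv/= lte_fin le_eqVlt => /predU1P[->|->//].
by rewrite ltxx subrr.
Qed.

Lemma intab_cst k a b : a <= b -> intab (fun=> k) a b = k * (b - a).
Proof. by move=> ab; rewrite /intab Rintegral_cst// mu_itvE. Qed.

Lemma intabD f g a b : cont_on f a b -> cont_on g a b ->
  intab (fun x => f x + g x) a b = intab f a b + intab g a b.
Proof. by move=> cf cg; rewrite /intab RintegralD//; exact: cont_on_integrable. Qed.

Lemma intabB f g a b : cont_on f a b -> cont_on g a b ->
  intab (fun x => f x - g x) a b = intab f a b - intab g a b.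
Proof. by move=> cf cg; rewrite /intab RintegralB//; exact: cont_on_integrable. Qed.

Lemma intabZ f k a b : cont_on f a b ->
  intab (fun x => k * f x) a b = k * intab f a b.
Proof. by move=> cf; rewrite /intab RintegralZl//; exact: cont_on_integrable. Qed.

Lemma le_intab f g a b : cont_on f a b -> cont_on g a b ->
  (forall x, a <= x <= b -> f x <= g x) -> intab f a b <= intab g a b.
Proof.
move=> cf cg fg; apply: le_Rintegral => //; try exact: cont_on_integrable.
Qed.

Lemma eq_intab f g a b : (forall x, a <= x <= b -> f x = g x) ->
  intab f a b = intab g a b.
Proof. by move=> fg; apply: eq_Rintegral => x /set_mem /=; rewrite in_itv; exact: fg. Qed.

Lemma intab_bound f a b k : a <= b -> cont_on f a b ->
  (forall x, a <= x <= b -> `|f x| <= k) -> `|intab f a b| <= k * (b - a).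
Proof.
move=> ab cf fk; rewrite ler_norml -mulNr -!intab_cst//.
by apply/andP; split; apply: le_intab => //; try exact: cont_on_cst;
  move=> x /fk; rewrite ler_norml => /andP[].
Qed.

Lemma intab_split f a b c : a <= c -> c <= b -> cont_on f a b ->
  intab f a b = intab f a c + intab f c b.
Proof.
move=> ac cb cf; have := @Rintegral_itvB R f (BLeft a) (BRight b) c.
move=> /(_ (cont_on_integrable cf)); rewrite !bnd_simp => /(_ ac cb).
rewrite -/(intab f a b) -/(intab f a c) => /eqP; rewrite subr_eq addrC => /eqP ->.
congr (_ + _); rewrite Rintegral_itv_obnd_cbnd//.
have cf' := cont_on_integrable (cont_onS ac (lexx b) cf).
apply: integrableS cf' => //.
by apply: subset_itvr; rewrite bnd_simp.
Qed.

End RealIntegral.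

(** * Goursat's theorem and Cauchy's formula on circles *)

Section Goursat.
Context {R : realType}.
Variables P Q : R -> R -> R.
Implicit Types a b c d x y : R.

(** The integral of the form [P dx + Q dy] along the boundary of [[a, b] x [c, d]],
    counterclockwise. *)
Definition rect_int a b c d : R :=
  intab (fun x => P x c - P x d) a b + intab (fun y => Q b y - Q a y) c d.

(** [P] and [Q] are differentiable at the point, and the shared [B] says that the [y]-derivative of
    [P] equals the [x]-derivative of [Q]: pointwise closedness of [P dx + Q dy]. *)
Definition closed_form_at x0 y0 : Prop :=
  exists A B E : R, forall e, 0 < e -> exists2 r, 0 < r & forall x y,
    `|x - x0| < r -> `|y - y0| < r ->
    `|P x y - P x0 y0 - A * (x - x0) - B * (y - y0)| <= e * (`|x - x0| + `|y - y0|) /\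
    `|Q x y - Q x0 y0 - B * (x - x0) - E * (y - y0)| <= e * (`|x - x0| + `|y - y0|).

Lemma expansion_continuous (f : R -> R) x0 A :
  (forall e, 0 < e -> exists2 r, 0 < r & forall x, `|x - x0| < r ->
     `|f x - f x0 - A * (x - x0)| <= e * `|x - x0|) ->
  {for x0, continuous f}.
Proof.
move=> H; have [r r0 Hr] := H _ ltr01.
apply/cvgrPdist_lt => e e0.
have A0 : 0 < `|A| + 1 by rewrite ltr_wpDl.
apply/nbhs_ballP; exists (Num.min r (e / (`|A| + 1))) => /=.
  by rewrite lt_min r0 divr_gt0.
move=> x; rewrite /ball/= lt_min => /andP[]; rewrite distrC => xr.
rewrite ltr_pdivlMr// => xe; have := Hr x xr; rewrite mul1r => {}Hr.
rewrite distrC; apply: le_lt_trans xe.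
rewrite -(subrK (A * (x - x0)) (f x - f x0)).
rewrite (le_trans (ler_normD _ _))//.
have -> : `|x - x0| * (`|A| + 1) = `|x - x0| + `|A| * `|x - x0| by ring.
by rewrite lerD// normrM.
Qed.

Lemma closed_form_cont_P a b y : (forall x, a <= x <= b -> closed_form_at x y) ->
  cont_on (fun x => P x y) a b.
Proof.
move=> H x; rewrite in_itv/= => /H[A [B [E F]]].
apply: (@expansion_continuous _ _ A) => e /F[r r0 Fr]; exists r => // z zr.
have [] := Fr z y zr; first by rewrite subrr normr0.
by rewrite subrr normr0 !addr0 mulr0 subr0.
Qed.

Lemma closed_form_cont_Q c d x : (forall y, c <= y <= d -> closed_form_at x y) ->
  cont_on (fun y => Q x y) c d.
Proof.
move=> H y; rewrite in_itv/= => /H[A [B [E F]]].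
apply: (@expansion_continuous _ _ E) => e /F[r r0 Fr]; exists r => // z zr.
by have := Fr x z; rewrite subrr normr0 !mulr0 !subr0 add0r => /(_ r0 zr)[].
Qed.

Definition closed_form_on a b c d :=
  forall x y, a <= x <= b -> c <= y <= d -> closed_form_at x y.

Lemma rect_int_splitx a b c d m : a <= m -> m <= b -> c <= d ->
  closed_form_on a b c d ->
  rect_int a b c d = rect_int a m c d + rect_int m b c d.
Proof.
move=> am mb cd H; have ab := le_trans am mb.
have cP y : c <= y <= d -> cont_on (fun x => P x y) a b.
  by move=> yc; apply: closed_form_cont_P => x xab; apply: H.
have cQ x : a <= x <= b -> cont_on (fun y => Q x y) c d.
  by move=> yc; apply: closed_form_cont_Q => y yab; apply: H.
rewrite /rect_int (@intab_split _ _ _ _ m)//; last first.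
  by apply: cont_onB; apply: cP; rewrite lexx cd.
have -> : intab (fun y => Q b y - Q a y) c d =
   intab (fun y => Q m y - Q a y) c d + intab (fun y => Q b y - Q m y) c d.
  rewrite -intabD; last 2 first.
  - by apply: cont_onB; apply: cQ; rewrite ?lexx ?am ?mb ?ab.
  - by apply: cont_onB; apply: cQ; rewrite ?lexx ?am ?mb ?ab.
  by apply: eq_intab => y _; ring.
ring.
Qed.

Lemma rect_int_splity a b c d m : a <= b -> c <= m -> m <= d ->
  closed_form_on a b c d ->
  rect_int a b c d = rect_int a b c m + rect_int a b m d.
Proof.
move=> ab cm md H; have cd := le_trans cm md.
have cP y : c <= y <= d -> cont_on (fun x => P x y) a b.
  by move=> yc; apply: closed_form_cont_P => x xab; apply: H.
have cQ x : a <= x <= b -> cont_on (fun y => Q x y) c d.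
  by move=> yc; apply: closed_form_cont_Q => y yab; apply: H.
rewrite /rect_int (@intab_split _ (fun y => Q b y - Q a y) _ _ m)//; last first.
  by apply: cont_onB; apply: cQ; rewrite lexx ab.
have -> : intab (fun x => P x c - P x d) a b =
   intab (fun x => P x c - P x m) a b + intab (fun x => P x m - P x d) a b.
  rewrite -intabD; last 2 first.
  - by apply: cont_onB; apply: cP; rewrite ?lexx ?cm ?md ?cd.
  - by apply: cont_onB; apply: cP; rewrite ?lexx ?cm ?md ?cd.
  by apply: eq_intab => y _; ring.
ring.
Qed.

(** The affine parts integrate to zero around the rectangle because they share [B]; only the
    remainders, of size [e], are left, once on each of the four sides. *)
Lemma rect_int_local a b c d e x0 y0 A B E : a <= b -> c <= d ->
  closed_form_on a b c d -> 0 <= e ->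
  (forall x y, a <= x <= b -> c <= y <= d ->
    `|P x y - P x0 y0 - A * (x - x0) - B * (y - y0)| <= e /\
    `|Q x y - Q x0 y0 - B * (x - x0) - E * (y - y0)| <= e) ->
  `|rect_int a b c d| <= 2 * e * ((b - a) + (d - c)).
Proof.
move=> ab cd H e0 K.
have cP y : c <= y <= d -> cont_on (fun x => P x y) a b.
  by move=> yc; apply: closed_form_cont_P => x xab; apply: H.
have cQ x : a <= x <= b -> cont_on (fun y => Q x y) c d.
  by move=> yc; apply: closed_form_cont_Q => y yab; apply: H.
have hc : c <= c <= d by rewrite lexx.
have hd : c <= d <= d by rewrite lexx cd.
have ha : a <= a <= b by rewrite lexx.
have hb : a <= b <= b by rewrite lexx ab.
have -> : rect_int a b c d =
  intab (fun x => (P x c - P x d) + B * (d - c)) a b +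
  intab (fun y => (Q b y - Q a y) - B * (b - a)) c d.
  rewrite intabD ?intabB ?intab_cst//; last 6 first.
  - by apply: cont_onB; exact: cQ.
  - exact: cont_on_cst.
  - by exact: cP.
  - by exact: cP.
  - by apply: cont_onB; exact: cP.
  - exact: cont_on_cst.
  rewrite /rect_int intabB; [|exact: cP|exact: cP].
  - by rewrite intabB; [ring|exact: cQ|exact: cQ].
  - exact: cQ.
  - exact: cQ.
rewrite (le_trans (ler_normD _ _))// [leRHS]mulrDr lerD//; apply: intab_bound => //.
- by apply: cont_onD; [apply: cont_onB; exact: cP|exact: cont_on_cst].
- move=> x xab; have [+ _] := K x c xab hc; have [+ _] := K x d xab hd.
  rewrite !ler_norml => /andP[h1 h2] /andP[h3 h4]; apply/andP; split; lra.
- by apply: cont_onB; [apply: cont_onB; exact: cQ|exact: cont_on_cst].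
- move=> y ycd; have [_ +] := K a y ha ycd; have [_ +] := K b y hb ycd.
  rewrite !ler_norml => /andP[h1 h2] /andP[h3 h4]; apply/andP; split; lra.
Qed.

Lemma rect_int_quarter a c u v eta : 0 <= u -> 0 <= v ->
  closed_form_on a (a + 2 * u) c (c + 2 * v) ->
  eta < `|rect_int a (a + 2 * u) c (c + 2 * v)| ->
  exists a' c', [/\ a <= a' <= a + u, c <= c' <= c + v &
    eta / 4 < `|rect_int a' (a' + u) c' (c' + v)|].
Proof.
move=> u0 v0 H.
have au : a <= a + u by rewrite lerDl.
have au2 : a + u <= a + 2 * u by lra.
have cv : c <= c + v by rewrite lerDl.
have cv2 : c + v <= c + 2 * v by lra.
rewrite (@rect_int_splitx _ _ _ _ (a + u))//; last by lra.
rewrite (@rect_int_splity a _ _ _ (c + v))//; last first.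
  by move=> x y /andP[xa xb]; apply: H; rewrite xa (le_trans xb).
rewrite (@rect_int_splity (a + u) _ _ _ (c + v))//; last first.
  by move=> x y /andP[xa xb]; apply: H; rewrite (le_trans _ xa).
have -> : a + 2 * u = a + u + u by ring.
have -> : c + 2 * v = c + v + v by ring.
set I1 := rect_int a _ c _; set I2 := rect_int a _ (c + v) _.
set I3 := rect_int (a + u) _ c _; set I4 := rect_int (a + u) _ (c + v) _.
move=> etaI; apply: contrapT => N.
have {}N a' c' : a <= a' <= a + u -> c <= c' <= c + v ->
    `|rect_int a' (a' + u) c' (c' + v)| <= eta / 4.
  by move=> ha hc; rewrite leNgt; apply/negP => h; apply: N; exists a', c'.
have n1 : `|I1| <= eta / 4 by apply: N; rewrite lexx/=; lra.
have n2 : `|I2| <= eta / 4 by apply: N; rewrite lexx/=; lra.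
have n3 : `|I3| <= eta / 4 by apply: N; rewrite lexx/=; lra.
have n4 : `|I4| <= eta / 4 by apply: N; rewrite lexx/=; lra.
have := ler_normD (I1 + I2) (I3 + I4).
have := ler_normD I1 I2; have := ler_normD I3 I4; lra.
Qed.

(** Bisection: nested quarters, each keeping more than a quarter of the previous bound, shrink to a
    point where the first-order expansion bounds the boundary integral by [o (4 ^- k)]. *)
Theorem goursat a b c d : a <= b -> c <= d -> closed_form_on a b c d ->
  rect_int a b c d = 0.
Proof.
move=> ab cd H; apply/eqP; rewrite -normr_eq0 eq_le normr_ge0 andbT leNgt.
apply/negP => I0; set w := b - a; set h := d - c.
have w0 : 0 <= w by rewrite subr_ge0.
have h0 : 0 <= h by rewrite subr_ge0.
(* Half of the integral, so that the invariant of [good] starts as a strict inequality. *)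
pose eta := `|rect_int a b c d| / 2.
have eta0 : 0 < eta by rewrite divr_gt0.
pose W k := w / 2 ^+ k; pose V k := h / 2 ^+ k.
have W0 k : 0 <= W k by rewrite divr_ge0// exprn_ge0.
have V0 k : 0 <= V k by rewrite divr_ge0// exprn_ge0.
have WS k : W k = 2 * W k.+1.
  by rewrite /W exprS invfM; field; rewrite expf_neq0.
have VS k : V k = 2 * V k.+1.
  by rewrite /V exprS invfM; field; rewrite expf_neq0.
pose good k (p : R * R) := [/\ a <= p.1, p.1 + W k <= b, c <= p.2, p.2 + V k <= d &
   eta / 4 ^+ k < `|rect_int p.1 (p.1 + W k) p.2 (p.2 + V k)|].
have good_closed k p : good k p ->
    closed_form_on p.1 (p.1 + W k) p.2 (p.2 + V k).
  move=> [h1 h2 h3 h4 _] x y /andP[x1 x2] /andP[y1 y2]; apply: H.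
    by rewrite (le_trans h1)// (le_trans x2).
  by rewrite (le_trans h3)// (le_trans y2).
have step k p : exists q, good k p -> good k.+1 q /\
    [/\ p.1 <= q.1 & q.1 + W k.+1 <= p.1 + W k] /\
    [/\ p.2 <= q.2 & q.2 + V k.+1 <= p.2 + V k].
  have [gp|] := pselect (good k p); last by exists p.
  have gc := good_closed _ _ gp; case: gp => h1 h2 h3 h4.
  move: gc; rewrite (WS k) (VS k) => gc hI.
  have [a' [c' [/andP[a1 a2] /andP[c1 c2] hI']]] :=
    rect_int_quarter (W0 _) (V0 _) gc hI.
  exists (a', c') => _; split; last by split; split => //=; lra.
  split => //=.
  - exact: le_trans a1.
  - by rewrite (le_trans _ h2)// (WS k); lra.
  - exact: le_trans c1.
  - by rewrite (le_trans _ h4)// (VS k); lra.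
  - by apply: le_lt_trans hI'; rewrite exprS invfM; lra.
have [nx nxP] : {nx : nat -> R * R -> R * R & forall k p, good k p ->
    good k.+1 (nx k p) /\
    [/\ p.1 <= (nx k p).1 & (nx k p).1 + W k.+1 <= p.1 + W k] /\
    [/\ p.2 <= (nx k p).2 & (nx k p).2 + V k.+1 <= p.2 + V k]}.
  exists (fun k p => sval (cid (step k p))) => k p.
  by case: cid => q /=.
pose s := fix s k := if k is k'.+1 then nx k' (s k') else (a, c).
have gs k : good k (s k).
  elim: k => [|k IH]; last by have [] := nxP _ _ (IH).
  have aW : a + W 0%N = b by rewrite /W expr0 divr1 /w addrC subrK.
  have cV : c + V 0%N = d by rewrite /V expr0 divr1 /h addrC subrK.
  rewrite /good [s 0%N]/= [(a, c).1]/= [(a, c).2]/= aW cV expr0 divr1.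
  by split; rewrite ?lexx// /eta; lra.
have smono k j : (k <= j)%N ->
    [/\ (s k).1 <= (s j).1, (s j).1 + W j <= (s k).1 + W k,
        (s k).2 <= (s j).2 & (s j).2 + V j <= (s k).2 + V k].
  elim: j => [|j IH]; first by rewrite leqn0 => /eqP ->.
  rewrite leq_eqVlt => /predU1P[->//|/IH[h1 h2 h3 h4]].
  have [_ [[g1 g2] [g3 g4]]] := nxP _ _ (gs j).
  split; [exact: le_trans g1|exact: le_trans h2|exact: le_trans g3|exact: le_trans h4].
have sbd k j : (s j).1 <= (s k).1 + W k /\ (s j).2 <= (s k).2 + V k.
  case: (leqP k j) => [kj|/ltnW jk].
    have [h1 h2 h3 h4] := smono _ _ kj.
    by split; [apply: le_trans h2|apply: le_trans h4]; rewrite lerDl.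
  have [h1 h2 h3 h4] := smono _ _ jk.
  by split; [apply: le_trans h1 _|apply: le_trans h3 _]; rewrite lerDl.
(* The lower left corners increase and stay below every upper right corner, so their suprema give a
   point common to all the rectangles. *)
pose Sx := range (fun k => (s k).1); pose Sy := range (fun k => (s k).2).
have supx : has_sup Sx.
  split; first by exists (s 0).1; exists 0%N.
  by exists ((s 0).1 + W 0) => _ [k _ <-]; have [] := sbd 0%N k.
have supy : has_sup Sy.
  split; first by exists (s 0).2; exists 0%N.
  by exists ((s 0).2 + V 0) => _ [k _ <-]; have [] := sbd 0%N k.
pose x0 := sup Sx; pose y0 := sup Sy.
have hx0 k : (s k).1 <= x0 <= (s k).1 + W k.
  apply/andP; split; first by apply: sup_upper_bound => //; exists k.
  by apply: ge_sup; [exact: supx.1|move=> _ [j _ <-]; have [] := sbd k j].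
have hy0 k : (s k).2 <= y0 <= (s k).2 + V k.
  apply/andP; split; first by apply: sup_upper_bound => //; exists k.
  by apply: ge_sup; [exact: supy.1|move=> _ [j _ <-]; have [] := sbd k j].
have [A [B [E F]]] : closed_form_at x0 y0.
  have [g1 g2 g3 g4 _] := gs 0%N; have /andP[x1 x2] := hx0 0%N.
  have /andP[y1 y2] := hy0 0%N.
  by apply: H; rewrite (le_trans g1, le_trans g3)//= (le_trans x2, le_trans y2).
have wh : 0 < w + h + 1 by rewrite ltr_wpDl// addr_ge0.
(* Chosen so that [2 e (W k + V k) ^ 2] is at most [eta / 4 ^ k]; the [+ 1] covers degenerate
   rectangles. *)
pose e := eta / (2 * (w + h + 1) ^+ 2).
have e0 : 0 < e by rewrite divr_gt0// mulr_gt0// exprn_gt0.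
have [r r0 Fr] := F e e0.
have [k Wk Vk] : exists2 k, W k < r & V k < r.
  have [k hk] : exists k, (w + h + 1) / r < 2 ^+ k.
    exists (Num.trunc ((w + h + 1) / r)).+1.
    rewrite (lt_trans (truncnS_gt _))// -natrX ltr_nat.
    exact: ltn_expl.
  have k0 : (0 : R) < 2 ^+ k by rewrite exprn_gt0.
  by exists k; rewrite ltr_pdivrMr//; move: hk; rewrite ltr_pdivrMr// mulrC => hk; lra.
have [g1 g2 g3 g4 g5] := gs k; have /andP[x1 x2] := hx0 k; have /andP[y1 y2] := hy0 k.
have : `|rect_int (s k).1 ((s k).1 + W k) (s k).2 ((s k).2 + V k)| <=
    2 * (e * (W k + V k)) * (W k + V k).
  have := @rect_int_local (s k).1 ((s k).1 + W k) (s k).2 ((s k).2 + V k)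
    (e * (W k + V k)) x0 y0 A B E.
  rewrite [(s k).1 + _]addrC [(s k).2 + _]addrC !addrK; apply.
  - by rewrite lerDr.
  - by rewrite lerDr.
  - by rewrite ![W k + _]addrC ![V k + _]addrC; exact: good_closed.
  - by rewrite mulr_ge0 ?addr_ge0// ltW.
  move=> x y; rewrite ![W k + _]addrC ![V k + _]addrC => /andP[x3 x4] /andP[y3 y4].
  have xx : `|x - x0| <= W k by rewrite ler_norml; lra.
  have yy : `|y - y0| <= V k by rewrite ler_norml; lra.
  have [] := Fr x y (le_lt_trans xx Wk) (le_lt_trans yy Vk).
  by move=> f1 f2; split; [apply: le_trans f1 _|apply: le_trans f2 _];
    rewrite ler_pM2l// addrC [in leRHS]addrC lerD.
move/(lt_le_trans g5); apply/negP; rewrite -leNgt.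
have -> : 2 * (e * (W k + V k)) * (W k + V k) =
   (eta / 4 ^+ k) * ((w + h) ^+ 2 / (w + h + 1) ^+ 2).
  have -> : (4 : R) ^+ k = 2 ^+ k * 2 ^+ k by rewrite -exprMn; congr (_ ^+ _); ring.
  by rewrite /e /W /V; field; rewrite expf_neq0 ?gt_eqF.
apply: ler_piMr; first by rewrite divr_ge0 ?exprn_ge0// ltW.
by rewrite ler_pdivrMr ?exprn_gt0// mul1r lerXn2r ?nnegrE; lra.
Qed.

End Goursat.

(** * First-order expansions of complex functions of two real variables *)

Section TwoVariableExpansion.
Context {R : realType}.
Local Notation C := (CC R).
Implicit Types G H : R -> R -> C.

Definition dexp2 G x0 y0 (A B : C) := forall e : R, 0 < e ->
  exists2 r : R, 0 < r & forall x y, `|x - x0| < r -> `|y - y0| < r ->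
    cmod (G x y - G x0 y0 - A * cR (x - x0) - B * cR (y - y0))
      <= e * (`|x - x0| + `|y - y0|).

Definition cexp (f : C -> C) (z f' : C) := forall e : R, 0 < e -> exists2 d : R, 0 < d &
    forall w, cmod (w - z) < d ->
      cmod (f w - f z - f' * (w - z)) <= e * cmod (w - z).

Lemma dexp2_lip G x0 y0 A B : dexp2 G x0 y0 A B ->
  exists2 L : R, 0 < L & exists2 r : R, 0 < r &
    forall x y, `|x - x0| < r -> `|y - y0| < r ->
    cmod (G x y - G x0 y0) <= L * (`|x - x0| + `|y - y0|).
Proof.
move=> /(_ _ ltr01)[r r0 H]; exists (1 + cmod A + cmod B).
  by rewrite ltr_wpDr ?cmod_ge0// ltr_wpDr ?cmod_ge0.
exists r => // x y xr yr; have := H x y xr yr; rewrite mul1r.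
set u := `|x - x0|; set v := `|y - y0| => {}H.
have -> : G x y - G x0 y0 = (G x y - G x0 y0 - A * cR (x - x0) - B * cR (y - y0))
   + A * cR (x - x0) + B * cR (y - y0) by ring.
have h1 := cmodD (G x y - G x0 y0 - A * cR (x - x0) - B * cR (y - y0)
  + A * cR (x - x0)) (B * cR (y - y0)).
have h2 := cmodD (G x y - G x0 y0 - A * cR (x - x0) - B * cR (y - y0))
  (A * cR (x - x0)).
move: h1 h2; rewrite [cmod (A * _)]cmodM [cmod (B * _)]cmodM !cmodR -/u -/v => h1 h2.
have u0 : 0 <= u by rewrite /u.
have v0 : 0 <= v by rewrite /v.
have a0 := cmod_ge0 A; have b0 := cmod_ge0 B.
have := mulr_ge0 a0 v0; have := mulr_ge0 b0 u0; nra.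
Qed.

Lemma dexp2_comp (f : C -> C) f' G x0 y0 A B : dexp2 G x0 y0 A B ->
  cexp f (G x0 y0) f' ->
  dexp2 (fun x y => f (G x y)) x0 y0 (f' * A) (f' * B).
Proof.
move=> dG df e e0; have [L L0 [r1 r10 HL]] := dexp2_lip dG.
have e1 : 0 < e / (2 * L) by rewrite divr_gt0// mulr_gt0.
have [d d0 Hd] := df _ e1.
have c0 := cmod_ge0 f'.
have e2 : 0 < e / (2 * (cmod f' + 1)) by rewrite divr_gt0// mulr_gt0// ltr_wpDl.
have [r2 r20 H2] := dG _ e2.
exists (Num.min (Num.min r1 r2) (d / (2 * L))).
  by rewrite !lt_min r10 r20 divr_gt0// mulr_gt0.
move=> x y; rewrite !lt_min => /andP[/andP[x1 x2] x3] /andP[/andP[y1 y2] y3].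
have {HL}hL := HL x y x1 y1; have {H2}h2 := H2 x y x2 y2.
set u := `|x - x0| in x1 x2 x3 hL h2 *; set v := `|y - y0| in y1 y2 y3 hL h2 *.
have uv0 : 0 <= u + v by rewrite addr_ge0 ?/u ?/v.
have L2 : 0 < 2 * L by rewrite mulr_gt0.
have /Hd {}Hd : cmod (G x y - G x0 y0) < d.
  apply: le_lt_trans hL _; move: x3 y3; rewrite !ltr_pdivlMr//; nra.
have -> : f (G x y) - f (G x0 y0) - f' * A * cR (x - x0) - f' * B * cR (y - y0) =
  (f (G x y) - f (G x0 y0) - f' * (G x y - G x0 y0)) +
  f' * (G x y - G x0 y0 - A * cR (x - x0) - B * cR (y - y0)) by ring.
rewrite (le_trans (cmodD _ _))// cmodM.
have -> : e * (u + v) = e / (2 * L) * (L * (u + v)) +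
   (cmod f' + 1) * (e / (2 * (cmod f' + 1)) * (u + v)).
  by field; rewrite !gt_eqF// ltr_wpDl.
rewrite lerD//; first by rewrite (le_trans Hd)// ler_wpM2l// ltW.
rewrite ler_pM ?cmod_ge0//; lra.
Qed.

Lemma dexp2_ext G H x0 y0 A B A' B' : (forall x y, G x y = H x y) -> A = A' -> B = B' ->
  dexp2 G x0 y0 A B -> dexp2 H x0 y0 A' B'.
Proof.
move=> GH <- <- dG e /dG[r r0 K]; exists r => // x y /K + /[dup] yr => /(_ y yr).
by rewrite !GH.
Qed.

Lemma dexp2_cst (k : C) x0 y0 : dexp2 (fun _ _ => k) x0 y0 0 0.
Proof.
move=> e e0; exists 1 => // x y _ _; rewrite subrr !mul0r !subr0 cmod0.
by rewrite mulr_ge0 ?addr_ge0// ltW.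
Qed.

Lemma dexp2_fst x0 y0 : dexp2 (fun x _ => cR x) x0 y0 1 0.
Proof.
move=> e e0; exists 1 => // x y _ _; rewrite mul1r mul0r subr0 cRB subrr cmod0.
by rewrite mulr_ge0 ?addr_ge0// ltW.
Qed.

Lemma dexp2D G H x0 y0 A B A' B' : dexp2 G x0 y0 A B -> dexp2 H x0 y0 A' B' ->
  dexp2 (fun x y => G x y + H x y) x0 y0 (A + A') (B + B').
Proof.
move=> dG dH e e0; have e2 : 0 < e / 2 by rewrite divr_gt0.
have [r1 r10 h1] := dG _ e2; have [r2 r20 h2] := dH _ e2.
exists (Num.min r1 r2); first by rewrite lt_min r10.
move=> x y; rewrite !lt_min => /andP[x1 x2] /andP[y1 y2].
have {}h1 := h1 x y x1 y1; have {}h2 := h2 x y x2 y2.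
have -> : G x y + H x y - (G x0 y0 + H x0 y0) - (A + A') * cR (x - x0) -
  (B + B') * cR (y - y0) =
  (G x y - G x0 y0 - A * cR (x - x0) - B * cR (y - y0)) +
  (H x y - H x0 y0 - A' * cR (x - x0) - B' * cR (y - y0)) by ring.
by rewrite (le_trans (cmodD _ _))//; lra.
Qed.

Lemma cexpX2 (z : C) : cexp (fun w => w ^+ 2) z (2 * z).
Proof.
move=> e e0; exists e => // w wz.
have -> : w ^+ 2 - z ^+ 2 - 2 * z * (w - z) = (w - z) * (w - z) by ring.
by rewrite cmodM ler_wpM2r ?cmod_ge0// ltW.
Qed.

Lemma cexpZ (k z : C) : cexp (fun w => k * w) z k.
Proof.
move=> e e0; exists 1 => // w wz; rewrite -!mulrBr subrr mulr0 cmod0.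
by rewrite mulr_ge0 ?cmod_ge0// ltW.
Qed.

(** Polarisation: the product is half of [(G + H) ^ 2 - G ^ 2 - H ^ 2], so sums and composition with
    the square suffice. *)
Lemma dexp2M G H x0 y0 A B A' B' : dexp2 G x0 y0 A B -> dexp2 H x0 y0 A' B' ->
  dexp2 (fun x y => G x y * H x y) x0 y0
    (A * H x0 y0 + G x0 y0 * A') (B * H x0 y0 + G x0 y0 * B').
Proof.
move=> dG dH; have dS := dexp2D dG dH.
have := dexp2D (dexp2_comp dS (cexpX2 _))
  (dexp2_comp (dexp2D (dexp2_comp dG (cexpX2 _)) (dexp2_comp dH (cexpX2 _)))
     (cexpZ (-1) _)).
have two0 : (2 : C) != 0 by rewrite pnatr_eq0.
move=> /dexp2_comp /(_ (cexpZ (2^-1) _)); apply: dexp2_ext => [x y||]; by field.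
Qed.

Lemma cexp_inv (z : C) : z != 0 -> cexp GRing.inv z (- (z ^+ 2)^-1).
Proof.
move=> z0; have m0 : 0 < cmod z by rewrite cmod_gt0.
move=> e e0; exists (Num.min (cmod z / 2) (e * cmod z ^+ 3 / 2)).
  by rewrite lt_min !divr_gt0// mulr_gt0// exprn_gt0.
move=> w; rewrite lt_min => /andP[w1 w2].
have wm : cmod z / 2 < cmod w.
  have := cmodD (z - w) w; rewrite subrK cmodBC; lra.
have w0 : w != 0 by rewrite -cmod_gt0; lra.
have -> : w^-1 - z^-1 - (- (z ^+ 2)^-1) * (w - z) = (w - z) * (w - z) / (w * z ^+ 2).
  by field; rewrite z0.
rewrite !(cmodM, cmodV, cmodX).
have p0 : 0 < cmod w * cmod z ^+ 2 by rewrite mulr_gt0 ?exprn_gt0//; lra.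
rewrite ler_pdivrMr// mulrAC ler_wpM2r ?cmod_ge0//.
rewrite (le_trans (ltW w2))// -mulrA ler_wpM2l ?(ltW e0)//.
rewrite exprSr -mulrA mulrC ler_wpM2r ?exprn_ge0 ?cmod_ge0//; exact: ltW.
Qed.

Lemma dexp2V G x0 y0 A B : dexp2 G x0 y0 A B -> G x0 y0 != 0 ->
  dexp2 (fun x y => (G x y)^-1) x0 y0
    (- (G x0 y0 ^+ 2)^-1 * A) (- (G x0 y0 ^+ 2)^-1 * B).
Proof. by move=> dG G0; apply: dexp2_comp dG (cexp_inv G0). Qed.

Lemma dexp2_Re G H x0 y0 A B E : dexp2 G x0 y0 A B -> dexp2 H x0 y0 B E ->
  closed_form_at (fun x y => complex.Re (G x y)) (fun x y => complex.Re (H x y)) x0 y0.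
Proof.
move=> dG dH; exists (complex.Re A), (complex.Re B), (complex.Re E) => e e0.
have [r1 r10 h1] := dG _ e0; have [r2 r20 h2] := dH _ e0.
exists (Num.min r1 r2); first by rewrite lt_min r10.
move=> x y; rewrite !lt_min => /andP[x1 x2] /andP[y1 y2].
have Rec (a : C) k : complex.Re a * k = complex.Re (a * cR k).
  by rewrite cReM /= mulr0 subr0.
split.
  apply: le_trans (h1 x y x1 y1); apply: le_trans (Re_le_cmod _).
  by rewrite !Rec -!cReN -!cReD.
apply: le_trans (h2 x y x2 y2); apply: le_trans (Re_le_cmod _).
by rewrite !Rec -!cReN -!cReD.
Qed.

Definition ei (t : R) : C := Complex (cos t) (sin t).

Lemma cmod_ei t : cmod (ei t) = 1.
Proof. by rewrite /cmod/= cos2Dsin2 sqrtr1. Qed.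

Lemma real_expansion (h : R -> R) (x0 dh : R) : is_derive x0 (1 : R) h dh ->
  forall e, 0 < e -> exists2 r, 0 < r & forall x, `|x - x0| < r ->
     `|h x - h x0 - dh * (x - x0)| <= e * `|x - x0|.
Proof.
move=> H e e0; have [/derivable_nbhsP dh1 <-] := H.
have /eqaddoP/(_ e e0) := dh1; rewrite near_simpl => /nbhs_ballP[r r0 K].
exists r => // x xr; have := K (x - x0).
rewrite /ball/= sub0r normrN => /(_ xr).
set lhs := (X in `|X| <= _ -> _).
have -> : lhs = h x - h x0 - 'D_1 h x0 * (x - x0).
  rewrite /lhs.
  change (h ((x - x0) *: 1 + x0) - (h x0 + (x - x0) *: 'D_1 h x0)
   = h x - h x0 - 'D_1 h x0 * (x - x0)).
  by rewrite [_ *: 1]mulr1 subrK opprD addrA [_ *: _]mulrC.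
by [].
Qed.

Lemma dexp2_ei x0 y0 : dexp2 (fun _ y => ei y) x0 y0 0 (Complex 0 1 * ei y0).
Proof.
move=> e e0; have e2 : 0 < e / 2 by rewrite divr_gt0.
have [r1 r10 h1] := real_expansion (is_derive_cos y0) e2.
have [r2 r20 h2] := real_expansion (is_derive_sin y0) e2.
exists (Num.min r1 r2); first by rewrite lt_min r10.
move=> x y _; rewrite !lt_min => /andP[y1 y2].
have {}h1 := h1 y y1; have {}h2 := h2 y y2.
rewrite mul0r subr0 (le_trans (cmod_le_ReIm _))//.
have -> : complex.Re (ei y - ei y0 - Complex 0 1 * ei y0 * cR (y - y0)) =
  cos y - cos y0 - - sin y0 * (y - y0) by rewrite /=; ring.
have -> : complex.Im (ei y - ei y0 - Complex 0 1 * ei y0 * cR (y - y0)) =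
  sin y - sin y0 - cos y0 * (y - y0) by rewrite /=; ring.
have e3 : 0 <= e * `|x - x0| by rewrite mulr_ge0// ltW.
by rewrite [leRHS]mulrDr; lra.
Qed.

End TwoVariableExpansion.

(** * Integrals of complex functions over one turn of the circle *)

Section CircleIntegral.
Context {R : realType}.
Local Notation C := (CC R).
Implicit Types (h g : R -> C).

(* A name of its own keeps [done] from unfolding [continuous]. *)
Definition ccts h : Prop := continuous h.

Definition cint h : C :=
  Complex (intab (fun t => complex.Re (h t)) 0 (2 * pi))
          (intab (fun t => complex.Im (h t)) 0 (2 * pi)).

Lemma twopi_ge0 : 0 <= 2 * pi :> R.
Proof. by rewrite mulr_ge0// pi_ge0. Qed.

Lemma cont_on_Re h a b : ccts h -> cont_on (fun t => complex.Re (h t)) a b.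
Proof. by move=> ch t _; apply: continuous_comp (ch t) _; exact: Re_continuous. Qed.

Lemma cont_on_Im h a b : ccts h -> cont_on (fun t => complex.Im (h t)) a b.
Proof. by move=> ch t _; apply: continuous_comp (ch t) _; exact: Im_continuous. Qed.

Lemma cintD g h : ccts g -> ccts h ->
  cint (fun t => g t + h t) = cint g + cint h.
Proof.
move=> cg ch; rewrite /cint [RHS]/GRing.add/=; congr Complex; rewrite -intabD;
  by [exact: cont_on_Re|exact: cont_on_Im|apply: eq_intab => t _; rewrite ?cReD ?cImD].
Qed.

Lemma cintZ (k : C) h : ccts h -> cint (fun t => k * h t) = k * cint h.
Proof.
case: k => a b ch; have cR := cont_on_Re ch; have cI := cont_on_Im ch.
rewrite /cint [RHS]/GRing.mul/=; congr Complex; rewrite -!intabZ//.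
  rewrite -intabB; [|exact: cont_onZ..].
  by apply: eq_intab => t _; case: (h t).
rewrite -intabD; [|exact: cont_onZ..].
by apply: eq_intab => t _; case: (h t).
Qed.

Lemma cintB g h : ccts g -> ccts h ->
  cint (fun t => g t - h t) = cint g - cint h.
Proof.
move=> cg ch; rewrite /cint [RHS]/GRing.add/=; congr Complex; rewrite -intabB;
  by [exact: cont_on_Re|exact: cont_on_Im|apply: eq_intab => t _; rewrite ?cReD ?cImD ?cReN ?cImN].
Qed.

Lemma eq_cint g h : (forall t, g t = h t) -> cint g = cint h.
Proof. by move=> gh; congr cint; apply/funext. Qed.

(** The factor [2] is the price of bounding real and imaginary parts separately; it is absorbed by
    the constant [6] of [cauchy_approx]. *)
Lemma cint_bound h M : ccts h -> (forall t, cmod (h t) <= M) ->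
  cmod (cint h) <= 2 * M * (2 * pi).
Proof.
move=> ch hM; rewrite (le_trans (cmod_le_ReIm _))//=.
have -> : 2 * M * (2 * pi) = M * (2 * pi - 0) + M * (2 * pi - 0) by ring.
apply: lerD; apply: intab_bound => //; rewrite ?twopi_ge0//.
- exact: cont_on_Re.
- by move=> t _; rewrite (le_trans (Re_le_cmod _)).
- exact: cont_on_Im.
- by move=> t _; rewrite (le_trans (Im_le_cmod _)).
Qed.

Lemma cint_cst (k : C) : cint (fun=> k) = cR (2 * pi) * k.
Proof.
rewrite /cint !intab_cst ?twopi_ge0// subr0; case: k => a b.
by apply/eqP; rewrite eq_complex /=; apply/andP; split; apply/eqP; ring.
Qed.

Lemma ccts_sum (I : Type) (r : seq I) (F : I -> R -> C) :
  (forall i, ccts (F i)) -> ccts (fun t => \sum_(i <- r) F i t).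
Proof.
move=> cF; elim: r => [|i r IH].
  by move=> t; under eq_fun do rewrite big_nil; exact: cst_continuous.
have -> : (fun t => \sum_(j <- i :: r) F j t) =
    (fun t => F i t + \sum_(j <- r) F j t).
  by apply/funext => t; rewrite big_cons.
by move=> t; apply: (@continuousD _ _ _ (F i)); [exact: cF|exact: IH].
Qed.

Lemma cint_sum (I : Type) (r : seq I) (F : I -> R -> C) :
  (forall i, ccts (F i)) ->
  cint (fun t => \sum_(i <- r) F i t) = \sum_(i <- r) cint (F i).
Proof.
move=> cF; elim: r => [|i r IH].
  by under eq_fun do rewrite big_nil; rewrite big_nil cint_cst mulr0.
rewrite big_cons -IH -(cintD (cF i) (ccts_sum cF)).
by apply: eq_cint => t; rewrite big_cons.
Qed.

Lemma ei_continuous : ccts (@ei R).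
Proof.
by move=> t; apply: cvg_Complex; [exact: continuous_cos|exact: continuous_sin].
Qed.

Lemma ei2pi : ei (2 * pi) = ei 0 :> C.
Proof. by rewrite /ei mulr_natl cos2pi sin2pi cos0 sin0. Qed.

Lemma cctsM g h : ccts g -> ccts h ->
  ccts (fun t => g t * h t).
Proof. by move=> cg ch t; apply: (@cvgM _ _ _ _ g h); [exact: cg|exact: ch]. Qed.

Lemma cctsD g h : ccts g -> ccts h ->
  ccts (fun t => g t + h t).
Proof. by move=> cg ch t; apply: (@cvgD _ _ _ _ _ g h); [exact: cg|exact: ch]. Qed.

Lemma cctsV h : ccts h -> (forall t, h t != 0) ->
  ccts (fun t => (h t)^-1).
Proof. by move=> ch h0 t; apply: (@cvgV _ _ _ _ h); [exact: h0|exact: ch]. Qed.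

Lemma cctsX h n : ccts h -> ccts (fun t => h t ^+ n).
Proof.
move=> ch; elim: n => [|n IH].
  by under eq_fun do rewrite expr0; move=> t; exact: cst_continuous.
by under eq_fun do rewrite exprS; exact: cctsM.
Qed.

Lemma cctscst (k : C) : ccts (fun _ : R => k).
Proof. by move=> t; exact: cst_continuous. Qed.

Lemma cexp_continuous (f : C -> C) z f' : cexp f z f' ->
  forall e : R, 0 < e -> exists2 d : R, 0 < d & forall w, cmod (w - z) < d ->
    cmod (f w - f z) < e.
Proof.
move=> /(_ _ ltr01)[d d0 H] e e0; have A0 : 0 < cmod f' + 1.
  by rewrite ltr_wpDl ?cmod_ge0.
exists (Num.min d (e / (cmod f' + 1))); first by rewrite lt_min d0 divr_gt0.
move=> w; rewrite lt_min => /andP[/H {}H]; rewrite ltr_pdivlMr// => we.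
rewrite mul1r in H; apply: le_lt_trans we.
rewrite -(subrK (f' * (w - z)) (f w - f z)) (le_trans (cmodD _ _))//.
rewrite [leRHS](_ : _ = cmod (w - z) + cmod f' * cmod (w - z)); last by ring.
by rewrite lerD// cmodM.
Qed.

Lemma cexp_continuous_comp (f : C -> C) h : ccts h ->
  (forall t, exists f', cexp f (h t) f') -> ccts (fun t => f (h t)).
Proof.
move=> ch cf t; apply/cvgCP => e e0; have [f' /cexp_continuous/(_ _ e0)[d d0 H]] := cf t.
by have /cvgCP/(_ _ d0) := ch t; apply: filterS => s /H.
Qed.

End CircleIntegral.

Ltac ccont H := lazymatch goal with
  | |- ccts (fun _ => ?k) => exact: cctscst
  | |- ccts (fun t => @?g t * @?h t) => apply: (@cctsM _ g h); ccont H
  | |- ccts (fun t => @?g t + @?h t) => apply: (@cctsD _ g h); ccont H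
  | |- ccts (fun t => @?g t ^+ ?n) => apply: (@cctsX _ g n); ccont H
  | _ => exact: H
  end.

Definition circ {R : realType} (S t : R) : CC R := cR S * ei t.

Lemma circ_continuous {R : realType} (S : R) : ccts (circ S).
Proof.
by apply: (@cctsM _ (fun=> cR S) (@ei R));
  [exact: cctscst|exact: ei_continuous].
Qed.

Section Cauchy.
Context {R : realType}.
Local Notation C := (CC R).
Variables (f : C -> C) (r S : R).
Hypothesis S0 : 0 < S.
Hypothesis Sr : S < r.
Hypothesis df : forall w, cmod w < r -> exists f', cexp f w f'.

Local Notation W := (circ S).

Let cmodW t : cmod (W t) = S.
Proof. by rewrite /circ cmodM cmodR cmod_ei mulr1 gtr0_norm. Qed.

Let cW : ccts W.
Proof. exact: circ_continuous. Qed.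

Let W0 t : W t != 0.
Proof. by rewrite -cmod_gt0 cmodW. Qed.

Let Wz z t : cmod z < S -> W t - z != 0.
Proof. by move=> zS; rewrite subr_eq0; apply: contraTneq zS => <-; rewrite cmodW ltxx. Qed.

Local Notation I1 := (Complex 0 1 : C).

(* The form [f w / (w - z) dw] is closed off [z]; integrate it over the
   homotopy [z + x (W y - z)] contracting the circle [W] to [z]. *)
Definition gam (z : C) (x y : R) : C := z + cR x * (W y - z).

Let cmod_gam z x y : cmod z < S -> 0 <= x <= 1 -> cmod (gam z x y) <= S.
Proof.
move=> zS /andP[x0 x1]; have -> : gam z x y = cR (1 - x) * z + cR x * W y.
  by rewrite cRB cR1 /gam; ring.
rewrite (le_trans (cmodD _ _))// [cmod (_ * z)]cmodM [cmod (_ * W y)]cmodM.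
rewrite cmodW !cmodR !ger0_norm ?subr_ge0//.
have := cmod_ge0 z; nra.
Qed.

(** The logarithmic derivative of [W y - z] in [y], since [W' = i W]. *)
Definition cker (z : C) (y : R) : C := I1 * W y / (W y - z).

Let cK z : cmod z < S -> ccts (cker z).
Proof.
move=> zS; apply: cctsM; first by ccont cW.
apply: cctsV => [|t]; last exact: Wz.
by ccont cW.
Qed.

Let dW x0 y0 : dexp2 (fun _ y => W y) x0 y0 0 (I1 * W y0).
Proof.
apply: dexp2_ext (dexp2M (dexp2_cst (cR S) x0 y0) (dexp2_ei x0 y0)) => //.
  by rewrite mulr0 mul0r addr0.
by rewrite /circ/= mul0r add0r mulrCA.
Qed.

Let dgam z x0 y0 : dexp2 (gam z) x0 y0 (W y0 - z) (cR x0 * (I1 * W y0)).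
Proof.
have dW' := dexp2D (dW x0 y0) (dexp2_cst (- z) x0 y0).
apply: dexp2_ext (dexp2D (dexp2_cst z x0 y0) (dexp2M (dexp2_fst x0 y0) dW')) => //=; ring.
Qed.

Let J z x := cint (fun y => f (gam z x y) * cker z y).

Let cJ z x : cmod z < S -> 0 <= x <= 1 -> ccts (fun y => f (gam z x y) * cker z y).
Proof.
move=> zS x01; apply: cctsM; last exact: cK.
apply: cexp_continuous_comp => [|t].
  by rewrite /gam; ccont cW.
by apply: df; rewrite (le_lt_trans (cmod_gam _ zS x01)).
Qed.

(** Pulled back by [gam], the form [f w / (w - z) dw] has [dx] part [f / x], because
    [gam - z = x (W - z)], and [dy] part [f cker]. Both cross derivatives equal [f' i W]. The factor
    [k], taken to be [1] or [- i], selects the real or the imaginary part. *)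
Let homotopy_forms z x0 y0 (k : C) : cmod z < S -> 0 < x0 <= 1 ->
  closed_form_at (fun x y => complex.Re (k * (f (gam z x y) / cR x)))
    (fun x y => complex.Re (k * (f (gam z x y) * cker z y))) x0 y0.
Proof.
move=> zS /andP[x0_gt0 x01].
have [f' Hf] : exists f', cexp f (gam z x0 y0) f'.
  by apply: df; rewrite (le_lt_trans (cmod_gam _ zS _))// ltW.
have dfg := dexp2_comp (dgam z x0 y0) Hf.
have cx0 : cR x0 != 0 by rewrite -cmod_gt0 cmodR normr_gt0 gt_eqF.
have dP := dexp2M dfg (dexp2V (dexp2_fst x0 y0) cx0).
have dK := dexp2M (dexp2M (dexp2_cst I1 x0 y0) (dW x0 y0))
  (dexp2V (dexp2D (dW x0 y0) (dexp2_cst (- z) x0 y0)) (Wz y0 zS)).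
have dQ := dexp2M dfg dK.
have wz := Wz y0 zS.
apply: (@dexp2_Re _ _ _ _ _ _ (k * (f' * (I1 * W y0)))).
  apply: dexp2_ext (dexp2_comp dP (cexpZ k _)) => //=.
  by rewrite mulr0 mulr0 addr0; congr (k * _); field.
apply: dexp2_ext (dexp2_comp dQ (cexpZ k _)) => //=.
by rewrite !(mul0r, mulr0, addr0, add0r); congr (k * _); field.
Qed.

(** Goursat on [[x, 1] x [0, 2 pi]]: the two horizontal sides cancel by periodicity, so the two
    vertical ones agree. *)
Let Jre z x (k : C) : cmod z < S -> 0 < x <= 1 ->
  intab (fun y => complex.Re (k * (f (gam z x y) * cker z y))) 0 (2 * pi) =
  intab (fun y => complex.Re (k * (f (gam z 1 y) * cker z y))) 0 (2 * pi).
Proof.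
move=> zS /andP[x0 x1].
have H : closed_form_on (fun x y => complex.Re (k * (f (gam z x y) / cR x)))
    (fun x y => complex.Re (k * (f (gam z x y) * cker z y))) x 1 0 (2 * pi).
  move=> u y /andP[u1 u2] _; apply: homotopy_forms => //.
  by rewrite (lt_le_trans x0).
have := goursat x1 twopi_ge0 H; rewrite /rect_int.
rewrite (_ : intab _ x 1 = 0); last first.
  rewrite (@eq_intab _ _ (fun=> 0)) ?intab_cst ?mul0r// => u _.
  by rewrite /gam /circ ei2pi subrr.
have cc u : 0 <= u <= 1 -> ccts (fun y => k * (f (gam z u y) * cker z y)).
  by move=> u01; apply: (@cctsM _ (fun=> k)); [exact: cctscst|exact: cJ].
rewrite add0r intabB; [|apply: cont_on_Re; apply: cc; rewrite ?ler01 ?lexx//..].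
  by move/subr0_eq.
by rewrite ltW.
Qed.

Let JE z x : cmod z < S -> 0 < x <= 1 -> J z x = J z 1.
Proof.
move=> zS x01; rewrite /J /cint; congr Complex.
  have := Jre 1 zS x01.
  by rewrite (@eq_intab _ _ (fun y => complex.Re (f (gam z x y) * cker z y)))
     => [->|y _]; [apply: eq_intab => y _|]; rewrite mul1r.
have E (w : C) : complex.Im w = complex.Re (- I1 * w).
  by case: w => a b /=; ring.
have := Jre (- I1) zS x01.
by rewrite (@eq_intab _ _ (fun y => complex.Im (f (gam z x y) * cker z y)))
     => [->|y _]; [apply: eq_intab => y _|]; rewrite -E.
Qed.

(** The integral over the contracted circle does not depend on [x] and tends to [f z] times the
    integral of [cker] as [x] tends to [0]. In this subtracted form no value of the kernel integral
    has to be computed. *)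
Lemma cauchy_circle z : cmod z < S ->
  cint (fun t => (f (W t) - f z) * (W t / (W t - z))) = 0.
Proof.
move=> zS; have cKz := cK zS; have one01 : 0 <= (1 : R) <= 1 by rewrite ler01 lexx.
have Sz : 0 < S - cmod z by rewrite subr_gt0.
have KM t : cmod (cker z t) <= S / (S - cmod z).
  rewrite /cker cmodM cmodV [cmod (I1 * _)]cmodM cmodW.
  have -> : cmod I1 = 1 by rewrite /cmod/= expr0n/= expr1n add0r sqrtr1.
  rewrite mul1r ler_pM2l// lef_pV2 ?posrE ?cmod_gt0 ?Wz//.
  by have := cmodD (W t - z) z; rewrite subrK cmodW lerBlDr.
set M := S / (S - cmod z) in KM.
have M0 : 0 <= M by rewrite divr_ge0 ?ltW.
have key : J z 1 = cint (fun t => f z * cker z t).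
  apply/eqP; rewrite -subr_eq0 -cmod_eq0 eq_le cmod_ge0 andbT.
  apply/ler_addgt0Pl => e e0; rewrite addr0.
  have [f' Hf] := df (lt_trans zS Sr).
  have P0 : 0 < 2 * (M + 1) * (2 * pi).
    by rewrite mulr_gt0// mulr_gt0// ?pi_gt0// ltr_wpDl.
  have e1 : 0 < e / (2 * (M + 1) * (2 * pi)) by rewrite divr_gt0.
  have [d d0 Hd] := cexp_continuous Hf e1.
  (* Since [|W t - z| < 2 S], this brings [gam z x t] within [d] of [z]. *)
  pose x := Num.min 1 (d / (4 * S)).
  have x0 : 0 < x by rewrite lt_min ltr01 divr_gt0// mulr_gt0.
  have x1 : x <= 1 by rewrite ge_min lexx.
  have xd : x * (4 * S) <= d by rewrite -ler_pdivlMr ?mulr_gt0// ge_min lexx orbT.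
  have x01 : 0 <= x <= 1 by rewrite ltW.
  rewrite -(@JE z x) ?x0//.
  have -> : J z x - cint (fun t => f z * cker z t) =
      cint (fun t => (f (gam z x t) - f z) * cker z t).
    rewrite /J -cintB; [|exact: cJ|by ccont cKz].
    by apply: eq_cint => t; ring.
  have B : cmod (cint (fun t => (f (gam z x t) - f z) * cker z t)) <=
      2 * (e / (2 * (M + 1) * (2 * pi)) * M) * (2 * pi).
    apply: cint_bound => [|t].
      have -> : (fun t => (f (gam z x t) - f z) * cker z t) =
         (fun t => f (gam z x t) * cker z t + (- f z) * cker z t).
        by apply/funext => t; ring.
      by apply: cctsD; [exact: cJ|ccont cKz].
    rewrite cmodM ler_pM ?cmod_ge0// ltW// Hd//.
    have -> : gam z x t - z = cR x * (W t - z) by rewrite /gam; ring.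
    rewrite cmodM cmodR gtr0_norm//.
    have := cmodB (W t) z; rewrite cmodW => h; have := cmod_ge0 (W t - z); nra.
  apply: (le_trans B).
  have -> : 2 * (e / (2 * (M + 1) * (2 * pi)) * M) * (2 * pi) = e * (M / (M + 1)).
    have M1 : M + 1 != 0 by rewrite gt_eqF// ltr_wpDl.
    have : 2 * pi != 0 :> R by rewrite gt_eqF// mulr_gt0// pi_gt0.
    by move: (2 * pi) => T T0; field; rewrite M1 T0.
  by rewrite ger_pMr// ler_pdivrMr ?mul1r ?lerDl// ltr_wpDl.
have gam1 t : gam z 1 t = W t by rewrite /gam cR1 mul1r addrC subrK.
have I0 : I1 != 0 by rewrite eq_complex /= oner_eq0 andbF.
apply: (mulfI I0); rewrite mulr0.
have cc : ccts (fun t => (f (W t) - f z) * (W t / (W t - z))).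
  have -> : (fun t => (f (W t) - f z) * (W t / (W t - z))) =
     (fun t => I1^-1 * (f (gam z 1 t) * cker z t + (- f z) * cker z t)).
    by apply/funext => t; rewrite gam1 /cker; field; rewrite Wz.
  by apply: (@cctsM _ (fun=> I1^-1)); [exact: cctscst|apply: cctsD; [exact: cJ|ccont cKz]].
rewrite -cintZ//; transitivity (J z 1 - cint (fun t => f z * cker z t)).
  rewrite /J -cintB; [|exact: cJ|by ccont cKz].
  by apply: eq_cint => t; rewrite gam1 /cker; ring.
by rewrite key subrr.
Qed.

End Cauchy.

(** * Taylor polynomials with exponentially small error *)

Section PolynomialApproximation.
Context {R : realType}.
Local Notation C := (CC R).

Lemma cint_conj (h : R -> C) : ccts h ->
  cint (fun t => conjc (h t)) = conjc (cint h).
Proof.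
move=> ch; rewrite /cint /=; congr Complex.
  by apply: eq_intab => t _; case: (h t).
rewrite -mulN1r -intabZ; last exact: cont_on_Im.
by apply: eq_intab => t _; case: (h t) => a b /=; rewrite mulN1r.
Qed.

Lemma cexpXn (z : C) k : exists f', cexp (fun w => w ^+ k) z f'.
Proof.
apply: differentiable_expansion; case: k => [|k].
  by under eq_fun do rewrite expr0; exact: differentiable_cst.
have := @differentiableX C C id k z; rewrite exprfctE; apply.
by apply: ex_diff.
Qed.

Lemma circ_neq0 (S : R) t : 0 < S -> circ S t != 0 :> C.
Proof. by move=> S0; rewrite -cmod_gt0 cmodM cmodR cmod_ei mulr1 gtr0_norm. Qed.

Lemma cmod_circ (S : R) t : 0 < S -> cmod (circ S t) = S.
Proof. by move=> S0; rewrite cmodM cmodR cmod_ei mulr1 gtr0_norm. Qed.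

Lemma cint_circX (S : R) k : 0 < S -> (0 < k)%N ->
  cint (fun t => circ S t ^+ k) = 0.
Proof.
move=> S0 k0; have S1 : S < S + 1 by rewrite ltrDl.
rewrite -(@cauchy_circle _ (fun w => w ^+ k) _ _ S0 S1 _ 0).
- apply: eq_cint => t; rewrite expr0n (gtn_eqF k0) !subr0 divff ?mulr1//.
  exact: circ_neq0.
- by move=> w _; exact: cexpXn.
- by rewrite cmod0.
Qed.

Lemma circ_inv (S : R) t : 0 < S ->
  (circ S t)^-1 = cR (S ^+ 2)^-1 * conjc (circ S t) :> C.
Proof.
move=> S0; have c0 := circ_neq0 t S0.
apply: (mulfI c0); rewrite divff// mulrCA.
have -> : circ S t * conjc (circ S t) = cR (S ^+ 2).
  have := cmod_sqr (circ S t); rewrite cmod_circ// => ->.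
  by case: (circ S t) => a b; apply/eqP; rewrite eq_complex/=; apply/andP; split;
    apply/eqP; ring.
by rewrite -cRM mulVf// expf_neq0// gt_eqF.
Qed.

Lemma cint_circVX (S : R) k : 0 < S -> (0 < k)%N ->
  cint (fun t => (circ S t)^-1 ^+ k) = 0.
Proof.
move=> S0 k0.
rewrite (@eq_cint _ _ (fun t => cR (S ^+ 2)^-1 ^+ k * conjc (circ S t ^+ k))).
  have cX : ccts (fun t => circ S t ^+ k) by exact: cctsX (@circ_continuous R S).
  rewrite cintZ; last first.
    move=> t; have -> : (fun t => conjc (circ S t ^+ k)) =
      (fun t => Complex (complex.Re (circ S t ^+ k)) (- complex.Im (circ S t ^+ k))).
      by apply/funext => s; case: (circ S s ^+ k).
    apply: cvg_Complex; first by apply: continuous_comp (cX t) _; exact: Re_continuous.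
    by apply: cvgN; apply: continuous_comp (cX t) _; exact: Im_continuous.
  by rewrite cint_conj// cint_circX// conjc0 mulr0.
by move=> t; rewrite circ_inv// exprMn rmorphXn.
Qed.

Lemma geom_kernel (w z : C) N : w != 0 -> w - z != 0 ->
  w / (w - z) = \sum_(k < N) z ^+ k * w^-1 ^+ k + (z / w) ^+ N * (w / (w - z)).
Proof.
move=> w0 wz; have q1 : 1 - z / w != 0.
  by rewrite subr_eq0 eq_sym; apply: contra wz => /eqP/divr1_eq ->; rewrite subrr.
have -> : w / (w - z) = (1 - z / w)^-1.
  by apply: (mulfI q1); rewrite divff// mulrA mulrBl mul1r divfK// divff.
under eq_bigr do rewrite -exprMn.
apply: (mulfI q1); rewrite mulrDr mulrCA divff// mulr1.
have := subrX1 (z / w) N; rewrite -opprB => /eqP; rewrite eqr_oppLR => /eqP.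
by rewrite -mulNr opprB => <-; rewrite subrK.
Qed.

(** The approximant is the Taylor polynomial at [0]: the kernel is expanded in powers of [z / W], of
    modulus at most [1 / 4]. The constant dominates [2 * 2 * 4 / 3], from [cint_bound], from
    [|f W - f z| <= 2] and from the kernel. *)
Lemma cauchy_approx (f : C -> C) (r S : R) N : 0 < S -> S < r ->
  (forall w, cmod w < r -> exists f', cexp f w f') ->
  (forall w, cmod w < r -> cmod (f w) <= 1) ->
  exists2 p : {poly C}, (size p <= N)%N &
    forall z, cmod z <= S / 4 -> cmod (f z - p.[z]) <= 6 / 4 ^+ N.
Proof.
move=> S0 Sr df f1.
pose T : R := 2 * pi.
have T0 : 0 < T by rewrite mulr_gt0// pi_gt0.
have cT0 : cR T != 0 by rewrite -cmod_gt0 cmodR gtr0_norm.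
have cf : ccts (fun t => f (circ S t)).
  apply: cexp_continuous_comp; first exact: circ_continuous.
  by move=> t; apply: df; rewrite cmod_circ.
have cWV : ccts (fun t => (circ S t)^-1).
  by apply: cctsV => [|t]; [exact: circ_continuous|exact: circ_neq0].
pose c k := (cR T)^-1 * cint (fun t => f (circ S t) * (circ S t)^-1 ^+ k).
exists (\poly_(k < N) c k); first exact: size_poly.
move=> z zS; have zS' : cmod z < S by lra.
have zr : cmod z < r by lra.
(* The value [f z] comes out of the term of index [0], which is absent when [N = 0]; there the bound
   [1] on [f] is enough. *)
case: N => [|N].
  by rewrite poly_def big_ord0 horner0 subr0 (le_trans (f1 _ zr))// expr0; lra.
have Wz t : circ S t - z != 0.
  by rewrite subr_eq0; apply: contraTneq zS' => <-; rewrite cmod_circ// ltxx.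
have cfz : ccts (fun t => f (circ S t) - f z).
  by apply: cctsD; [exact: cf|exact: cctscst].
have cker : ccts (fun t => circ S t / (circ S t - z)).
  apply: cctsM; first exact: circ_continuous.
  apply: cctsV; last exact: Wz.
  by apply: cctsD; [exact: circ_continuous|exact: cctscst].
pose rem t := (f (circ S t) - f z) * ((z / circ S t) ^+ N.+1 * (circ S t / (circ S t - z))).
have crem : ccts rem.
  apply: cctsM; first exact: cfz.
  apply: cctsM; last exact: cker.
  by apply: cctsX; apply: cctsM; [exact: cctscst|exact: cWV].
pose Fk (k : 'I_N.+1) t := z ^+ k * ((f (circ S t) - f z) * (circ S t)^-1 ^+ k).
have cfk k : ccts (fun t => (f (circ S t) - f z) * (circ S t)^-1 ^+ k).
  by apply: cctsM; [exact: cfz|exact: cctsX].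
have cFk k : ccts (Fk k) by apply: cctsM; [exact: cctscst|exact: cfk].
have csum : ccts (fun t => \sum_(k < N.+1) Fk k t).
  exact: ccts_sum cFk.
have H := cauchy_circle S0 Sr df zS'.
have : cint (fun t => \sum_(k < N.+1) Fk k t) + cint rem = 0.
  rewrite -(cintD csum crem) -[RHS]H; apply: eq_cint => t.
  rewrite [in RHS](geom_kernel N.+1 (circ_neq0 t S0) (Wz t)) mulrDr; congr (_ + _).
  by rewrite mulr_sumr; apply: eq_bigr => k _; rewrite /Fk mulrCA.
rewrite (cint_sum _ cFk).
have -> : \sum_(k < N.+1) cint (Fk k) = cR T * ((\poly_(k < N.+1) c k).[z] - f z).
  rewrite horner_poly mulrBr mulr_sumr.
  have E k : cint (Fk k) = cR T * (c k * z ^+ k) -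
     z ^+ k * (f z * cint (fun t => (circ S t)^-1 ^+ k)).
    rewrite /Fk (cintZ _ (cfk k)).
    have -> : cint (fun t => (f (circ S t) - f z) * (circ S t)^-1 ^+ k) =
      cint (fun t => f (circ S t) * (circ S t)^-1 ^+ k) -
      f z * cint (fun t => (circ S t)^-1 ^+ k).
      have cX := @cctsX _ _ k cWV.
      have c1 : ccts (fun t => f (circ S t) * (circ S t)^-1 ^+ k).
        by apply: cctsM; [exact: cf|exact: cX].
      have c2 : ccts (fun t => f z * (circ S t)^-1 ^+ k).
        by apply: cctsM; [exact: cctscst|exact: cX].
      rewrite -(cintZ _ cX) -(cintB c1 c2).
      by apply: eq_cint => t; rewrite mulrBl.
    by rewrite /c mulrBr; congr (_ - _); rewrite mulrA mulrA divff// mul1r mulrC.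
  rewrite (eq_bigr _ (fun k _ => E k)) sumrB; congr (_ - _).
  (* Negative powers of [W] integrate to zero, so only the index [0] contributes a multiple of
     [f z]. *)
  rewrite big_ord_recl big1 => [|k _]; last by rewrite cint_circVX// !mulr0.
  under eq_cint do rewrite expr0.
  by rewrite cint_cst expr0 mul1r mulr1 addr0 mulrC.
move/eqP; rewrite addr_eq0 => /eqP E.
have remB t : cmod (rem t) <= 2 * (4 ^+ N.+1)^-1 * (4 / 3).
  rewrite /rem cmodM -mulrA ler_pM ?cmod_ge0//.
    rewrite (le_trans (cmodB _ _))// [X in _ <= X](_ : _ = 1 + 1)//.
    by rewrite lerD// f1// cmod_circ.
  rewrite cmodM cmodX ler_pM ?cmod_ge0 ?exprn_ge0 ?cmod_ge0//.
    rewrite -exprVn lerXn2r ?nnegrE ?cmod_ge0 ?invr_ge0//.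
    by rewrite cmodM cmodV cmod_circ// ler_pdivrMr// mulrC.
  rewrite cmodM cmodV cmod_circ// ler_pdivrMr ?cmod_gt0//.
  have := cmodD (circ S t - z) z; rewrite subrK cmod_circ//; lra.
have := cint_bound crem remB; rewrite -cmodN -E cmodM cmodR gtr0_norm// -/T.
rewrite cmodBC mulrC ler_pM2r// => /le_trans; apply.
have : 0 < (4 ^+ N.+1)^-1 :> R by rewrite invr_gt0 exprn_gt0.
by move: ((4 ^+ N.+1)^-1) => u u0; lra.
Qed.

End PolynomialApproximation.

(** * Interpolation at roots of unity *)

Section Interpolation.
Context {R : realType}.
Local Notation C := (CC R).

Lemma closed_prim_root (F : numClosedFieldType) N : (0 < N)%N ->
  exists z : F, N.-primitive_root z.
Proof.
move=> N0; have [rs Dp] := closed_field_poly_normal ('X^N - 1 : {poly F}).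
rewrite (monicP _) ?monicXnsubC // scale1r in Dp.
have rn1 : all N.-unity_root rs by apply/allP => z; rewrite -root_prod_XsubC -Dp.
have sz : (N < (size rs).+1)%N.
  by rewrite -(size_prod_XsubC rs id) -Dp size_XnsubC.
have [|z _ zP] := hasP (cyclic.has_prim_root N0 rn1 _ sz); last by exists z.
by rewrite -separable.separable_prod_XsubC -Dp cyclotomic.separable_Xn_sub_1// pnatr_eq0 -lt0n.
Qed.

Variables (N : nat) (zeta : C) (rho : R).
Hypothesis N0 : (0 < N)%N.
Hypothesis zetaP : N.-primitive_root zeta.
Hypothesis rho0 : 0 < rho.

Definition node (b : nat) : C := cR rho * zeta ^+ b.

(* Lagrange's cardinal functions of the [N] nodes on the circle of radius [rho],
   in closed form by orthogonality of the roots of unity. *)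
Definition lag (w : C) (b : nat) : C := N%:R^-1 * \sum_(k < N) (w / node b) ^+ k.

Definition interp (f : C -> C) (w : C) : C := \sum_(b < N) f (node b) * lag w b.

Lemma cmod_zeta : cmod zeta = 1.
Proof.
apply/eqP; rewrite -(@pexpr_eq1 _ _ N)// ?cmod_ge0//.
by rewrite -cmodX (prim_expr_order zetaP) cmod1.
Qed.

Lemma cmod_node b : cmod (node b) = rho.
Proof. by rewrite cmodM cmodX cmod_zeta expr1n cmodR mulr1 gtr0_norm. Qed.

Lemma node_neq0 b : node b != 0.
Proof. by rewrite -cmod_gt0 cmod_node. Qed.

Lemma root_sum (u : C) : u ^+ N = 1 -> u != 1 -> \sum_(b < N) u ^+ b = 0.
Proof.
move=> uN u1; have := subrX1 u N; rewrite uN subrr => /esym/eqP.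
by rewrite mulf_eq0 subr_eq0 (negPf u1) => /eqP.
Qed.

Lemma interpX j w : (j < N)%N -> interp (fun v => v ^+ j) w = w ^+ j.
Proof.
move=> jN; have Nn0 : (N%:R : C) != 0 by rewrite pnatr_eq0 -lt0n.
have z0 : zeta != 0 by rewrite -cmod_gt0 cmod_zeta.
have r0 : cR rho != 0 by rewrite -cmod_gt0 cmodR gtr0_norm.
rewrite /interp /lag.
under eq_bigr do rewrite mulrCA mulr_sumr.
rewrite -mulr_sumr exchange_big /= (bigD1 (Ordinal jN))//= [X in _ + X]big1.
  rewrite addr0 (eq_bigr (fun=> w ^+ j)); last first.
    by move=> b _; rewrite -exprMn mulrC divfK// node_neq0.
  by rewrite sumr_const card_ord -(mulr_natl (w ^+ j)) mulrA mulVf// mul1r.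
move=> k; rewrite -val_eqE /= => kj.
rewrite (eq_bigr (fun b : 'I_N =>
   (cR rho ^+ j * w ^+ k / cR rho ^+ k) * (zeta ^+ j / zeta ^+ k) ^+ b)); last first.
  move=> b _; rewrite /node !exprMn !exprVn !exprMn -!exprM ![(b * _)%N]mulnC.
  by field; rewrite !expf_neq0.
rewrite -mulr_sumr root_sum ?mulr0//.
  rewrite exprMn exprVn -!exprM ![(_ * N)%N]mulnC !exprM (prim_expr_order zetaP).
  by rewrite !expr1n divr1.
apply: contra kj => /eqP/divr1_eq/eqP; rewrite (eq_prim_root_expr zetaP).
by rewrite !modn_small// eq_sym.
Qed.

Lemma interp_poly (p : {poly C}) w : (size p <= N)%N ->
  interp (fun v => p.[v]) w = p.[w].
Proof.
move=> sp; rewrite (horner_coef_wide _ sp) /interp.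
under eq_bigr do rewrite (horner_coef_wide _ sp) mulr_suml.
rewrite exchange_big /=; apply: eq_bigr => j _.
rewrite -(interpX w (ltn_ord j)) /interp [RHS]mulr_sumr.
by apply: eq_bigr => b _; rewrite [RHS]mulrA.
Qed.

Lemma lag_bound kappa w b : 1 <= kappa -> cmod w <= kappa * rho ->
  cmod (lag w b) <= kappa ^+ N.
Proof.
move=> k1 wk; rewrite cmodM cmodV cmod_nat.
rewrite ler_pdivrMl ?ltr0n// (le_trans (cmod_sum _ _ _))//.
rewrite mulr_natl -[X in _ *+ X]card_ord -sumr_const; apply: ler_sum => k _.
rewrite cmodX cmodM cmodV cmod_node.
have : cmod w / rho <= kappa by rewrite ler_pdivrMr.
have wr : 0 <= cmod w / rho by rewrite divr_ge0 ?cmod_ge0// ltW.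
move=> h; apply: (@le_trans _ _ (kappa ^+ k)).
  by rewrite lerXn2r// nnegrE (le_trans wr).
by rewrite ler_weXn2l// ltnW.
Qed.

Lemma interp_bound f M kappa w : 1 <= kappa -> cmod w <= kappa * rho ->
  (forall b, cmod (f (node b)) <= M) -> cmod (interp f w) <= M * (N%:R * kappa ^+ N).
Proof.
move=> k1 wk fM; rewrite (le_trans (cmod_sum _ _ _))//.
rewrite mulrCA mulr_natl -[X in _ *+ X]card_ord -sumr_const; apply: ler_sum => b _.
by rewrite cmodM ler_pM ?cmod_ge0//; apply: lag_bound.
Qed.

Lemma interpB f g w : interp (fun v => f v - g v) w = interp f w - interp g w.
Proof. by rewrite /interp -sumrB; apply: eq_bigr => b _; rewrite mulrBl. Qed.

(** Interpolation reproduces the Taylor polynomial [p], so the error is that of [f - p] minus its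
    interpolant, and on the disc of radius [rho] the operator has norm at most [N]. The condition
    [4 * rho < r] pays for the ratio [1 / 4] of [cauchy_approx]. *)
Lemma interp_error (f : C -> C) (r : R) w : 4 * rho < r ->
  (forall w, cmod w < r -> exists f', cexp f w f') ->
  (forall w, cmod w < r -> cmod (f w) <= 1) ->
  cmod w <= rho -> cmod (f w - interp f w) <= (1 + N%:R) * (6 / 4 ^+ N).
Proof.
move=> rr df f1 wr.
have S0 : 0 < 4 * rho by rewrite mulr_gt0.
have [p sp pe] := cauchy_approx N S0 rr df f1.
have E : 4 * rho / 4 = rho by rewrite mulrC mulrA mulVf// mul1r.
rewrite E in pe.
have -> : f w - interp f w = (f w - p.[w]) - interp (fun v => f v - p.[v]) w.
  by rewrite interpB (interp_poly w sp); ring.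
rewrite (le_trans (cmodB _ _))// mulrDl mul1r lerD ?pe//.
have := @interp_bound (fun v => f v - p.[v]) (6 / 4 ^+ N) 1 w (lexx _).
rewrite mul1r expr1n mulr1 [_ * N%:R]mulrC; apply => // b.
by apply: pe; rewrite cmod_node.
Qed.

End Interpolation.

(** * Interpolation in several variables, one variable at a time *)

Section TensorInterpolation.
Context {R : realType} {n : nat}.
Local Notation C := (CC R).
Implicit Types (z a : 'rV[C]_n) (F G : 'rV[C]_n -> C).

Definition zupd z (i : 'I_n) (c : C) : 'rV[C]_n :=
  \row_j if j == i then c else z ord0 j.

Lemma zupdE z i c j : zupd z i c ord0 j = if j == i then c else z ord0 j.
Proof. by rewrite mxE. Qed.

Lemma zupd_id z i : zupd z i (z ord0 i) = z.
Proof. by apply/rowP => j; rewrite !mxE; case: eqP => // ->. Qed.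

Lemma zupd_differentiable F z i (a0 w : C) :
  differentiable F (zupd z i (a0 + w)) ->
  exists f', cexp (fun w => F (zupd z i (a0 + w))) w f'.
Proof.
move=> dF; apply: differentiable_expansion.
have E : (fun w => zupd z i (a0 + w)) =
    (fun w : C => zupd z i a0 + w *: (delta_mx ord0 i : 'rV[C]_n)).
  apply/funext => v; apply/rowP => j; rewrite !mxE eqxx/=.
  by case: eqP => _; rewrite ?mulr1 ?mulr0 ?addr0.
apply: (@differentiable_comp _ _ _ _ (fun w => zupd z i (a0 + w)) F) => //.
rewrite E; apply: differentiableD; first exact: differentiable_cst.
by apply: differentiableZl; apply: ex_diff.
Qed.

Variables (N : nat) (zeta : C) (rho : R) (a : 'rV[C]_n).
Hypothesis N0 : (0 < N)%N.
Hypothesis zetaP : N.-primitive_root zeta.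
Hypothesis rho0 : 0 < rho.

Local Notation node := (node zeta rho).

Definition interp_at (i : 'I_n) F z : C :=
  interp N zeta rho (fun w => F (zupd z i (a ord0 i + w))) (z ord0 i - a ord0 i).

Definition tinterp F : 'rV[C]_n -> C := foldr interp_at F (enum 'I_n).

(** Coordinates outside [s] already sit at nodes. With this invariant a bound for [F] on the grid
    alone controls the interpolant up to distance [kappa * rho]. *)
Lemma foldr_interp_bound (M kappa : R) F (s : seq 'I_n) z : 1 <= kappa ->
  (forall z, (forall i, exists b, z ord0 i = a ord0 i + node b) -> cmod (F z) <= M) ->
  (forall i, i \notin s -> exists b, z ord0 i = a ord0 i + node b) ->
  (forall i, cmod (z ord0 i - a ord0 i) <= kappa * rho) ->
  cmod (foldr interp_at F s z) <= M * (N%:R * kappa ^+ N) ^+ size s.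
Proof.
move=> k1 FM; elim: s z => [|i s IH] z zs zk.
  by rewrite /= expr0 mulr1; apply: FM => i; exact: zs.
rewrite /= exprSr mulrA; apply: interp_bound => // b; apply: IH => j.
  rewrite zupdE; case: eqP => [->|/eqP ji] js; first by exists b.
  by apply: zs; rewrite in_cons negb_or ji.
rewrite zupdE; case: eqP => [->|_]; last exact: zk.
by rewrite addrC addKr (cmod_node N0 zetaP rho0)// ler_peMl// ltW.
Qed.

Lemma foldr_interpB F G (s : seq 'I_n) z :
  foldr interp_at (fun z => F z - G z) s z =
  foldr interp_at F s z - foldr interp_at G s z.
Proof.
elim: s z => [//|i s IH] z /=; rewrite /interp_at -interpB.
by apply: eq_bigr => b _; rewrite IH.
Qed.

Lemma tinterp_bound (M kappa : R) F z : 1 <= kappa ->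
  (forall z, (forall i, exists b, z ord0 i = a ord0 i + node b) -> cmod (F z) <= M) ->
  (forall i, cmod (z ord0 i - a ord0 i) <= kappa * rho) ->
  cmod (tinterp F z) <= M * (N%:R * kappa ^+ N) ^+ n.
Proof.
move=> k1 FM zk; have := @foldr_interp_bound M kappa F (enum 'I_n) z k1 FM.
by rewrite size_enum_ord; apply => // i; rewrite mem_enum.
Qed.

Lemma tinterpB F G z : tinterp (fun z => F z - G z) z = tinterp F z - tinterp G z.
Proof. exact: foldr_interpB. Qed.

(** Telescoping: [F - I H = (F - I F) + I (F - H)], where [I] interpolates in the new variable with
    norm at most [N], so each variable multiplies the error by [1 + N]. *)
Lemma foldr_interp_error F (r : R) (s : seq 'I_n) z : 4 * rho < r ->
  (forall z, (forall i, cmod (z ord0 i - a ord0 i) < r) ->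
     differentiable F z /\ cmod (F z) <= 1) ->
  (forall i, cmod (z ord0 i - a ord0 i) <= rho) ->
  cmod (F z - foldr interp_at F s z) <=
    (1 + N%:R) ^+ size s * ((1 + N%:R) * (6 / 4 ^+ N)).
Proof.
move=> rr HF; set E := (1 + N%:R) * (6 / 4 ^+ N).
have E0 : 0 <= E by rewrite mulr_ge0 ?addr_ge0 ?divr_ge0 ?exprn_ge0.
have rho_r : rho < r by apply: le_lt_trans rr; rewrite ler_peMl ?ler1n// ltW.
elim: s z => [|i s IH] z zr.
  by rewrite /= subrr cmod0 expr0 mul1r.
rewrite /=; set H := foldr interp_at F s.
have -> : F z - interp_at i H z = (F z - interp_at i F z) + interp_at i (fun z => F z - H z) z.
  by rewrite /interp_at interpB; ring.
have e1 : cmod (F z - interp_at i F z) <= E.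
  have := @interp_error _ N zeta rho N0 zetaP rho0 (fun w => F (zupd z i (a ord0 i + w)))
     r (z ord0 i - a ord0 i) rr.
  rewrite [a ord0 i + _]addrC subrK zupd_id; apply => // w wr.
    apply: zupd_differentiable; apply: (HF _ _).1 => j; rewrite zupdE.
    by case: eqP => [->|_]; rewrite ?[a ord0 i + w]addrC ?addrK// (le_lt_trans (zr j)).
  apply: (HF _ _).2 => j; rewrite zupdE.
  by case: eqP => [->|_]; rewrite ?[a ord0 i + w]addrC ?addrK// (le_lt_trans (zr j)).
have e2 : cmod (interp_at i (fun z => F z - H z) z) <= ((1 + N%:R) ^+ size s * E) * N%:R.
  have := @interp_bound _ N zeta rho N0 zetaP rho0
    (fun w => F (zupd z i (a ord0 i + w)) - H (zupd z i (a ord0 i + w)))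
    ((1 + N%:R) ^+ size s * E) 1
     (z ord0 i - a ord0 i) (lexx _).
  rewrite mul1r expr1n mulr1; apply => // b; apply: IH => j; rewrite zupdE.
  by case: eqP => [->|_]; rewrite ?[a ord0 i + _]addrC ?addrK// (cmod_node N0 zetaP rho0).
rewrite (le_trans (cmodD _ _))// exprS -mulrA mulrDl mul1r lerD//.
  by rewrite (le_trans e1)// ler_peMl// exprn_ege1// lerDl.
by rewrite mulrC.
Qed.

Lemma tinterp_error F (r : R) z : 4 * rho < r ->
  (forall z, (forall i, cmod (z ord0 i - a ord0 i) < r) ->
     differentiable F z /\ cmod (F z) <= 1) ->
  (forall i, cmod (z ord0 i - a ord0 i) <= rho) ->
  cmod (F z - tinterp F z) <= (1 + N%:R) ^+ n.+1 * (6 / 4 ^+ N).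
Proof.
move=> rr HF zr; have := foldr_interp_error (enum 'I_n) rr HF zr.
by rewrite size_enum_ord mulrA -exprSr.
Qed.

(** The induction freezes at [z0] the coordinates outside [s], on which [F] still depends in an
    arbitrary way; evaluating at a node updates [z0], and [comp_mpoly] substitutes that node for the
    variable. *)
Lemma tinterp_mpoly F : exists P : mpoly.mpoly n C,
  forall z, tinterp F z = mpoly.meval (fun i => z ord0 i) P.
Proof.
suff H (s : seq 'I_n) z0 : exists P : mpoly.mpoly n C, forall z,
    (forall i, i \notin s -> z ord0 i = z0 ord0 i) ->
    foldr interp_at F s z = mpoly.meval (fun i => z ord0 i) P.
  have [P HP] := H (enum 'I_n) 0; exists P => z; apply: HP => i.
  by rewrite mem_enum.
elim: s z0 => [|i s IH] z0.
  exists (mpoly.mpolyC n (F z0)) => z zz; rewrite mpoly.mevalC; congr F.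
  by apply/rowP => i; exact: zz.
pose Q b : mpoly.mpoly n C := sval (cid (IH (zupd z0 i (a ord0 i + node b)))).
have HQ b z : (forall j, j \notin s -> z ord0 j = (zupd z0 i (a ord0 i + node b)) ord0 j) ->
    foldr interp_at F s z = mpoly.meval (fun i => z ord0 i) (Q b).
  by rewrite /Q; case: cid => P /= + h; apply.
pose lq b : n.-tuple (mpoly.mpoly n C) :=
  [tuple if j == i then mpoly.mpolyC n (a ord0 i + node b)
         else mpoly.mpolyX C (mpoly.mnm1 j) | j < n].
pose L b : mpoly.mpoly n C := (mpoly.mpolyC n (N%:R^-1 : C) : mpoly.mpoly n C) *
  \sum_(k < N) ((mpoly.mpolyX C (mpoly.mnm1 i) - mpoly.mpolyC n (a ord0 i)) *
     mpoly.mpolyC n (node b)^-1) ^+ k.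
exists (\sum_(b < N) mpoly.comp_mpoly (lq b) (Q b) * L b) => z zz /=.
rewrite /interp_at /interp (rmorph_sum (mpoly.meval (fun i => z ord0 i))).
apply: eq_bigr => b _; rewrite /= mpoly.mevalM; congr (_ * _).
  rewrite mpoly.comp_mpoly_meval (HQ b).
    apply: mpoly.meval_eq => j; rewrite tnth_mktuple zupdE.
    by case: eqP => _; rewrite ?mpoly.mevalC ?mpoly.mevalXU.
  move=> j js; rewrite !zupdE; case: eqP => // /eqP ji.
  by apply: zz; rewrite in_cons negb_or ji.
rewrite /lag /L mpoly.mevalM mpoly.mevalC; congr (_ * _).
rewrite (rmorph_sum (mpoly.meval (fun i => z ord0 i))); apply: eq_bigr => k _ /=.
rewrite (rmorphXn (mpoly.meval (fun i => z ord0 i))) /= mpoly.mevalM mpoly.mevalB.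
by rewrite !mpoly.mevalC mpoly.mevalXU.
Qed.
End TensorInterpolation.

(** * Growth of the entropy *)

Section LimitSuperior.
Context {R : realType} {T : choiceType} {X : filteredType T}.
Implicit Types (f : X -> \bar R) (F : set_system X).

Lemma limf_esup_le f F (y : \bar R) : (\forall x \near F, (f x <= y)%E) ->
  (limf_esup f F <= y)%E.
Proof.
move=> H; rewrite limf_esupE; apply: ereal_inf_le.
exists (ereal_sup (f @` [set x | (f x <= y)%E])); first by exists [set x | (f x <= y)%E].
by apply: ge_ereal_sup => _ [x /= ? <-].
Qed.

Lemma limf_esup_lt f F (y : \bar R) : Filter F -> (limf_esup f F < y)%E ->
  \forall x \near F, (f x < y)%E.
Proof.
move=> FF; rewrite limf_esupE => /ereal_inf_lt[_ [V FV <-] Vy].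
apply: filterS FV => x Vx; apply: le_lt_trans Vy.
by apply: ereal_sup_ubound; exists x.
Qed.

End LimitSuperior.

Section LogExp.
Context {R : realType}.

Lemma le_lne (x y : \bar R) : (x <= y)%E -> (lne x <= lne y)%E.
Proof.
move=> xy; have [x0|x0] := leP x 0%E; first by rewrite le0_lneNy ?leNye.
by rewrite lee_lne// in_itv/= leey andbT ltW// (lt_le_trans x0).
Qed.

Lemma near0_log (M : R) : \forall e \near 0^'+, 0 < e /\ M < ln e^-1.
Proof.
have : \forall e \near (0 : R)^'+, e < expR (- M) by apply: nbhs_right_lt; exact: expR_gt0.
apply: filterS2 (nbhs_right_gt (0 : R)) => e e0 eM; split => //.
rewrite lnV ?posrE// ltrNr -ltr_expR lnK ?posrE//.
Qed.

(** The half matches the definition of the entropy: sets of diameter [2 * eps] make a code of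
    precision [2 * eps], here [exp (- d)]. *)
Lemma near0_nat (P : R -> Prop) : (\forall e \near 0^'+, P e) ->
  exists d0 : nat, forall d, (d0 <= d)%N -> P (expR (- d%:R) / 2).
Proof.
case=> e /= e0 H.
exists (Num.trunc (ln e^-1)).+1 => d dd.
apply: H; last by rewrite divr_gt0// expR_gt0.
rewrite /ball_/= sub0r normrN gtr0_norm ?divr_gt0 ?expR_gt0//.
apply: (@le_lt_trans _ _ (expR (- d%:R))).
  by rewrite ler_pdivrMr// ler_peMr ?expR_ge0// ler1n.
rewrite -ltr_ln ?posrE ?expR_gt0// expRK ltrNl -lnV ?posrE//.
by rewrite (lt_le_trans (truncnS_gt _))// ler_nat.
Qed.

End LogExp.

Section EntropyGrowth.
Context {R : realType}.
Local Notation C := (CC R).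

Definition unit_holo n (D : set 'rV[C]_n) (F : 'rV[C]_n -> C) : Prop :=
  holomorphic_on D F /\ forall z, D z -> cmod (F z) <= 1.

Lemma unit_ball_restrP n (X D : set 'rV[C]_n) (f : X -> C) :
  @unit_ball_restr R n X D f <-> exists2 F, unit_holo D F & f = F \o set_val.
Proof.
split=> [[F [hF sF] <-]|[F [hF sF] ->]].
  exists F => //; split => // z Dz; rewrite -lee_fin; apply: le_trans sF.
  by apply: ereal_sup_ubound; exists z.
exists F => //; split => //; apply: ge_ereal_sup => _ [z Dz <-].
by rewrite lee_fin sF.
Qed.

(* A cover of [A_X^D] by [k] sets of small diameter is encoded as a map to a
   [k]-element type whose fibres have small diameter. *)
Definition coded n (X D : set 'rV[C]_n) (e : R) (K : finType)
    (c : ('rV[C]_n -> C) -> K) : Prop :=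
  forall F G, unit_holo D F -> unit_holo D G -> c F = c G ->
    forall x, X x -> cmod (F x - G x) <= e.

(* [H_eps (A_X^D) = O ((log 1/eps) ^ (s + 1))] along [eps = exp (- d)];
   [Psi X D] is the infimum of these [s]. *)
Definition ent_growth n (X D : set 'rV[C]_n) (s : R) : Prop :=
  exists (A : R) (d0 : nat), forall d, (d0 <= d)%N ->
    exists (K : finType) (c : ('rV[C]_n -> C) -> K),
      #|K|%:R <= expR (A * d%:R `^ (s + 1)) /\ coded X D (expR (- d%:R)) c.

Lemma unit_holo_cst n (D : set 'rV[C]_n) (k : C) : cmod k <= 1 -> unit_holo D (fun=> k).
Proof. by move=> k1; split => // z _; exact: differentiable_cst. Qed.

Lemma covered_coded n (X D : set 'rV[C]_n) (e : R) k :
  covered_by (@sup_dist R X) e (@unit_ball_restr R n X D) k ->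
  exists c : ('rV[C]_n -> C) -> option 'I_k, coded X D (2 * e) c.
Proof.
move=> [U [dU UE]].
(* [None] is the code of the functions outside the unit ball, which keeps the code total. *)
have H F : exists o : option 'I_k, unit_holo D F ->
    exists2 i, o = Some i & U i (F \o set_val).
  have [uF|] := pselect (unit_holo D F); last by exists None.
  have : (\bigcup_i U i) (F \o set_val).
    by rewrite UE; apply/unit_ball_restrP; exists F.
  by move=> [i _ Ui]; exists (Some i) => _; exists i.
exists (fun F => sval (cid (H F))) => F G uF uG; case: cid => o /=.
case: cid => o' /= /(_ uG)[j -> Uj] /(_ uF)[i -> Ui] [ij] x Xx.
rewrite ij in Ui; rewrite -lee_fin; apply: le_trans (dU j).
apply: (@le_trans _ _ (sup_dist (F \o set_val : X -> C) (G \o set_val))).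
  apply: ereal_sup_ubound; exists (SigSub (mem_set Xx)) => //.
by apply: ereal_sup_ubound; exists (F \o set_val, G \o set_val).
Qed.

Lemma coded_covered n (X D : set 'rV[C]_n) (e : R) (K : finType)
    (c : ('rV[C]_n -> C) -> K) : coded X D (2 * e) c ->
  covered_by (@sup_dist R X) e (@unit_ball_restr R n X D) #|K|.
Proof.
move=> Hc; exists (fun i => [set f | exists F, [/\ unit_holo D F,
   f = F \o set_val & c F = enum_val i]]); split.
  move=> i; apply: ge_ereal_sup => _ [[_ _] [[F [uF -> cF]] [G [uG -> cG]]] <-] /=.
  apply: ge_ereal_sup => _ [x _ <-]; rewrite lee_fin; apply: Hc => //.
    by rewrite cF cG.
  exact: set_valP.
apply/seteqP; split => [f [i _ [F [uF -> _]]]|f /unit_ball_restrP[F uF ->]].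
  by apply/unit_ball_restrP; exists F.
by exists (enum_rank (c F)) => //; exists F; split => //; rewrite enum_rankK.
Qed.

Lemma covering_number_ge0 n (X D : set 'rV[C]_n) (e : R) :
  (0 <= covering_number (@sup_dist R X) e (@unit_ball_restr R n X D))%E.
Proof. by apply: le_ereal_inf_tmp => _ [k _ <-]; rewrite lee_fin. Qed.

Lemma Psi_lt_ent n (X D : set 'rV[C]_n) (s : R) : -1 <= s ->
  (Psi X D < s%:E)%E -> ent_growth X D s.
Proof.
move=> s1; rewrite /Psi lteBlDr// -EFinD => /limf_esup_lt.
move=> H1.
have [d0 H] : exists d0 : nat, forall d, (d0 <= d)%N ->
   exists k, k%:R < expR ((ln (expR (- d%:R) / 2)^-1) `^ (s + 1)) /\
     covered_by (@sup_dist R X) (expR (- d%:R) / 2) (@unit_ball_restr R n X D) k.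
  apply: (@near0_nat R (fun e => exists k, k%:R < expR ((ln e^-1) `^ (s + 1)) /\
     covered_by (@sup_dist R X) e (@unit_ball_restr R n X D) k)).
  apply: filterS2 H1 (near0_log 1) => e H [e0 L1].
  have lL : 0 < ln (ln e^-1) by rewrite ln_gt0.
  have L0 : 0 < ln e^-1 by apply: lt_trans L1.
  suff : (covering_number (@sup_dist R X) e (@unit_ball_restr R n X D)
       < (expR ((ln e^-1) `^ (s + 1)))%:E)%E.
    by move=> /ereal_inf_lt[_ [k ck <-]]; rewrite lte_fin => ke; exists k.
  move: H; rewrite /entropy.
  set N := covering_number _ _ _ => H; have N0 : (0 <= N)%E by exact: covering_number_ge0.
  rewrite ltNge; apply/negP => EN; move: H; apply/negP; rewrite -leNgt.
  rewrite inver (gt_eqF lL) lee_pdivlMr//.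
  have P0 : 0 < (ln e^-1) `^ (s + 1) by rewrite powR_gt0.
  have := le_lne (le_lne EN); rewrite lne_EFin ?expR_gt0// expRK lne_EFin//.
  by rewrite ln_powR.
(* [2 ^ (s + 1)] comes from [ln (1 / eps) = d + ln 2 <= 2 d], and the leading [2] absorbs the extra
   code [None]; both use [s + 1 >= 0]. *)
exists (2 * 2 `^ (s + 1)), (maxn d0 1) => d; rewrite geq_max => /andP[/H{H} [k [kA kc]] d1].
have [c Hc] := covered_coded kc; exists (option 'I_k : finType), c; split; last first.
  by move: Hc; rewrite mulrC divfK.
rewrite card_option card_ord.
have L : ln (expR (- d%:R) / 2)^-1 = d%:R + ln 2 :> R.
  by rewrite invfM invrK -expRN opprK lnM ?posrE ?expR_gt0// expRK.
have ln2 : 0 <= ln (2 : R) <= 1.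
  rewrite ln_ge0/= ?ler1n//; rewrite -[leRHS](expRK 1) ler_ln ?posrE ?expR_gt0//.
  by rewrite (le_trans _ (expR_ge1Dx 1))// -natr1.
have dR : 1 <= d%:R :> R by rewrite ler1n.
set A := _ `^ _ in kA.
have AB : A <= 2 `^ (s + 1) * d%:R `^ (s + 1).
  by rewrite -powRM ?ler0n// /A L ge0_ler_powR ?nnegrE//; lra.
have A1 : 1 <= 2 `^ (s + 1) * d%:R `^ (s + 1).
  rewrite -powRM ?ler0n// -[leLHS](powRr0 (2 * d%:R)) ler_powR//; lra.
have e2 : 2 * expR A <= expR (1 + A).
  by rewrite expRD ler_pM2r ?expR_gt0// (le_trans _ (expR_ge1Dx 1))// -natr1.
apply: (@le_trans _ _ (2 * expR A)).
  have : 1 <= expR A by rewrite -expR0 ler_expR powR_ge0.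
  by rewrite -natr1; move: kA; move: (expR A) => u; lra.
apply: (le_trans e2); rewrite ler_expR -mulrA; move: AB A1.
by move: (2 `^ (s + 1) * _) => u; lra.
Qed.

Lemma ent_Psi_le n (X D : set 'rV[C]_n) (s : R) : -1 <= s ->
  ent_growth X D s -> (Psi X D <= s%:E)%E.
Proof.
move=> s1 [A0 [d0 H0]]; pose A := `|A0| + 1.
have Ap : 0 < A by rewrite ltr_wpDl.
have H d : (d0 <= d)%N -> exists (K : finType) (c : ('rV[C]_n -> C) -> K),
    #|K|%:R <= expR (A * d%:R `^ (s + 1)) /\ coded X D (expR (- d%:R)) c.
  move=> /H0 [K [c [Kc cc]]]; exists K, c; split => //; apply: (le_trans Kc).
  rewrite ler_expR ler_wpM2r ?powR_ge0// /A.
  by rewrite (le_trans (ler_norm _))// lerDl.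
apply/lee_addgt0Pr => t t0; rewrite -EFinD /Psi leeBlDr// -EFinD.
apply: limf_esup_le.
(* Beyond [M], [ln L] is positive, the integer just above [L] is an admissible index, and [L ^ t]
   absorbs the constant [A * 2 ^ (s + 1)]. *)
pose M := Num.max (Num.max 1 d0%:R) ((A * 2 `^ (s + 1)) `^ t^-1).
apply: filterS (near0_log M) => e [e0]; set L := ln e^-1.
rewrite !gt_max => /andP[/andP[L1 Ld] LA].
have L0 : 0 < L by apply: lt_trans L1.
have lL : 0 < ln L by rewrite ln_gt0.
rewrite inver (gt_eqF lL) lee_pdivrMr//.
have [|K [c [Kc cc]]] := H (Num.trunc L).+1.
  by rewrite -(ler_nat R) (le_trans (ltW Ld))// ltW// truncnS_gt.
set d := (Num.trunc L).+1 in Kc cc.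
have Ld1 : L <= d%:R by rewrite ltW// truncnS_gt.
have dL : d%:R <= 2 * L.
  have : (Num.trunc L)%:R <= L by rewrite truncn_le ltW.
  by rewrite /d -natr1; lra.
have /coded_covered cov : coded X D (2 * e) c.
  move=> F G uF uG cFG x Xx; apply: le_trans (cc F G uF uG cFG x Xx) _.
  have : expR (- d%:R) <= e.
    by rewrite -ler_ln ?posrE ?expR_gt0// expRK lerNl -lnV ?posrE.
  by lra.
have K0 : (0 < #|K|)%N by apply/card_gt0P; exists (c (fun=> 0)).
have : (entropy (@sup_dist R X) e (@unit_ball_restr R n X D) <= (L `^ (s + t + 1))%:E)%E.
  rewrite /entropy; apply: (@le_trans _ _ (lne #|K|%:R%:E)).
    by apply: le_lne; apply: ereal_inf_lbound; exists #|K|.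
  rewrite lne_EFin ?ltr0n// lee_fin -[leRHS]expRK ler_ln ?posrE ?expR_gt0 ?ltr0n//.
  apply: (le_trans Kc); rewrite ler_expR.
  apply: (@le_trans _ _ (A * (2 * L) `^ (s + 1))).
    by rewrite ler_pM2l// ge0_ler_powR ?nnegrE ?ler0n//; lra.
  rewrite powRM ?ler0n// ?(ltW L0)// mulrA.
  have -> : s + t + 1 = t + (s + 1) by ring.
  rewrite [leRHS]powRD ?(gt_eqF L0) ?implybT// ler_wpM2r ?powR_ge0//.
  have := ltW LA => /(@ge0_ler_powR _ t (ltW t0)).
  rewrite !nnegrE powR_ge0 -powRrM mulVf ?gt_eqF// powRr1 ?(ltW L0).
    exact.
  by rewrite mulr_ge0 ?powR_ge0// ltW.
move=> /le_lne/le_trans; apply; rewrite lne_EFin ?powR_gt0// ln_powR.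
by rewrite -EFinM lee_fin; apply: ler_wpM2r; [exact: ltW|lra].
Qed.

End EntropyGrowth.

(** * Polydiscs, boundedness and compactness *)

Section Polydisc.
Context {R : realType}.
Local Notation C := (CC R).

Definition polydisc n (a : 'rV[C]_n) (r : R) : set 'rV[C]_n :=
  [set z | forall i, cmod (z ord0 i - a ord0 i) < r].

Lemma polydisc_ball n (a : 'rV[C]_n) (r : R) : 0 < r -> polydisc a r = ball a (cR r).
Proof.
move=> r0; apply/seteqP; split => z.
  move=> za; split; first by rewrite -cR0 cR_lt.
  by move=> i j; rewrite ord1; apply/ballCP; rewrite cmodBC.
by move=> [_ za] i; rewrite cmodBC; apply/ballCP.
Qed.

Lemma nbhs_polydiscP n (a : 'rV[C]_n) (A : set 'rV[C]_n) :
  nbhs a A <-> exists2 r : R, 0 < r & polydisc a r `<=` A.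
Proof.
split=> [/nbhs_ballP[e /= e0 eA]|[r r0 rA]].
  have [ee e0'] := cR_gt0P e0; exists (complex.Re e) => //.
  by rewrite (polydisc_ball a e0') -ee.
apply/nbhs_ballP; exists (cR r); first by rewrite /= -cR0 cR_lt.
by rewrite -polydisc_ball.
Qed.

Lemma polydisc_open n (a : 'rV[C]_n) (r : R) : open (polydisc a r).
Proof.
rewrite openE => z za; apply/nbhs_polydiscP.
pose m := \big[Num.max/0]_i cmod (z ord0 i - a ord0 i).
have [r0|r0] := leP r 0.
  exists 1 => // w _ i; have := za i; move=> /lt_le_trans/(_ r0).
  by rewrite ltNge cmod_ge0.
have mr : m < r by apply/bigmax_ltP; split.
exists (r - m); first by rewrite subr_gt0.
move=> w wz i; rewrite -(subrK (z ord0 i) (w ord0 i)) -addrA.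
apply: (le_lt_trans (cmodD _ _)).
have : cmod (z ord0 i - a ord0 i) <= m by exact: le_bigmax.
by have := wz i; lra.
Qed.

Lemma polydisc_center n (a : 'rV[C]_n) (r : R) : 0 < r -> polydisc a r a.
Proof. by move=> r0 i; rewrite subrr cmod0. Qed.

Lemma lineE n (a v : 'rV[C]_n) (t : C) i :
  (a + t *: v) ord0 i = a ord0 i + t * v ord0 i.
Proof. by rewrite !mxE. Qed.

Lemma subvE n (a v : 'rV[C]_n) i : (a - v) ord0 i = a ord0 i - v ord0 i.
Proof. by rewrite !mxE. Qed.

(** A polydisc is the union of the segments joining its points to the centre. *)
Lemma polydisc_connected n (a : 'rV[C]_n) (r : R) : connected (polydisc a r).
Proof.
pose seg (z : 'rV[C]_n) := (fun t : R => a + cR t *: (z - a)) @` `[0, 1].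
have -> : polydisc a r = \bigcup_(z in polydisc a r) seg z.
  apply/seteqP; split => [z za|w [z za [t /= t01 <-]]].
    exists z => //; exists 1; first by rewrite /= in_itv/= ler01 lexx.
    by rewrite cR1 scale1r addrC subrK.
  move=> i; rewrite lineE subvE addrAC subrr add0r; move: t01; rewrite in_itv/= => /andP[t0 t1].
  rewrite cmodM cmodR ger0_norm//.
  by apply: le_lt_trans (za i); rewrite ler_piMl ?cmod_ge0.
apply: bigcup_connected.
  exists a => z za; exists 0; first by rewrite /= in_itv/= ler01 lexx.
  by rewrite cR0 scale0r addr0.
move=> z za; apply: connected_continuous_connected; first exact: segment_connected.
apply: continuous_subspaceT => t A /nbhs_polydiscP[e e0 eA].
pose m := \sum_i cmod (z ord0 i - a ord0 i).
have m0 : 0 <= m by apply: sumr_ge0 => i _; exact: cmod_ge0.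
have m1 : 0 < m + 1 by rewrite ltr_wpDl.
apply/nbhs_ballP; exists (e / (m + 1)); first by rewrite /= divr_gt0.
move=> u; rewrite /ball/= ltr_pdivlMr// => ut; apply: eA => i.
have -> : (a + cR u *: (z - a)) ord0 i - (a + cR t *: (z - a)) ord0 i =
    cR (u - t) * (z ord0 i - a ord0 i).
  have -> := congr2 (fun x y : C => x - y) (lineE a (z - a) (cR u) i)
    (lineE a (z - a) (cR t) i).
  by rewrite subvE cRB; ring.
rewrite cmodM cmodR distrC; apply: le_lt_trans ut.
rewrite ler_wpM2l// /m (bigD1 i)//= -addrA lerDl addr_ge0// sumr_ge0// => j _.
exact: cmod_ge0.
Qed.

Lemma bounded_coord n (D : set 'rV[C]_n) : bounded_set D ->
  exists2 M : R, 0 < M & forall z, D z -> forall i, cmod (z ord0 i) < M.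
Proof.
move=> [K [Kr H]]; have K0 : 0 < `|K| + 1 by rewrite ltr_wpDl.
have K1 : K < `|K| + 1 by rewrite (le_lt_trans (real_ler_norm Kr))// ltrDl.
have K2 : `|K| + 1 < `|K| + 1 + 1 by rewrite ltrDl.
have [e0 e1] := cR_gt0P (lt_trans K0 K2).
exists (complex.Re (`|K| + 1 + 1)) => // z Dz i.
have : ball 0 (`|K| + 1 + 1) z.
  rewrite -ball_normE /ball_/= sub0r normrN; exact: le_lt_trans (H _ K1 z Dz) K2.
by rewrite e0 -polydisc_ball// => /(_ i); rewrite mxE subr0.
Qed.

Lemma coord_bounded n (D : set 'rV[C]_n) (M : R) :
  (forall z, D z -> forall i, cmod (z ord0 i) < M) -> bounded_set D.
Proof.
move=> H; exists (cR (`|M| + 1)); split; first by rewrite complex_real.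
move=> x Mx z Dz; have M1 : 0 < `|M| + 1 by rewrite ltr_wpDl.
suff : ball 0 (cR (`|M| + 1)) z.
  rewrite -ball_normE /ball_/= sub0r normrN => h; exact: ltW (lt_trans h Mx).
rewrite -polydisc_ball// => i; rewrite mxE subr0.
by rewrite (lt_le_trans (H z Dz i))// (le_trans (ler_norm _))// lerDl.
Qed.

Lemma polydisc_domain n (a : 'rV[C]_n) (r : R) : 0 < r -> domain (polydisc a r).
Proof.
move=> r0; split; [exact: polydisc_open|exact: polydisc_connected|].
by exists a; exact: polydisc_center.
Qed.

Lemma polydisc_bounded n (a : 'rV[C]_n) (r : R) : bounded_set (polydisc a r).
Proof.
apply: (@coord_bounded _ _ (r + \sum_i cmod (a ord0 i))) => z za i.
rewrite -(subrK (a ord0 i) (z ord0 i)); apply: (le_lt_trans (cmodD _ _)).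
rewrite ltr_leD ?za// (bigD1 i)//= lerDl sumr_ge0// => j _; exact: cmod_ge0.
Qed.

Lemma compact_polydisc_cover n (X : set 'rV[C]_n) (r : 'rV[C]_n -> R) :
  compact X -> (forall x, X x -> 0 < r x) ->
  exists2 s : seq 'rV[C]_n, (forall x, x \in s -> X x) &
    forall z, X z -> exists2 x, x \in s & polydisc x (r x) z.
Proof.
rewrite compact_cover => cX r0.
have [||s sX Xs] := cX _ X (fun x => polydisc x (r x)).
- by move=> x _; exact: polydisc_open.
- by move=> x Xx; exists x => //; apply: polydisc_center; exact: r0.
exists (finmap.enum_fset s); first by move=> x /sX; rewrite inE.
by move=> z /Xs[x xs]; exists x.
Qed.

Lemma compact_coord_bounded n (X : set 'rV[C]_n) : compact X ->
  exists2 M : R, 0 < M & forall z, X z -> forall i, cmod (z ord0 i) < M.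
Proof.
move=> cX; have [|s _ sX] := @compact_polydisc_cover _ X (fun=> 1) cX; first by [].
pose B (x : 'rV[C]_n) := \sum_i cmod (x ord0 i).
have B0 x : 0 <= B x by apply: sumr_ge0 => i _; exact: cmod_ge0.
exists (1 + \sum_(x <- s) B x); first by rewrite ltr_pwDl// sumr_ge0.
move=> z /sX[x xs zx] i; rewrite -(subrK (x ord0 i) (z ord0 i)).
apply: (le_lt_trans (cmodD _ _)); rewrite ltr_leD ?zx//.
apply: (@le_trans _ _ (B x)).
  by rewrite /B (bigD1 i)//= lerDl sumr_ge0// => j _; exact: cmod_ge0.
by rewrite (big_rem x)//= lerDl sumr_ge0.
Qed.

Lemma bounded_domain_exists n (X : set 'rV[C]_n) (M : R) : 0 < M ->
  (forall z, X z -> forall i, cmod (z ord0 i) < M) ->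
  [/\ domain (polydisc (0 : 'rV[C]_n) M), bounded_set (polydisc (0 : 'rV[C]_n) M)
    & X `<=` polydisc 0 M].
Proof.
move=> M0 XM; split; [exact: polydisc_domain|exact: polydisc_bounded|].
by move=> z Xz i; rewrite mxE subr0; exact: XM.
Qed.

Lemma square_compact (M : R) : compact [set z : C | `|complex.Re z| <= M /\ `|complex.Im z| <= M].
Proof.
have -> : [set z : C | `|complex.Re z| <= M /\ `|complex.Im z| <= M] =
    (fun p : R * R => Complex p.1 p.2 : C) @` (`[- M, M] `*` `[- M, M]).
  apply/seteqP; split => [[a b] /= [aM bM]|_ [[a b] [/= aM bM] <-]].
    by exists (a, b) => //=; rewrite !in_itv/= -!ler_norml.
  by move: aM bM; rewrite !in_itv/= -!ler_norml.
apply: continuous_compact; last by apply: compact_setX; exact: segment_compact.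
apply: continuous_subspaceT => -[a b].
by apply: cvg_Complex; [exact: cvg_fst|exact: cvg_snd].
Qed.

Lemma closed_bounded_compact n (X : set 'rV[C]_n) (M : R) : closed X ->
  (forall z, X z -> forall i, cmod (z ord0 i) <= M) -> compact X.
Proof.
move=> cX XM; have K := @rV_compact C n (fun=> _) (fun=> @square_compact M).
apply: (subclosed_compact cX K) => z Xz i /=.
by split; rewrite (le_trans _ (XM z Xz i)) ?Re_le_cmod ?Im_le_cmod.
Qed.

End Polydisc.

(** * Differentiability of polynomials and stability of the growth condition *)

Section Growth.
Context {R : realType}.
Local Notation C := (CC R).

Lemma differentiable_mulf n (f g : 'rV[C]_n -> C) z :
  differentiable f z -> differentiable g z -> differentiable (fun w => f w * g w) z.
Proof. exact: differentiableM. Qed.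

Lemma differentiable_addf n (f g : 'rV[C]_n -> C) z :
  differentiable f z -> differentiable g z -> differentiable (fun w => f w + g w) z.
Proof. exact: differentiableD. Qed.

Lemma differentiable_sumf n (I : Type) (s : seq I) (f : I -> 'rV[C]_n -> C) z :
  (forall i, differentiable (f i) z) ->
  differentiable (fun w => \sum_(i <- s) f i w) z.
Proof.
move=> df; elim: s => [|i s IH].
  by under eq_fun do rewrite big_nil; exact: differentiable_cst.
by under eq_fun do rewrite big_cons; exact: differentiable_addf.
Qed.

Lemma differentiable_prodf n (I : Type) (s : seq I) (f : I -> 'rV[C]_n -> C) z :
  (forall i, differentiable (f i) z) ->
  differentiable (fun w => \prod_(i <- s) f i w) z.
Proof.
move=> df; elim: s => [|i s IH].
  by under eq_fun do rewrite big_nil; exact: differentiable_cst.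
by under eq_fun do rewrite big_cons; exact: differentiable_mulf.
Qed.

Lemma differentiable_expf n (f : 'rV[C]_n -> C) k z :
  differentiable f z -> differentiable (fun w => f w ^+ k) z.
Proof.
move=> df; elim: k => [|k IH].
  by under eq_fun do rewrite expr0; exact: differentiable_cst.
by under eq_fun do rewrite exprS; exact: differentiable_mulf.
Qed.

Lemma meval_differentiable n (P : mpoly.mpoly n C) (z : 'rV[C]_n) :
  differentiable (fun w : 'rV[C]_n => mpoly.meval (fun i => w ord0 i) P) z.
Proof.
under eq_fun do rewrite mpoly.mevalE.
apply: differentiable_sumf => m; apply: differentiable_mulf.
  exact: differentiable_cst.
apply: differentiable_prodf => i; apply: differentiable_expf.
exact: differentiable_coord.
Qed.

Lemma expR1_le4 : expR 1 <= 4 :> R.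
Proof.
have h : expR (- 2^-1) * expR (2^-1) = 1 :> R by rewrite -expRD addNr expR0.
have := expR_ge1Dx (- 2^-1 : R).
have -> : expR 1 = expR (2^-1) * expR (2^-1) :> R by rewrite -expRD; congr expR; lra.
have := expR_gt0 (2^-1 : R); nra.
Qed.

Lemma expRn (d : nat) : expR d%:R = expR 1 ^+ d :> R.
Proof. by rewrite -expRM_natl mulr1. Qed.

(** With [N = 4 * d], [4 ^- N] is at most [exp (- 4 d)], and the power of [N] costs at most a
    constant times [exp (2 d)]; what remains is a constant times [exp (- 2 d)]. The leading [2]
    accounts for the two functions being compared. *)
Lemma interp_error_small m : exists d0 : nat, forall d, (d0 <= d)%N ->
  2 * ((1 + (4 * d)%:R) ^+ m.+1 * (6 / 4 ^+ (4 * d))) + expR (- (2 * d)%:R)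
    <= expR (- d%:R) :> R.
Proof.
pose c : R := (2 * m.+1)%:R; pose B := 24 * c ^+ m.+1 + 2.
have c0 : 0 < c by rewrite ltr0n muln_gt0.
have B0 : 0 < B by rewrite ltr_wpDl// mulr_ge0// exprn_ge0// ltW.
exists (Num.trunc (ln B)).+1 => d dd.
have eB : B <= expR d%:R.
  rewrite -[leLHS]lnK ?posrE// ler_expR ltW// (lt_le_trans (truncnS_gt _))//.
  by rewrite ler_nat.
set N := (4 * d)%N; set E := expR d%:R in eB.
have E0 : 0 < E by exact: expR_gt0.
have E2 : expR (- (2 * d)%:R) = (E ^+ 2)^-1 :> R.
  by rewrite expRN natrM mulr2n mulrDl mul1r expRD.
have E1 : expR (- d%:R) = E^-1 :> R by rewrite expRN.
have h4 : (4 ^+ N)^-1 <= (E ^+ 4)^-1 :> R.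
  rewrite lef_pV2 ?posrE ?exprn_gt0// /E expRn -exprM mulnC.
  by rewrite lerXn2r ?nnegrE ?expR_ge0// expR1_le4.
have hN : (1 + N%:R) ^+ m.+1 <= c ^+ m.+1 * E ^+ 2 :> R.
  have -> : E ^+ 2 = (expR (N%:R / c)) ^+ m.+1.
    rewrite -!expRM_natl; congr expR; rewrite /c /N !natrM.
    by field; rewrite nat1r pnatr_eq0.
  rewrite -exprMn; apply: lerXn2r; rewrite ?nnegrE; [exact: addr_ge0|by rewrite mulr_ge0 ?expR_ge0// ltW|].
  have : c * (1 + N%:R / c) <= c * expR (N%:R / c) by rewrite ler_pM2l// expR_ge1Dx.
  have -> : c * (1 + N%:R / c) = c + N%:R by field; rewrite gt_eqF.
  by apply: le_trans; rewrite lerD2r /c ler1n muln_gt0.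
have E10 : 0 < E^-1 by rewrite invr_gt0.
rewrite E2 E1.
apply: (@le_trans _ _ (B / 2 / E ^+ 2 + (E ^+ 2)^-1)); last first.
  rewrite -[leRHS]mul1r -[X in _ + X]mul1r -mulrDl expr2 invfM mulrA ler_pM2r//.
  rewrite ler_pdivrMr// mul1r; have : 2 <= B by rewrite lerDr mulr_ge0// exprn_ge0// ltW.
  by move: eB; lra.
rewrite lerD2r.
have -> : B / 2 / E ^+ 2 = (12 * c ^+ m.+1 + 1) / E ^+ 2 by rewrite /B; field; rewrite gt_eqF.
apply: (@le_trans _ _ (12 * (c ^+ m.+1 * E ^+ 2) * (E ^+ 4)^-1)).
  have -> : 2 * ((1 + N%:R) ^+ m.+1 * (6 / 4 ^+ N)) = 12 * (1 + N%:R) ^+ m.+1 * (4 ^+ N)^-1 :> R.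
    by ring.
  apply: ler_pM => //.
  by rewrite ler_pM2l.
have -> : 12 * (c ^+ m.+1 * E ^+ 2) / E ^+ 4 = 12 * c ^+ m.+1 / E ^+ 2.
  by field; rewrite gt_eqF.
by rewrite ler_pM2r ?invr_gt0 ?exprn_gt0// lerDl.
Qed.

Lemma ent_growthS n (X Y D : set 'rV[C]_n) s : Y `<=` X ->
  ent_growth X D s -> ent_growth Y D s.
Proof.
move=> YX [A [d0 H]]; exists A, d0 => d /H[K [c [Kc cc]]]; exists K, c; split => //.
by move=> F G uF uG cFG y /YX; exact: cc.
Qed.

Lemma ent_growth0 n (D : set 'rV[C]_n) s : ent_growth set0 D s.
Proof.
exists 0, 0%N => d _; exists (unit : finType), (fun=> tt); split => //.
by rewrite card_unit mul0r expR0.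
Qed.

Lemma ent_growthU n (X Y D : set 'rV[C]_n) s : ent_growth X D s ->
  ent_growth Y D s -> ent_growth (X `|` Y) D s.
Proof.
move=> [A [d0 H]] [B [e0 K]]; exists (A + B), (maxn d0 e0) => d.
rewrite geq_max => /andP[/H[K1 [c1 [Kc1 cc1]]] /K[K2 [c2 [Kc2 cc2]]]].
exists (K1 * K2 : finType)%type, (fun F => (c1 F, c2 F)); split.
  by rewrite card_prod natrM mulrDl expRD ler_pM.
move=> F G uF uG [e1 e2] x [Xx|Yx]; [exact: cc1 Xx|exact: cc2 Yx].
Qed.

Lemma ent_growth_comp n k (X : set 'rV[C]_n) (D : set 'rV[C]_n) (D' : set 'rV[C]_k)
    (phi : 'rV[C]_n -> 'rV[C]_k) s :
  holomorphic_on D phi -> (forall z, D z -> D' (phi z)) ->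
  ent_growth X D s -> ent_growth (phi @` X) D' s.
Proof.
move=> hphi DD [A [d0 H]]; exists A, d0 => d /H[K [c [Kc cc]]].
exists K, (fun F => c (F \o phi)); split => //.
have uphi F : unit_holo D' F -> unit_holo D (F \o phi).
  move=> [dF F1]; split => z Dz; last by apply: F1; exact: DD.
  by apply: differentiable_comp; [exact: hphi|apply: dF; exact: DD].
by move=> F G /uphi uF /uphi uG cFG _ [x Xx <-]; exact: (cc _ _ uF uG cFG x Xx).
Qed.

End Growth.

(** * Codes from interpolation on a small polydisc *)

Section LocalGrowth.
Context {R : realType}.
Local Notation C := (CC R).
Variables (n : nat) (a : 'rV[C]_n) (r rho : R).
Hypothesis rho0 : 0 < rho.
Hypothesis rhor : 4 * rho < r.

Let rho_r : rho < r.
Proof. by apply: le_lt_trans rhor; rewrite ler_peMl ?ler1n// ltW. Qed.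

Lemma tinterp_codeP (X : set 'rV[C]_n) N (zeta : C) (d : nat) F G :
  (0 < N)%N -> N.-primitive_root zeta ->
  (forall z, X z -> forall i, cmod (z ord0 i - a ord0 i) <= rho) ->
  2 * ((1 + N%:R) ^+ n.+1 * (6 / 4 ^+ N)) + expR (- (2 * d)%:R) <= expR (- d%:R) :> R ->
  unit_holo (polydisc a r) F -> unit_holo (polydisc a r) G ->
  (forall z, X z -> cmod (tinterp N zeta rho a F z - tinterp N zeta rho a G z)
      <= expR (- (2 * d)%:R)) ->
  forall z, X z -> cmod (F z - G z) <= expR (- d%:R).
Proof.
move=> N0 zP Xr small [dF F1] [dG G1] FG z Xz.
have eF : cmod (F z - tinterp N zeta rho a F z) <= (1 + N%:R) ^+ n.+1 * (6 / 4 ^+ N).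
  apply: (tinterp_error N0 zP rho0 rhor) (Xr z Xz) => w wr.
  by split; [exact: dF|exact: F1].
have eG : cmod (G z - tinterp N zeta rho a G z) <= (1 + N%:R) ^+ n.+1 * (6 / 4 ^+ N).
  apply: (tinterp_error N0 zP rho0 rhor) (Xr z Xz) => w wr.
  by split; [exact: dG|exact: G1].
apply: le_trans small; have := FG z Xz.
have -> : F z - G z = (F z - tinterp N zeta rho a F z) +
   (tinterp N zeta rho a F z - tinterp N zeta rho a G z) -
   (G z - tinterp N zeta rho a G z) by ring.
have := cmodB ((F z - tinterp N zeta rho a F z) +
   (tinterp N zeta rho a F z - tinterp N zeta rho a G z)) (G z - tinterp N zeta rho a G z).
have := cmodD (F z - tinterp N zeta rho a F z)
   (tinterp N zeta rho a F z - tinterp N zeta rho a G z).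
by move: eF eG; move: (_ ^+ n.+1 * _) => E; lra.
Qed.

Lemma node_in_polydisc N (zeta : C) (z : 'rV[C]_n) : (0 < N)%N -> N.-primitive_root zeta ->
  (forall i, exists b, z ord0 i = a ord0 i + node zeta rho b) -> polydisc a r z.
Proof.
move=> N0 zP zn i; have [b ->] := zn i.
by rewrite addrC addKr (cmod_node N0 zP rho0).
Qed.

(** A function on the polydisc is coded through its interpolant, a polynomial that is bounded by [M]
    on [D]; divided by [M] it lies in the unit ball of [D], where the given code applies. *)
Lemma ent_growth_local (X D : set 'rV[C]_n) (kappa s : R) : 1 <= kappa -> -1 <= s ->
  (forall z, X z -> forall i, cmod (z ord0 i - a ord0 i) <= rho) ->
  (forall z, D z -> forall i, cmod (z ord0 i - a ord0 i) <= kappa * rho) ->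
  ent_growth X D s -> ent_growth X (polydisc a r) s.
Proof.
move=> k1 s1 Xr Dk [A [d0 H]]; have [e0 He] := @interp_error_small R n.
pose q := (Num.trunc kappa).+1.
have kq : kappa <= expR q%:R.
  by rewrite (le_trans _ (expR_ge1Dx _))// ltW// (lt_trans (truncnS_gt _))// ltrDr.
(* Undoing the division by [M <= exp (4 (1 + q) n d)] must leave the precision [exp (- 2 d)]. *)
pose B := (4 * (1 + q) * n + 2)%N.
exists (A * B%:R `^ (s + 1)), (maxn (maxn d0 e0) 1) => d.
rewrite !geq_max => /andP[/andP[dd0 de0] d1].
pose N := (4 * d)%N; have N0 : (0 < N)%N by rewrite muln_gt0.
have [zeta zP] := @closed_prim_root C N N0.
have [|K [c [Kc cc]]] := H (B * d)%N.
  by rewrite (leq_trans dd0)// leq_pmull// /B addn2.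
pose M : R := (N%:R * kappa ^+ N) ^+ n.
have M0 : 0 < M.
  by rewrite exprn_gt0// mulr_gt0 ?ltr0n// exprn_gt0// (lt_le_trans ltr01).
have MB : M * expR (- (B * d)%:R) <= expR (- (2 * d)%:R).
  rewrite expRN ler_pdivrMr ?expR_gt0// -expRD.
  have : M <= (expR (N%:R * (1 + q%:R))) ^+ n.
    apply: lerXn2r; rewrite ?nnegrE ?expR_ge0//.
      by rewrite mulr_ge0 ?exprn_ge0// (le_trans ler01).
    rewrite mulrDr mulr1 expRD; apply: ler_pM => //.
    - by rewrite exprn_ge0// (le_trans ler01).
    - by rewrite (le_trans _ (expR_ge1Dx _))// lerDr.
    - by rewrite expRM_natl; apply: lerXn2r; rewrite ?nnegrE ?expR_ge0// (le_trans ler01).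
  move/le_trans; apply; rewrite -expRM_natl ler_expR le_eqVlt; apply/orP; left.
  by rewrite /B /N !(natrD, natrM); apply/eqP; ring.
pose c' F := c (fun z => cR M^-1 * tinterp N zeta rho a F z).
exists K, c'; split.
  apply: (le_trans Kc); rewrite ler_expR natrM powRM ?ler0n//.
  by rewrite mulrA.
move=> F G uF uG cFG; apply: (tinterp_codeP N0 zP Xr (He d de0) uF uG) => z Xz.
have uT F' : unit_holo (polydisc a r) F' -> unit_holo D (fun z => cR M^-1 * tinterp N zeta rho a F' z).
  move=> [dF F1]; split => w Dw.
    apply: differentiable_mulf; first exact: differentiable_cst.
    have [P HP] := @tinterp_mpoly _ _ N zeta rho a F'.
    rewrite (_ : tinterp N zeta rho a F' =
      fun z => mpoly.meval (fun i => z ord0 i) P); last exact/funext.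
    exact: meval_differentiable.
  rewrite cmodM cmodR gtr0_norm ?invr_gt0// ler_pdivrMl// mulr1.
  have := @tinterp_bound _ _ N zeta rho a N0 zP rho0 1 kappa F' w k1.
  rewrite mul1r; apply; last exact: Dk.
  by move=> v vn; apply: F1; exact: node_in_polydisc N0 zP vn.
have := cc _ _ (uT F uF) (uT G uG) cFG z Xz.
rewrite -mulrBr cmodM cmodR gtr0_norm ?invr_gt0// ler_pdivrMl// => h.
exact: le_trans h MB.
Qed.

(** The cell of side [1 / Q] of the square [[-1, 1] ^ 2] that contains [w]; a coordinate equal to
    [1] takes the index [2 * Q], hence [2 * Q + 1] indices. *)
Definition grid Q (w : C) : 'I_(2 * Q).+1 * 'I_(2 * Q).+1 :=
  (inord (Num.trunc ((complex.Re w + 1) * Q%:R)),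
   inord (Num.trunc ((complex.Im w + 1) * Q%:R))).

Lemma trunc_grid Q (x y : R) : `|x| <= 1 -> `|y| <= 1 -> (0 < Q)%N ->
  (inord (Num.trunc ((x + 1) * Q%:R)) : 'I_(2 * Q).+1) =
    inord (Num.trunc ((y + 1) * Q%:R)) -> `|x - y| <= Q%:R^-1.
Proof.
move=> x1 y1 Q0; have Qr : 0 < Q%:R :> R by rewrite ltr0n.
have B (u : R) : `|u| <= 1 -> 0 <= (u + 1) * Q%:R /\ (Num.trunc ((u + 1) * Q%:R) < (2 * Q).+1)%N.
  rewrite ler_norml => /andP[u1 u2]; have u0 : 0 <= (u + 1) * Q%:R.
    by rewrite mulr_ge0 ?ler0n//; lra.
  split => //; rewrite ltnS -(ler_nat R) (le_trans (y := (u + 1) * Q%:R))//.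
    by rewrite truncn_le.
  by rewrite natrM ler_pM2r//; lra.
have [x0 xb] := B x x1; have [y0 yb] := B y y1.
move=> /(congr1 (@nat_of_ord _)); rewrite !inordK// => E.
rewrite -(ler_pM2r Qr) mulVf ?gt_eqF// -[X in _ * X](gtr0_norm Qr) -normrM.
have -> : (x - y) * Q%:R = (x + 1) * Q%:R - (y + 1) * Q%:R by ring.
move: x0 y0 E; move: ((x + 1) * Q%:R) ((y + 1) * Q%:R) => p q p0 q0 E.
have := truncnS_gt p; have := truncnS_gt q.
have : (Num.trunc p)%:R <= p by rewrite truncn_le.
have : (Num.trunc q)%:R <= q by rewrite truncn_le.
by rewrite E -natr1 ler_norml; lra.
Qed.

Lemma gridP Q (v w : C) : (0 < Q)%N -> cmod v <= 1 -> cmod w <= 1 ->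
  grid Q v = grid Q w -> cmod (v - w) <= 2 / Q%:R.
Proof.
move=> Q0 v1 w1 [e1 e2]; rewrite (le_trans (cmod_le_ReIm _))//.
rewrite cReD cImD cReN cImN mulrDl mul1r.
by rewrite lerD// trunc_grid// (le_trans (Re_le_cmod _), le_trans (Im_le_cmod _)).
Qed.

Lemma ent_growth_upper (X : set 'rV[C]_n) :
  (forall z, X z -> forall i, cmod (z ord0 i - a ord0 i) <= rho) ->
  ent_growth X (polydisc a r) n%:R.
Proof.
move=> Xr; have [e0 He] := @interp_error_small R n.
(* There are [N ^ n = 4 ^ n d ^ n] nodes, and each value is recorded by two indices, each among at
   most [exp ((4 n + 6) d)]. *)
exists ((2 * (4 * n + 6) * 4 ^ n)%:R), (maxn e0 1) => d.
rewrite geq_max => /andP[de0 d1].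
pose N := (4 * d)%N; have N0 : (0 < N)%N by rewrite muln_gt0.
have [zeta zP] := @closed_prim_root C N N0.
(* The precision [1 / E] at the nodes loses the factor [N ^ n <= exp (4 n d)] under interpolation
   and keeps [exp (- 2 d)]. *)
pose E : R := expR ((4 * n + 2) * d)%:R.
have E1 : 1 <= E by rewrite -expR0 ler_expR ler0n.
pose Q := (Num.trunc (2 * E)).+1.
have QE : 2 * E <= Q%:R by rewrite ltW// truncnS_gt.
have Q0 : (0 < Q)%N by [].
have Qr : 0 < Q%:R :> R by rewrite ltr0n.
pose nd (b : {ffun 'I_n -> 'I_N}) : 'rV[C]_n := \row_i (a ord0 i + node zeta rho (b i)).
exists ({ffun {ffun 'I_n -> 'I_N} -> 'I_(2 * Q).+1 * 'I_(2 * Q).+1} : finType).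
exists (fun F => [ffun b => grid Q (F (nd b))]); split.
  rewrite card_ffun card_prod !card_ord card_ffun !card_ord.
  have QU : ((2 * Q).+1)%:R <= expR ((4 * n + 6) * d)%:R :> R.
    have Q3 : Q%:R <= 2 * E + 1.
      by rewrite /Q -natr1 lerD2r truncn_le mulr_ge0// (le_trans ler01).
    have -> : expR ((4 * n + 6) * d)%:R = E * expR (4 * d)%:R :> R.
      by rewrite -expRD -natrD; congr (expR _%:R); ring.
    have e16 : 16 <= expR (4 * d)%:R :> R.
      apply: (@le_trans _ _ (expR 4)); last by rewrite ler_expR ler_nat leq_pmulr.
      have -> : expR 4 = expR 1 ^+ 4 :> R by rewrite -expRn.
      have -> : 16 = 2 ^+ 4 :> R by rewrite -natrX.
      apply: lerXn2r; rewrite ?nnegrE ?expR_ge0//.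
      by have := expR_ge1Dx (1 : R); lra.
    rewrite -natr1 natrM; nra.
  rewrite natrX natrM; apply: (@le_trans _ _ ((expR ((4 * n + 6) * d)%:R ^+ 2) ^+ (N ^ n))).
    apply: lerXn2r; rewrite ?nnegrE ?exprn_ge0 ?expR_ge0 ?mulr_ge0 ?ler0n//.
    by rewrite expr2 ler_pM// ler0n.
  rewrite -!expRM_natl ler_expR.
  have -> : d%:R `^ (n%:R + 1) = d%:R ^+ n.+1 :> R by rewrite natr1 powR_mulrn ?ler0n.
  by rewrite -natrX -!natrM ler_nat /N expnMn expnSr; apply: eq_leq; ring.
move=> F G uF uG cFG; apply: (tinterp_codeP N0 zP Xr (He d de0) uF uG) => z Xz.
rewrite -tinterpB.
have := @tinterp_bound _ _ N zeta rho a N0 zP rho0 (2 / Q%:R) 1 (fun z => F z - G z) z (lexx _).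
rewrite expr1n mulr1 mul1r => /(_ _ (Xr z Xz)) H.
apply: le_trans (H _) _.
  move=> w wn; have [b wb] : exists b, w = nd b.
    pose bb i := sval (cid (wn i)).
    exists [ffun i => Ordinal (ltn_pmod (bb i) N0)]; apply/rowP => i; rewrite mxE ffunE/=.
    have -> : node zeta rho (bb i %% N) = node zeta rho (bb i).
      by rewrite /node (prim_expr_mod zP).
    by rewrite /bb; case: cid.
  have wr : polydisc a r w by exact: node_in_polydisc N0 zP wn.
  apply: gridP => //; [exact: uF.2|exact: uG.2|].
  by move/ffunP: cFG => /(_ b); rewrite !ffunE -wb.
have NE : N%:R ^+ n <= expR (4 * n * d)%:R :> R.
  have -> : (4 * n * d)%N = (n * N)%N by rewrite /N; ring.
  rewrite natrM expRM_natl; apply: lerXn2r; rewrite ?nnegrE ?expR_ge0//.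
  by rewrite (le_trans _ (expR_ge1Dx _))// lerDr.
have EE : E = expR (4 * n * d)%:R * expR (2 * d)%:R.
  by rewrite -expRD -natrD; congr (expR _%:R); ring.
rewrite expRN -[X in _ <= X]mul1r ler_pdivlMr ?expR_gt0//.
rewrite (_ : 2 / Q%:R * N%:R ^+ n * expR (2 * d)%:R =
  2 * (N%:R ^+ n * expR (2 * d)%:R) / Q%:R); last by ring.
rewrite ler_pdivrMr// mul1r; apply: le_trans QE.
by rewrite EE ler_pM2l// ler_pM2r// expR_gt0.
Qed.

End LocalGrowth.

(** * The Kolmogorov dimension *)

Section KolmogorovDimension.
Context {R : realType}.
Local Notation C := (CC R).

(** Near each point of [X] a polydisc inside [D] is mapped into [D']; there [ent_growth_local] moves
    the code from [B] to the polydisc, and composition with [phi] moves it to [D']. A finite cover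
    glues the pieces. The identity gives independence of the domain. *)
Lemma ent_growth_general n k (X D B : set 'rV[C]_n) (D' : set 'rV[C]_k)
    (phi : 'rV[C]_n -> 'rV[C]_k) (s : R) :
  -1 <= s -> compact X -> open D -> X `<=` D -> holomorphic_on D phi ->
  open D' -> (forall x, X x -> D' (phi x)) -> bounded_set B ->
  ent_growth X B s -> ent_growth (phi @` X) D' s.
Proof.
move=> s1 cX oD XD hphi oD' XD' /bounded_coord[M M0 BM] eX.
have Hr x : exists r : R, X x ->
    0 < r /\ polydisc x r `<=` D `&` phi @^-1` D'.
  have [Xx|] := pselect (X x); last by exists 0.
  have /nbhs_polydiscP[r r0 rH] : nbhs x (D `&` phi @^-1` D').
    apply: filterI; first exact: open_nbhs_nbhs (conj oD (XD x Xx)).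
    have cphi : {for x, continuous phi}.
      by apply: differentiable_continuous; apply: hphi; exact: XD.
    by apply: cphi; exact: open_nbhs_nbhs (conj oD' (XD' x Xx)).
  by exists r.
pose r x := sval (cid (Hr x)).
have rP x : X x -> 0 < r x /\ polydisc x (r x) `<=` D `&` phi @^-1` D'.
  exact: (svalP (cid (Hr x))).
(* A fifth of the radius satisfies the condition [4 * rho < r] of the interpolation estimates. *)
have [|l lX Xl] := @compact_polydisc_cover R n X (fun x => r x / 5) cX.
  by move=> x /rP[r0 _]; rewrite divr_gt0.
suff H (l' : seq 'rV[C]_n) : {subset l' <= l} ->
    ent_growth (phi @` (X `&` [set z | exists2 x, x \in l' & polydisc x (r x / 5) z])) D' s.
  apply: ent_growthS (H l _); last by [].
  by move=> _ [z Xz <-]; exists z => //; split => //; exact: Xl.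
elim: l' => [_|x l' IH sl].
  apply: ent_growthS (ent_growth0 D' s).
  by move=> w [z [_ [y]]]; rewrite in_nil.
have Xx : X x by apply: lX; apply: sl; rewrite mem_head.
have [rx xD] := rP x Xx.
have loc : ent_growth (phi @` (X `&` polydisc x (r x / 5))) D' s.
  apply: (@ent_growth_comp _ _ _ _ (polydisc x (r x))).
  - by move=> z /xD[Dz _]; exact: hphi.
  - by move=> z /xD[].
  have rho0 : 0 < r x / 5 by rewrite divr_gt0.
  pose m := M + \sum_i cmod (x ord0 i).
  have sm : 0 <= \sum_i cmod (x ord0 i) by apply: sumr_ge0 => i _; exact: cmod_ge0.
  have m0 : 0 <= m by rewrite addr_ge0// ltW.
  have rho4 : 4 * (r x / 5) < r x by lra.
  apply: (@ent_growth_local R n x (r x) (r x / 5) rho0 rho4 _ B (1 + m / (r x / 5)) s) => //.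
  - by rewrite lerDl divr_ge0// ltW.
  - by move=> z [_ zx] i; exact: ltW.
  - move=> z Bz i; rewrite mulrDl mul1r divfK ?gt_eqF//.
    have h1 := BM z Bz i; have h2 := cmodB (z ord0 i) (x ord0 i).
    have h3 : cmod (x ord0 i) <= \sum_i cmod (x ord0 i).
      by rewrite (bigD1 i)//= lerDl sumr_ge0// => j _; exact: cmod_ge0.
    by rewrite /m; lra.
  - by apply: ent_growthS eX => z [].
have {}IH := IH (fun y yl => sl y (mem_behead (s := x :: l') yl)).
apply: ent_growthS (ent_growthU loc IH).
move=> w [z [Xz [y]]]; rewrite in_cons => /predU1P[->|yl] zy <-.
  by left; exists z.
by right; exists z => //; split => //; exists y.
Qed.

Lemma natr_dist_lt1 (i j : nat) : `|i%:R - j%:R : R| < 1 -> i = j.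
Proof.
have [ij|ij|//] := ltngtP i j; rewrite ltr_norml => /andP[h1 h2].
  have : i.+1%:R <= j%:R :> R by rewrite ler_nat.
  by rewrite -natr1 => h3; exfalso; lra.
have : j.+1%:R <= i%:R :> R by rewrite ler_nat.
by rewrite -natr1 => h3; exfalso; lra.
Qed.

(** Constant functions suffice: about [exp d] of them are separated at scale [exp (- d)], so the
    logarithm of the number of codes grows at least linearly in [d]. *)
Lemma Psi_ge0 n (X D : set 'rV[C]_n) : X !=set0 -> (0 <= Psi X D)%E.
Proof.
move=> [x Xx]; rewrite leNgt; apply/negP => P0.
have [s [s1 s0 Ps]] : exists s : R, [/\ -1 <= s, s < 0 & (Psi X D < s%:E)%E].
  case E: (Psi X D) P0 => [p| |] //; last by exists (- 2^-1); split; rewrite ?ltNyr//; lra.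
  (* The maximum with [- 1 / 2] keeps [s] in the range [-1 <= s < 0], also when [p] is very
     negative. *)
  rewrite lte_fin => p0; exists (Num.max (p / 2) (- 2^-1)); split.
  - by rewrite le_max; apply/orP; right; lra.
  - by rewrite gt_max; apply/andP; split; lra.
  - by rewrite lte_fin lt_max; apply/orP; left; lra.
have [A [d0 H]] := Psi_lt_ent s1 Ps.
have s0' : 0 < - s by lra.
pose B := `|A| + 1; have B1 : 1 <= B by rewrite lerDr.
(* So large that [d ^ (- s)] exceeds [B], that is, [(|A| + 1) d ^ (s + 1) <= d]. *)
pose d := maxn (maxn d0 1) (Num.trunc (B `^ (- s)^-1)).+1.
have [|K [c [Kc cc]]] := H d; first by rewrite !leq_max leqnn.
have d1 : (1 : R) <= d%:R by rewrite ler1n !leq_max leqnn orbT.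
have dB : B <= d%:R `^ (- s).
  have -> : B = (B `^ (- s)^-1) `^ (- s).
    by rewrite -powRrM mulVf ?gt_eqF// powRr1// (le_trans ler01).
  apply: ge0_ler_powR; rewrite ?nnegrE ?powR_ge0 ?ler0n// ?(ltW s0')//.
  by rewrite ltW// (lt_le_trans (truncnS_gt _))// ler_nat leq_maxr.
set T := d%:R `^ (s + 1) in Kc.
have T1 : 1 <= T by rewrite -[leLHS](powRr0 d%:R) ler_powR//; lra.
have BT : B * T <= d%:R.
  have dn0 : d%:R != 0 :> R by rewrite gt_eqF// (lt_le_trans ltr01).
  have -> : d%:R = d%:R `^ (- s) * T.
    rewrite /T -powRD; last by rewrite dn0 implybT.
    by rewrite addKr powRr1 ?ler0n.
  by rewrite ler_pM2r// (lt_le_trans ltr01).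
pose m := (Num.trunc (expR d%:R / 2 : R)).+1.
have m1 : (expR d%:R / 2 : R) < m%:R by rewrite /m truncnS_gt.
have ed2 : 2 <= expR d%:R :> R.
  by have := expR_ge1Dx (d%:R : R); lra.
have ed3 : 2 < expR d%:R :> R.
  apply: lt_le_trans (_ : expR 1 <= _); last by rewrite ler_expR.
  have h : expR 1 = expR (2^-1) * expR (2^-1) :> R by rewrite -expRD; congr expR; lra.
  by have := expR_ge1Dx (2^-1 : R); rewrite h; nra.
have m2 : m%:R < expR d%:R :> R.
  rewrite /m -natr1.
  have : (Num.trunc (expR d%:R / 2 : R))%:R <= expR d%:R / 2 :> R by rewrite truncn_le divr_ge0 ?expR_ge0.
  by lra.
have m0 : 0 < m%:R :> R by rewrite ltr0n.
have inj : injective (fun j : 'I_m => c (fun=> cR (j%:R / m%:R))).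
  have uj (j : 'I_m) : unit_holo D (fun=> cR (j%:R / m%:R)).
    apply: unit_holo_cst; rewrite cmodR ger0_norm ?divr_ge0//.
    by rewrite ler_pdivrMr// mul1r ler_nat ltnW.
  move=> i j cij; have := cc _ _ (uj i) (uj j) cij x Xx.
  rewrite -cRB cmodR -mulrBl normrM (gtr0_norm (_ : 0 < m%:R^-1)) ?invr_gt0//.
  rewrite expRN ler_pdivrMr// => ij.
  have {}ij : `|i%:R - j%:R : R| < 1.
    apply: le_lt_trans ij _; rewrite mulrC ltr_pdivrMr ?expR_gt0// mul1r.
    exact: m2.
  by apply/val_inj; exact: natr_dist_lt1 ij.
have := leq_card _ inj; rewrite card_ord -(ler_nat R) => mK.
have : expR d%:R / 2 < expR (A * T) :> R by apply: lt_le_trans Kc; exact: lt_le_trans mK.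
rewrite ltNge => /negP; apply.
rewrite ler_pdivlMr//.
apply: (@le_trans _ _ (expR (A * T) * expR 1)).
  by rewrite ler_pM2l ?expR_gt0//; have := expR_ge1Dx (1 : R); lra.
rewrite -expRD ler_expR.
have : A * T <= `|A| * T by rewrite ler_pM2r ?ler_norm// (lt_le_trans ltr01).
by move: BT; rewrite /B mulrDl mul1r; lra.
Qed.

(** Reduces comparisons of dimensions to growth conditions: it is enough to treat real exponents
    strictly above the larger side. *)
Lemma le_from_lt (x y : \bar R) : (0 <= x)%E ->
  (forall s : R, (x < s%:E)%E -> (y <= s%:E)%E) -> (y <= x)%E.
Proof.
case: x => [r| |]//; last by move=> _ _; rewrite leey.
move=> _ H; apply/lee_addgt0Pr => e e0; rewrite -EFinD; apply: H.
by rewrite lte_fin ltrDl.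
Qed.

(** A large polydisc is a bounded domain containing [X], so the choice made by [xget] never falls
    back on its default. *)
Lemma KdimE n (X : set 'rV[C]_n) (M : R) : 0 < M ->
  (forall z, X z -> forall i, cmod (z ord0 i) < M) ->
  exists D, [/\ domain D, bounded_set D, X `<=` D & Kdim X = Psi X D].
Proof.
move=> M0 XM; rewrite /Kdim; set D := xget _ _; exists D.
have : [set D | [/\ domain D, bounded_set D & X `<=` D]] D.
  by apply: xgetPex; exists (polydisc 0 M); exact: bounded_domain_exists.
by case.
Qed.

Lemma Kdim_ge0 n (X : set 'rV[C]_n) : X !=set0 -> (0 <= Kdim X)%E.
Proof. exact: Psi_ge0. Qed.

Lemma Kdim_lt_ent n k (X D : set 'rV[C]_n) (D' : set 'rV[C]_k)
    (phi : 'rV[C]_n -> 'rV[C]_k) (s : R) :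
  -1 <= s -> compact X -> open D -> X `<=` D -> holomorphic_on D phi ->
  open D' -> (forall x, X x -> D' (phi x)) ->
  (Kdim X < s%:E)%E -> ent_growth (phi @` X) D' s.
Proof.
move=> s1 cX oD XD hphi oD' XD'; have [M M0 XM] := compact_coord_bounded cX.
have [E [_ bE XE ->]] := KdimE M0 XM.
move=> /(Psi_lt_ent s1) eX.
exact: (ent_growth_general s1 cX oD XD hphi oD' XD' bE eX).
Qed.

Lemma ent_growth_id n (X D B : set 'rV[C]_n) (s : R) :
  -1 <= s -> compact X -> open D -> X `<=` D -> bounded_set B ->
  ent_growth X B s -> ent_growth X D s.
Proof.
move=> s1 cX oD XD bB eX; rewrite -(image_id X).
apply: (ent_growth_general s1 cX oD XD _ oD _ bB eX) => // z _.
Qed.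

Lemma Kdim_map n k (X D : set 'rV[C]_n) (phi : 'rV[C]_n -> 'rV[C]_k) :
  X !=set0 -> compact X -> open D -> X `<=` D -> holomorphic_on D phi ->
  (Kdim (phi @` X) <= Kdim X)%E.
Proof.
move=> X0 cX oD XD hphi; apply: le_from_lt; first exact: Kdim_ge0.
move=> s Xs; have s0 : 0 <= s.
  by rewrite -lee_fin (le_trans (Kdim_ge0 X0))// ltW.
have s1 : -1 <= s by lra.
have cphi : compact (phi @` X).
  apply: continuous_compact cX; apply: continuous_in_subspaceT => x /set_mem Xx.
  by apply: differentiable_continuous; apply: hphi; exact: XD.
have [M M0 XM] := compact_coord_bounded cphi.
have [E [[oE _ _] bE XE ->]] := KdimE M0 XM.
apply: (ent_Psi_le s1).
by apply: (Kdim_lt_ent s1 cX oD XD hphi oE _ Xs) => x Xx; apply: XE; exists x.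
Qed.

Lemma Kdim_sub n (X Y : set 'rV[C]_n) (M : R) : 0 < M ->
  (forall z, X z -> forall i, cmod (z ord0 i) < M) ->
  Y `<=` X -> Y !=set0 -> compact Y -> (Kdim Y <= Kdim X)%E.
Proof.
move=> M0 XM YX Y0 cY; have X0 : X !=set0 by have [y Yy] := Y0; exists y; exact: YX.
apply: le_from_lt; first exact: Kdim_ge0.
move=> s; have [E [_ bE XE ->]] := KdimE M0 XM => Xs; have s0 : 0 <= s.
  by rewrite -lee_fin (le_trans (Psi_ge0 E X0))// ltW.
have s1 : -1 <= s by lra.
have YM z : Y z -> forall i, cmod (z ord0 i) < M by move=> /YX; exact: XM.
have [F [[oF _ _] bF YF ->]] := KdimE M0 YM.
apply: (ent_Psi_le s1); apply: (ent_growth_id s1 cY oF YF bE).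
exact: ent_growthS YX (Psi_lt_ent s1 Xs).
Qed.

Lemma Kdim_le n (X : set 'rV[C]_n) : compact X -> (Kdim X <= n%:R%:E)%E.
Proof.
move=> cX; have [M M0 XM] := compact_coord_bounded cX.
have [D [[oD _ _] _ XD ->]] := KdimE M0 XM.
have n1 : -1 <= n%:R :> R by rewrite (le_trans _ (ler0n _ _))// lerN10.
apply: (ent_Psi_le n1).
have M5 : 4 * M < 5 * M by rewrite ltr_pM2r// ltr_nat.
apply: (ent_growth_id n1 cX oD XD (polydisc_bounded 0 (5 * M))).
apply: ent_growth_upper M0 M5 _ _ => z Xz i.
by rewrite mxE subr0; exact: ltW (XM z Xz i).
Qed.

(** A point is the image of the single point of the space of dimension [0] under a constant map, and
    there the upper bound [n] reads [0]. *)
Lemma Kdim_set1 n (z : 'rV[C]_n) : Kdim [set z] = 0%E.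
Proof.
apply/eqP; rewrite eq_le Kdim_ge0 ?andbT; last by exists z.
pose X : set 'rV[C]_0 := [set 0].
have cX : compact X by exact: compact_set1.
have -> : [set z] = (fun=> z) @` X.
  by apply/seteqP; split => [_ ->|_ [_ _ <-]]; [exists 0|].
apply: le_trans (Kdim_le cX).
apply: (@Kdim_map _ _ X setT); first by exists 0.
- exact: cX.
- exact: openT.
- by [].
- by move=> w _; exact: differentiable_cst.
Qed.

Lemma Kdim_bigcup n m (Xs : 'I_m.+1 -> set 'rV[C]_n) :
  (forall j, Xs j !=set0) -> (forall j, compact (Xs j)) ->
  Kdim (\bigcup_j Xs j) = \big[maxe/-oo%E]_(j < m.+1) Kdim (Xs j).
Proof.
move=> X0 cX.
have HM j : exists M : R, 0 < M /\ forall z, Xs j z -> forall i, cmod (z ord0 i) < M.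
  by have [M M0 XM] := compact_coord_bounded (cX j); exists M.
pose Mj j := sval (cid (HM j)).
have MjP j : 0 < Mj j /\ forall z, Xs j z -> forall i, cmod (z ord0 i) < Mj j.
  exact: (svalP (cid (HM j))).
pose M := \sum_j Mj j.
have MM j : Mj j <= M.
  by rewrite /M (bigD1 j)//= lerDl sumr_ge0// => i _; exact: ltW (MjP i).1.
have M0 : 0 < M by exact: lt_le_trans (MjP ord0).1 (MM ord0).
have UM z : (\bigcup_j Xs j) z -> forall i, cmod (z ord0 i) < M.
  by move=> [j _ Xz] i; exact: lt_le_trans ((MjP j).2 z Xz i) (MM j).
apply/eqP; rewrite eq_le; apply/andP; split; last first.
  apply: bigmax_le; first by rewrite leNye.
  move=> j _; apply: (Kdim_sub M0 UM) => //; by move=> z Xz; exists j.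
apply: le_from_lt.
  by apply: le_trans (Kdim_ge0 (X0 ord0)) _; exact: le_bigmax.
move=> s Hs; have s0 : 0 <= s.
  rewrite -lee_fin (le_trans (Kdim_ge0 (X0 ord0)))// ltW//.
  by apply: le_lt_trans Hs; exact: le_bigmax.
have s1 : -1 <= s by lra.
have [D [[oD _ _] bD XD ->]] := KdimE M0 UM.
apply: (ent_Psi_le s1).
suff H (l : seq 'I_m.+1) : ent_growth [set z | exists2 j, j \in l & Xs j z] D s.
  apply: ent_growthS (H (enum 'I_m.+1)) => z [j _ Xz]; exists j => //.
  by rewrite mem_enum.
elim: l => [|j l IH].
  by apply: ent_growthS (ent_growth0 D s) => z [j]; rewrite in_nil.
have loc : ent_growth (id @` Xs j) D s.
  have XjD : Xs j `<=` D by move=> z Xz; apply: XD; exists j.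
  apply: (Kdim_lt_ent s1 (cX j) oD XjD) => //.
  by apply: le_lt_trans Hs; exact: le_bigmax.
rewrite image_id in loc; apply: ent_growthS (ent_growthU loc IH).
move=> z [k0]; rewrite in_cons => /predU1P[->|il] Xz; first by left.
by right; exists k0.
Qed.

End KolmogorovDimension.

(** * Polynomially convex hulls *)

Section PolynomialHull.
Context {R : realType}.
Local Notation C := (CC R).
Implicit Types (n : nat).

Local Notation ev P z := (mpoly.meval (fun i => z ord0 i) P).

Lemma poly_hull_sub n (X : set 'rV[C]_n) : X `<=` poly_hull X.
Proof. by move=> z Xz P; apply: ereal_sup_ubound; exists z. Qed.

Lemma poly_hullP n (X : set 'rV[C]_n) z (P : mpoly.mpoly n C) (e : R) :
  poly_hull X z -> (forall w, X w -> cmod (ev P w) <= e) -> cmod (ev P z) <= e.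
Proof.
move=> Hz He; rewrite -lee_fin; apply: le_trans (Hz P) _.
by apply: ge_ereal_sup => _ [w Xw <-]; rewrite lee_fin He.
Qed.

Lemma poly_hull_bounded n (X : set 'rV[C]_n) (M : R) :
  (forall w, X w -> forall i, cmod (w ord0 i) <= M) ->
  forall z, poly_hull X z -> forall i, cmod (z ord0 i) <= M.
Proof.
move=> XM z Hz i.
have := @poly_hullP _ X z (mpoly.mpolyX C (mpoly.mnm1 i)) M Hz.
rewrite mpoly.mevalXU; apply => w Xw.
by rewrite mpoly.mevalXU; exact: XM.
Qed.

Lemma closed_le_cst (T : topologicalType) (g : T -> R) (c : \bar R) :
  continuous g -> closed [set z | ((g z)%:E <= c)%E].
Proof.
move=> cg; case: c => [x| |].
- rewrite (_ : [set z | _] = g @^-1` [set y | y <= x]); last first.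
    by apply/seteqP; split => z /=; rewrite lee_fin.
  exact: (proj1 (continuous_closedP g) cg _ (@closed_le _ x)).
- rewrite (_ : [set z | _] = setT); first exact: closedT.
  by apply/seteqP; split => z //= _; rewrite leey.
- rewrite (_ : [set z | _] = set0); first exact: closed0.
  by apply/seteqP; split => z //=; rewrite leNgt ltNyr.
Qed.

Lemma poly_hull_closed n (X : set 'rV[C]_n) : closed (poly_hull X).
Proof.
pose c (P : mpoly.mpoly n C) := ereal_sup [set (cmod (ev P w))%:E | w in X].
have -> : poly_hull X = \bigcap_(P in setT) [set z | ((cmod (ev P z))%:E <= c P)%E].
  by apply/seteqP; split => [z Hz P _|z Hz P]; [exact: Hz|exact: Hz].
apply: closed_bigI => P _; apply: closed_le_cst => z.
apply: (@continuous_comp _ _ _ (fun z : 'rV[C]_n => ev P z)).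
  by apply: differentiable_continuous; exact: meval_differentiable.
exact: cmod_continuous.
Qed.

Lemma poly_hull_compact n (X : set 'rV[C]_n) : compact X -> compact (poly_hull X).
Proof.
move=> cX; have [M M0 XM] := compact_coord_bounded cX.
apply: (@closed_bounded_compact _ _ _ M (@poly_hull_closed n X)).
by apply: poly_hull_bounded => w Xw i; exact: ltW (XM w Xw i).
Qed.

(** On the polydisc of radius [M], which contains the hull as well, [F - G] is a uniform limit of
    polynomials, so it obeys the inequality defining the hull. Hence a code for [X] is already a
    code for its hull. *)
Lemma poly_hull_dist n (X : set 'rV[C]_n) (M e : R) F G : 0 < M ->
  (forall z, X z -> forall i, cmod (z ord0 i) <= M) ->
  unit_holo (polydisc 0 (5 * M)) F -> unit_holo (polydisc 0 (5 * M)) G ->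
  (forall x, X x -> cmod (F x - G x) <= e) ->
  forall z, poly_hull X z -> cmod (F z - G z) <= e.
Proof.
move=> M0 XM [dF F1] [dG G1] FG z Hz.
have zM := poly_hull_bounded XM Hz.
apply/ler_addgt0Pr => eta eta0.
have [d0 Hd0] := @interp_error_small R n.
(* The passage through the polynomials costs [2 * E] at [w] in [X] and [2 * E] at [z]; this [d]
   makes the total at most [eta]. *)
pose d := maxn (maxn d0 1) (Num.trunc (ln (2 / eta))).+1.
have d1 : (0 < d)%N by rewrite !leq_max orbT.
have dd0 : (d0 <= d)%N by rewrite !leq_max leqnn.
have deta : 2 * expR (- d%:R) <= eta.
  rewrite expRN ler_pdivrMr ?expR_gt0// mulrC -ler_pdivrMr//.
  rewrite -[leLHS]lnK ?posrE ?divr_gt0// ler_expR ltW//.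
  by rewrite (lt_le_trans (truncnS_gt _))// ler_nat leq_maxr.
have N0 : (0 < 4 * d)%N by rewrite muln_gt0.
have [zeta zP] := @closed_prim_root C _ N0.
have M5 : 4 * M < 5 * M by rewrite ltr_pM2r// ltr_nat.
set N := (4 * d)%N in N0 zP.
set E := (1 + N%:R) ^+ n.+1 * (6 / 4 ^+ N) : R.
have EE : 2 * E <= expR (- d%:R).
  by have := Hd0 d dd0; have := expR_gt0 (- (2 * d)%:R : R); rewrite -/N -/E; lra.
have err H : unit_holo (polydisc 0 (5 * M)) H -> forall w : 'rV[C]_n,
    (forall i, cmod (w ord0 i) <= M) -> cmod (H w - tinterp N zeta M 0 H w) <= E.
  move=> [dH H1] w wM; apply: (tinterp_error N0 zP M0 M5).
    by move=> v vr; split; [exact: dH|exact: H1].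
  by move=> i; rewrite mxE subr0.
have [P HP] := @tinterp_mpoly _ _ N zeta M (0 : 'rV[C]_n) F.
have [Q HQ] := @tinterp_mpoly _ _ N zeta M (0 : 'rV[C]_n) G.
have tri (w : 'rV[C]_n) : (forall i, cmod (w ord0 i) <= M) ->
   `|cmod (F w - G w) - cmod (ev (P - Q) w)| <= 2 * E.
  move=> wM; have h1 := err F (conj dF F1) w wM; have h2 := err G (conj dG G1) w wM.
  rewrite mpoly.mevalB -HP -HQ; set f := tinterp _ _ _ _ F w in h1 *.
  set g := tinterp _ _ _ _ G w in h2 *.
  have E1 : F w - G w = (f - g) + ((F w - f) - (G w - g)) by ring.
  have E2 : f - g = (F w - G w) - ((F w - f) - (G w - g)) by ring.
  have h3 := cmodB (F w - f) (G w - g).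
  have h4 := cmodD (f - g) ((F w - f) - (G w - g)).
  have h5 := cmodB (F w - G w) ((F w - f) - (G w - g)).
  rewrite -E1 in h4; rewrite -E2 in h5.
  by rewrite ler_norml; apply/andP; split; lra.
have : cmod (ev (P - Q) z) <= e + 2 * E.
  apply: (poly_hullP Hz) => w Xw; have := tri w (XM w Xw); have := FG w Xw.
  by rewrite ler_norml => h /andP[h1 h2]; lra.
have := tri z zM; rewrite ler_norml => /andP[h1 h2] h3; lra.
Qed.

Lemma Kdim_poly_hull n (X : set 'rV[C]_n) : X !=set0 -> compact X ->
  Kdim (poly_hull X) = Kdim X.
Proof.
move=> X0 cX; have [M M0 XM] := compact_coord_bounded cX.
have XM' w : X w -> forall i, cmod (w ord0 i) <= M by move=> Xw i; exact: ltW (XM w Xw i).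
have cH := poly_hull_compact cX.
have [M' M'0 HM'] := compact_coord_bounded cH.
apply/eqP; rewrite eq_le; apply/andP; split; last first.
  by apply: (Kdim_sub M'0 HM') => //; exact: poly_hull_sub.
apply: le_from_lt; first exact: Kdim_ge0.
move=> s Xs; have s0 : 0 <= s by rewrite -lee_fin (le_trans (Kdim_ge0 X0))// ltW.
have s1 : -1 <= s by lra.
have [D [[oD _ _] bD HD ->]] := KdimE M'0 HM'.
have [E [_ bE XE EX]] := KdimE M0 XM; rewrite EX in Xs.
apply: (ent_Psi_le s1).
have M5 : 0 < 5 * M by rewrite mulr_gt0.
apply: (ent_growth_id s1 cH oD HD (polydisc_bounded 0 (5 * M))).
have XP : X `<=` polydisc 0 (5 * M).
  by move=> w Xw i; rewrite mxE subr0; apply: le_lt_trans (XM' w Xw i) _; lra.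
have [A [d0 H]] := ent_growth_id s1 cX (@polydisc_open R n 0 (5 * M)) XP bE (Psi_lt_ent s1 Xs).
exists A, d0 => d /H[K [c [Kc cc]]]; exists K, c; split; first exact: Kc.
move=> F G uF uG cFG; apply: (poly_hull_dist M0 XM' uF uG).
exact: cc.
Qed.

End PolynomialHull.

(** * Integer polynomials small on X *)

Section IntegerPolynomials.
Context {R : realType} {n : nat}.
Local Notation C := (CC R).
Implicit Types z : 'rV[C]_n.

Definition ipoly N (c : {ffun {ffun 'I_n -> 'I_N} -> int}) z : C :=
  \sum_al (c al)%:~R * \prod_i z ord0 i ^+ al i.

Lemma expR_half_le2 : expR 2^-1 <= 2 :> R.
Proof.
have h : expR (- 2^-1) * expR (2^-1) = 1 :> R by rewrite -expRD addNr expR0.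
rewrite -(ler_pM2l (expR_gt0 (- 2^-1))) h.
by have := expR_ge1Dx (- 2^-1 : R); lra.
Qed.

Lemma dist_lt (Q u v : nat) : (u < Q)%N -> (v < Q)%N -> (`|u%:Z - v%:Z| <= Q)%N.
Proof. lia. Qed.

Lemma cmod_int (k : int) : cmod (k%:~R : C) = `|k|%:~R.
Proof.
have E j : cmod ((Posz j)%:~R : C) = j%:R by rewrite cmod_nat.
case: k => k; first by rewrite E.
by rewrite NegzE mulrNz cmodN E normrN.
Qed.

Lemma ipolyB N (c d : {ffun {ffun 'I_n -> 'I_N} -> int}) z :
  ipoly [ffun al => c al - d al] z = ipoly c z - ipoly d z.
Proof.
by rewrite /ipoly -sumrB; apply: eq_bigr => al _; rewrite ffunE intrB mulrBl.
Qed.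

Lemma ipoly_differentiable N (c : {ffun {ffun 'I_n -> 'I_N} -> int}) z :
  differentiable (ipoly c) z.
Proof.
apply: differentiable_sumf => al; apply: differentiable_mulf.
  exact: differentiable_cst.
apply: differentiable_prodf => i; apply: differentiable_expf.
exact: differentiable_coord.
Qed.

Lemma ipoly_bound N (c : {ffun {ffun 'I_n -> 'I_N} -> int}) (B : R) (b : 'I_n -> R) z :
  0 <= B -> (forall al, `|c al|%:~R <= B) -> (forall i, 1 <= b i) ->
  (forall i, cmod (z ord0 i) <= b i) ->
  cmod (ipoly c z) <= N%:R ^+ n * (B * \prod_i b i ^+ N).
Proof.
move=> B0 cB b1 zb; rewrite (le_trans (cmod_sum _ _ _))//.
have -> : N%:R ^+ n = #|{ffun 'I_n -> 'I_N}|%:R :> R by rewrite card_ffun !card_ord natrX.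
rewrite mulr_natl -sumr_const; apply: ler_sum => al _.
rewrite cmodM cmod_int cmod_prod; apply: ler_pM => //.
  by apply: prodr_ge0 => i _; exact: cmod_ge0.
apply: ler_prod => i _; rewrite cmod_ge0 /= cmodX.
apply: (@le_trans _ _ (b i ^+ al i)).
  by rewrite lerXn2r// nnegrE ?cmod_ge0// (le_trans ler01).
by rewrite ler_weXn2l// ltnW.
Qed.

(* Thue-Siegel pigeonhole: there are [2 ^ N ^ n.+1] polynomials with
   coefficients in [0, 2 ^ N[, more than there are codes at precision
   [(m + b) * N] when [N] is large, because [s < n]. *)
Lemma small_integer_poly (X : set 'rV[C]_n) (M s : R) (m : nat) :
  0 < M -> (forall z, X z -> forall i, cmod (z ord0 i) < M) ->
  -1 <= s -> s < n%:R -> ent_growth X (polydisc 0 M) s ->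
  exists (N : nat) (c : {ffun {ffun 'I_n -> 'I_N} -> int}),
    [/\ (0 < N)%N, exists al, c al != 0, forall al, (`|c al| <= 2 ^ N)%N
      & forall z, X z -> cmod (ipoly c z) <= expR (- (m * N)%:R)].
Proof.
move=> M0 XM s1 sn [A [d0 H]].
(* [b] makes the normalising factor [B] at most [exp (b N)]: [n] for [N ^ n], [1] for [2 ^ N], and
   [q * n] for the powers of [1 + M <= exp q]. *)
pose q := (Num.trunc M).+1; pose b := (n + 1 + q * n)%N.
pose T := `|A| * (m + b)%:R `^ (s + 1) + 1.
have ns : 0 < n%:R - s by rewrite subr_gt0.
have T0 : 0 < T by rewrite ltr_wpDl// mulr_ge0// powR_ge0.
(* Then [T N ^ (s + 1) <= N ^ (n + 1) / 2], so the codes are fewer than [exp (N ^ (n + 1) / 2)],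
   itself at most [2 ^ (N ^ (n + 1))]. The [+ 1] in [T] makes the comparison strict. *)
pose N := maxn (maxn d0 1) (Num.trunc ((2 * T) `^ (n%:R - s)^-1)).+1.
have N0 : (0 < N)%N by rewrite !leq_max leqnn orbT.
have NR : 0 < N%:R :> R by rewrite ltr0n.
have NT : 2 * T <= N%:R `^ (n%:R - s).
  have -> : 2 * T = ((2 * T) `^ (n%:R - s)^-1) `^ (n%:R - s).
    by rewrite -powRrM mulVf ?gt_eqF// powRr1// mulr_ge0// ltW.
  apply: ge0_ler_powR; rewrite ?nnegrE ?powR_ge0 ?ler0n// ?(ltW ns)//.
  by rewrite ltW// (lt_le_trans (truncnS_gt _))// ler_nat leq_maxr.
pose d := ((m + b) * N)%N.
have [|K [c [Kc cc]]] := H d.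
  rewrite /d (leq_trans (_ : d0 <= N)%N)// ?leq_pmull ?/b ?addn1 ?addnS//.
  by rewrite !leq_max leqnn.
pose Q := (2 ^ N)%N.
have Q0 : (0 < Q)%N by rewrite expn_gt0.
pose toint (f : {ffun {ffun 'I_n -> 'I_N} -> 'I_Q}) :
   {ffun {ffun 'I_n -> 'I_N} -> int} := [ffun al => (f al : nat)%:Z].
pose B : R := N%:R ^+ n * (Q%:R * \prod_(i < n) (1 + M) ^+ N).
have M1 : 1 <= 1 + M by rewrite lerDl ltW.
have B0 : 0 < B.
  rewrite mulr_gt0 ?exprn_gt0// mulr_gt0 ?ltr0n// prodr_gt0// => i _.
  by rewrite exprn_gt0// (lt_le_trans ltr01).
have N_e : N%:R <= expR N%:R :> R by rewrite (le_trans _ (expR_ge1Dx _))// lerDr.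
have two_e : 2 <= expR 1 :> R by have := expR_ge1Dx (1 : R).
have BE : B <= expR (b * N)%:R.
  have -> : expR (b * N)%:R = expR N%:R ^+ n * (expR N%:R * \prod_(i < n) expR q%:R ^+ N) :> R.
    rewrite prodr_const card_ord -!expRM_natl -!expRD; congr expR.
    by rewrite /b !(natrD, natrM); ring.
  have pM0 : 0 <= \prod_(i < n) (1 + M) ^+ N.
    by apply: prodr_ge0 => i _; rewrite exprn_ge0// (le_trans ler01).
  apply: ler_pM; [by rewrite exprn_ge0|by rewrite mulr_ge0| |].
    by apply: lerXn2r; rewrite ?nnegrE ?expR_ge0.
  apply: ler_pM; [by []|by []| |].
    by rewrite /Q natrX expRn; apply: lerXn2r; rewrite ?nnegrE ?expR_ge0.
  apply: ler_prod => i _; rewrite exprn_ge0/= ?(le_trans ler01)//.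
  apply: lerXn2r; rewrite ?nnegrE ?expR_ge0 ?(le_trans ler01)//.
  by rewrite (le_trans (expR_ge1Dx _))// ler_expR ltW// truncnS_gt.
pose F (f : {ffun {ffun 'I_n -> 'I_N} -> 'I_Q}) z := cR B^-1 * ipoly (toint f) z.
have uF f : unit_holo (polydisc 0 M) (F f).
  split=> z zM.
    by apply: differentiable_mulf; [exact: differentiable_cst|exact: ipoly_differentiable].
  rewrite cmodM cmodR gtr0_norm ?invr_gt0// ler_pdivrMl// mulr1.
  apply: (@ipoly_bound _ _ _ (fun=> 1 + M)) => //.
    by move=> al; rewrite ffunE -[Q%:R]/((Posz Q)%:~R : R) ler_int ger0_norm// lez_nat ltnW.
  by move=> i; have := zM i; rewrite mxE subr0 => /ltW/le_trans; apply; rewrite lerDr.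
have [|ninj] := pselect (injective (fun f => c (F f))).
  move=> /leq_card; rewrite card_ffun card_ffun !card_ord -(ler_nat R) => QK.
  exfalso; have := le_trans QK Kc; apply/negP; rewrite -ltNge.
  apply: (@lt_le_trans _ _ (expR (N%:R ^+ n.+1 / 2))).
    rewrite ltr_expR.
    apply: (@lt_le_trans _ _ (T * N%:R `^ (s + 1))).
      rewrite /d natrM powRM ?ler0n// mulrA ltr_pM2r ?powR_gt0//.
      rewrite /T (le_lt_trans (y := `|A| * (m + b)%:R `^ (s + 1)))// ?ltrDl//.
      by rewrite ler_wpM2r ?powR_ge0// ler_norm.
    rewrite ler_pdivlMr// mulrC mulrA.
    have -> : N%:R ^+ n.+1 = N%:R `^ (n%:R - s) * N%:R `^ (s + 1) :> R.
      rewrite -powRD; last by rewrite (gt_eqF NR) implybT.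
      by rewrite -powR_mulrn ?ler0n//; congr (_ `^ _); rewrite -natr1; ring.
    by rewrite ler_pM2r ?powR_gt0.
  rewrite natrX /Q natrX -exprM -expnS.
  have -> : expR (N%:R ^+ n.+1 / 2) = expR 2^-1 ^+ (N ^ n.+1) :> R.
    by rewrite -expRM_natl natrX.
  by apply: lerXn2r; rewrite ?nnegrE ?expR_ge0// expR_half_le2.
have [f [g [cfg fg]]] : exists f g, c (F f) = c (F g) /\ f <> g.
  apply: contrapT => nex; apply: ninj => f g cfg; apply: contrapT => fg.
  by apply: nex; exists f, g.
exists N, [ffun al => toint f al - toint g al]; split => //.
- apply: contrapT => nex; apply: fg; apply/ffunP => al; apply/val_inj.
  apply/eqP; rewrite -eqz_nat -subr_eq0; apply: contrapT => al0; apply: nex.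
  by exists al; rewrite !ffunE; apply/negP.
- move=> al; rewrite !ffunE -/Q.
  exact: dist_lt (ltn_ord _) (ltn_ord _).
move=> z Xz; rewrite ipolyB.
have := cc _ _ (uF f) (uF g) cfg z Xz.
rewrite -mulrBr cmodM cmodR gtr0_norm ?invr_gt0// ler_pdivrMl// => /le_trans; apply.
rewrite expRN ler_pdivrMr ?expR_gt0// (le_trans BE)// -expRD ler_expR.
by rewrite /d !(natrD, natrM); lra.
Qed.

End IntegerPolynomials.

(** * Circle means of the logarithm of a polynomial *)

Section MeanValue.
Context {R : realType}.
Local Notation C := (CC R).

Lemma heine (g : R -> R) (a b eta : R) : cont_on g a b -> 0 < eta ->
  exists2 d, 0 < d & forall x y, a <= x <= b -> a <= y <= b -> `|x - y| < d ->
    `|g x - g y| <= eta.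
Proof.
move=> cg eta0; have e2 : 0 < eta / 2 by rewrite divr_gt0.
have Hd x : exists d : R, a <= x <= b -> 0 < d /\
    forall y, `|x - y| < d -> `|g x - g y| < eta / 2.
  have [xab|] := pselect (a <= x <= b); last by exists 0.
  have cgx : {for x, continuous g} by apply: cg; rewrite in_itv/=.
  have /nbhs_ballP[d /= d0 Hd] := cgx _ (nbhsx_ballx (g x) _ e2).
  exists d => _; split => // y xy; exact: Hd.
pose d x := sval (cid (Hd x)).
have dP x : a <= x <= b -> 0 < d x /\ forall y, `|x - y| < d x -> `|g x - g y| < eta / 2.
  exact: (svalP (cid (Hd x))).
have := @segment_compact R a b; rewrite compact_cover => cab.
have [||s sab Hs] := cab R [set` `[a, b]] (fun x => ball x (d x / 2)).
- by move=> x _; exact: ball_open.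
- move=> x xab; exists x => //; apply: ballxx; rewrite divr_gt0//.
  by apply: (dP x _).1; move: xab; rewrite /= in_itv.
pose l := finmap.enum_fset s.
have [dl dl0 dlP] : exists2 dl, 0 < dl & forall x, x \in l -> dl <= d x / 2.
  have : forall x, x \in l -> a <= x <= b.
    by move=> x xl; have /sab := xl; rewrite inE /= in_itv.
  elim: l => [_|x l IH xl]; first by exists 1.
  have [dl dl0 H] := IH (fun y yl => xl y (mem_behead (s := x :: l) yl)).
  have dx : 0 < d x / 2 by rewrite divr_gt0// (dP x (xl x (mem_head _ _))).1.
  exists (Num.min dl (d x / 2)); first by rewrite lt_min dl0.
  move=> y; rewrite in_cons => /predU1P[->|/H yd].
    by rewrite ge_min lexx orbT.
  by rewrite ge_min yd.
exists dl => // x y xab yab xy.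
have [c cs cx] : exists2 c, c \in l & `|c - x| < d c / 2.
  by have [|c cs cx] := Hs x; [rewrite /= in_itv|exists c].
have cab' : a <= c <= b by have /sab := cs; rewrite inE /= in_itv.
have [d0 Hc] := dP c cab'; have dlc := dlP c cs.
have h1 : `|g c - g x| < eta / 2 by apply: Hc; apply: (lt_le_trans cx); lra.
have h2 : `|g c - g y| < eta / 2.
  apply: Hc; have -> : c - y = (c - x) + (x - y) by ring.
  by rewrite (le_lt_trans (ler_normD _ _))//; lra.
have -> : g x - g y = (g c - g y) - (g c - g x) by ring.
by rewrite (le_trans (ler_normB _ _))//; lra.
Qed.

Lemma ei0 : ei 0 = 1 :> C.
Proof. by rewrite /ei cos0 sin0. Qed.

Lemma eiD (x y : R) : ei (x + y) = ei x * ei y :> C.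
Proof.
rewrite /ei cosD sinD; apply/eqP; rewrite eq_complex /=.
by apply/andP; split; apply/eqP; ring.
Qed.

Lemma eiX (x : R) k : ei x ^+ k = ei (k%:R * x) :> C.
Proof.
elim: k => [|k IH]; first by rewrite expr0 mul0r ei0.
by rewrite exprS IH -eiD -natr1; congr ei; ring.
Qed.

Lemma ei_2pi_eq1 : ei (2 * pi) = 1 :> C.
Proof. by rewrite ei2pi ei0. Qed.

Lemma ei_neq1 (x : R) : 0 < x < 2 * pi -> ei x != 1 :> C.
Proof.
move=> /andP[x0 x2]; apply/negP => /eqP[c1 s0].
have [xpi|xpi|xpi] := ltgtP x pi.
- by have := @sin_gt0_pi R x; rewrite x0 xpi s0 ltxx => /(_ isT).
- have := @sin_gt0_pi R (x - pi); rewrite subr_gt0 xpi /=.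
  have -> : x - pi < pi by lra.
  have := @sinDpi R (x - pi); rewrite subrK s0 => /esym/eqP.
  by rewrite oppr_eq0 => /eqP ->; rewrite ltxx => /(_ isT).
- by move: c1; rewrite xpi cospi => h; lra.
Qed.

Lemma prod_shift (N : nat) (a : nat -> C) : a N = a 0%N ->
  \prod_(k < N) a k.+1 = \prod_(k < N) a k.
Proof.
case: N => [_|N aN]; first by rewrite !big_ord0.
by rewrite big_ord_recr big_ord_recl /= aN mulrC; congr (_ * _); apply: eq_bigr => i _.
Qed.

(* Averaging over the roots of unity of order [L] kills all the coefficients of
   a polynomial of size at most [L] except the constant one. *)
Lemma horner_root_mean (p : {poly C}) (L : nat) : (0 < L)%N -> (size p <= L)%N ->
  exists j : 'I_L, cmod p.[0] <= cmod p.[ei (j%:R * (2 * pi / L%:R))].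
Proof.
move=> L0 sp; have LR : 0 < L%:R :> R by rewrite ltr0n.
set x := 2 * pi / L%:R; have x0 : 0 < x by rewrite divr_gt0// mulr_gt0// pi_gt0.
have sum0 : \sum_(j < L) p.[ei (j%:R * x)] = L%:R * p.[0].
  under eq_bigr do rewrite (horner_coef_wide _ sp).
  rewrite exchange_big /=; case: L L0 sp LR @x x0 => // L L0 sp LR x x0.
  rewrite big_ord_recl [X in _ + X]big1 => [|k _].
    rewrite addr0 horner_coef0; under eq_bigr do rewrite expr0 mulr1.
    by rewrite sumr_const card_ord mulr_natl.
  have Lx : L.+1%:R * x = 2 * pi by rewrite /x mulrC divfK// gt_eqF.
  rewrite -mulr_sumr; under eq_bigr do rewrite -eiX exprAC.
  have u1 : (ei x ^+ lift ord0 k) ^+ L.+1 = 1.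
    by rewrite exprAC eiX Lx ei_2pi_eq1 expr1n.
  have u2 : ei x ^+ lift ord0 k != 1 :> C.
    rewrite eiX ei_neq1//; apply/andP; split; first by rewrite mulr_gt0// ltr0n.
    by rewrite -Lx ltr_pM2r// ltr_nat.
  have := subrX1 (ei x ^+ lift ord0 k) L.+1; rewrite u1 subrr => /esym/eqP.
  by rewrite mulf_eq0 subr_eq0 (negPf u2) /= => /eqP ->; rewrite mulr0.
apply: contrapT => nex.
have : L%:R * cmod p.[0] < L%:R * cmod p.[0].
  rewrite -{1}(cmod_nat L) -cmodM -sum0 (le_lt_trans (cmod_sum _ _ _))//.
  rewrite mulr_natl -[X in _ *+ X]card_ord -sumr_const.
  apply: ltr_sum => [|j _]; first by apply/hasP; exists (Ordinal L0); rewrite ?mem_index_enum.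
  by rewrite ltNge; apply/negP => h; apply: nex; exists j.
by rewrite ltxx.
Qed.

Lemma intab_sum (g : R -> R) (N : nat) (h : R) : 0 <= h -> cont_on g 0 (N%:R * h) ->
  intab g 0 (N%:R * h) = \sum_(k < N) intab g (k%:R * h) (k.+1%:R * h).
Proof.
move=> h0; elim: N => [|N IH] cg.
  by rewrite big_ord0 mul0r /intab set_itv1 Rintegral_set1.
have h1 : 0 <= N%:R * h by rewrite mulr_ge0.
have h2 : N%:R * h <= N.+1%:R * h by rewrite ler_wpM2r// ler_nat.
rewrite (intab_split h1 h2 cg) big_ord_recr /= IH//.
exact: cont_onS (lexx _) h2 cg.
Qed.

(** The product [QN] of [N] copies of [q] rotated by multiples of [h = 2 pi / N] is itself invariant
    under rotation by [h]. Averaging over roots of unity gives a point where [|QN|] is at least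
    [|q t0| ^ N]; by invariance its angle may be taken in [[0, h]], so the factors sample one point
    in each arc, and the logarithm is bounded by a Riemann sum of [g]. The continuous majorant [g]
    keeps the zeros of [q] out of the integral. *)
Lemma log_mean_le (q : {poly C}) (t0 : C) (r : R) (g : R -> R) :
  cont_on g 0 (2 * pi) ->
  (forall t, 0 <= t <= 2 * pi -> cmod q.[t0 + cR r * ei t] <= expR (g t)) ->
  cmod q.[t0] <= expR ((2 * pi)^-1 * intab g 0 (2 * pi)).
Proof.
move=> cg qg; have T0 : 0 < 2 * pi :> R by rewrite mulr_gt0// pi_gt0.
set T := 2 * pi in cg qg T0 *; set m := T^-1 * _.
have [->|q0] := eqVneq q.[t0] 0; first by rewrite cmod0 expR_ge0.
have cq0 : 0 < cmod q.[t0] by rewrite cmod_gt0.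
rewrite -[leLHS]lnK ?posrE// ler_expR; apply/ler_addgt0Pr => eta eta0.
have [d d0 Hd] := heine cg eta0.
pose N := (Num.trunc (T / d)).+1.
have N0 : 0 < N%:R :> R by rewrite ltr0n.
pose h := T / N%:R; have h0 : 0 < h by rewrite divr_gt0.
have hd : h < d.
  by rewrite /h ltr_pdivrMr// mulrC -ltr_pdivrMr// truncnS_gt.
have Nh : N%:R * h = T by rewrite /h mulrC divfK// gt_eqF.
pose F k : {poly C} := q \Po (t0%:P + (cR r * ei (k%:R * h)) *: 'X).
pose QN := \prod_(k < N) F k.
have FE k w : (F k).[w] = q.[t0 + cR r * (ei (k%:R * h) * w)].
  by rewrite horner_comp hornerD hornerC hornerZ hornerX mulrA.
have QE w : QN.[w] = \prod_(k < N) q.[t0 + cR r * (ei (k%:R * h) * w)].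
  by rewrite horner_prod; apply: eq_bigr => k _; rewrite FE.
have inv w u : QN.[ei (u%:R * h) * w] = QN.[w].
  elim: u => [|u IH]; first by rewrite mul0r ei0 mul1r.
  rewrite -IH !QE -[RHS](prod_shift (a := fun k => q.[t0 + cR r * (ei (k%:R * h) * (ei (u%:R * h) * w))])).
    apply: eq_bigr => k _; congr (q.[_ + _ * _]); rewrite !mulrA -!eiD.
    by congr (ei _ * _); rewrite -!natr1; ring.
  by rewrite Nh mul0r ei0 ei_2pi_eq1.
(* The order [N * M] exceeds the degree of [QN] and refines the subdivision into [N] arcs. *)
pose M := (size QN).+1; have L0 : (0 < N * M)%N by rewrite muln_gt0.
have M0 : 0 < M%:R :> R by rewrite ltr0n.
have sQ : (size QN <= N * M)%N by rewrite (leq_trans (leqnSn _))// leq_pmull.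
have [j Hj] := horner_root_mean L0 sQ.
(* Whole rotations by [h], undone by invariance, and a remaining angle [th] within one arc. *)
pose u := (j %/ M)%N; pose v := (j %% M)%N.
have vM : (v < M)%N by rewrite ltn_pmod.
pose th := v%:R * (T / (N * M)%:R).
have th0 : 0 <= th by rewrite mulr_ge0// divr_ge0// ltW.
have thh : th <= h.
  rewrite /th /h natrM.
  have -> : v%:R * (T / (N%:R * M%:R)) = T / N%:R * (v%:R / M%:R).
    by field; rewrite !gt_eqF.
  rewrite ler_piMr//; first by rewrite divr_ge0// ltW.
  by rewrite ler_pdivrMr// mul1r ler_nat ltnW.
have jE : j%:R * (T / (N * M)%:R) = u%:R * h + th.
  rewrite {1}(divn_eq j M) -/u -/v natrD natrM /th /h natrM.
  by field; rewrite !gt_eqF.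
have Q0 : cmod QN.[0] = cmod q.[t0] ^+ N.
  rewrite QE (eq_bigr (fun=> q.[t0])) => [|k _]; last by rewrite mulr0 mulr0 addr0.
  by rewrite prodr_const card_ord cmodX.
move: Hj; rewrite -/T jE eiD inv Q0 QE cmod_prod => Hj.
pose xk (k : 'I_N) := k%:R * h + th.
have xkb (k : 'I_N) : k%:R * h <= xk k <= k.+1%:R * h.
  by rewrite /xk -natr1 mulrDl mul1r lerDl lerD2l th0.
have kT (k : 'I_N) : 0 <= k%:R * h /\ k.+1%:R * h <= T.
  by split; [rewrite mulr_ge0// ltW|rewrite -Nh ler_pM2r// ler_nat].
have xT k : 0 <= xk k <= T.
  by have /andP[h1 h2] := xkb k; have [h3 h4] := kT k; rewrite (le_trans h3)// (le_trans h2).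
have sum_le : \sum_(k < N) (g (xk k) - eta) * h <= intab g 0 T.
  rewrite -[X in intab g 0 X]Nh intab_sum ?(ltW h0) ?Nh//.
  apply: ler_sum => k _; have [h3 h4] := kT k.
  have hh : k.+1%:R * h - k%:R * h = h by rewrite -mulrBl -natr1 addrAC subrr add0r mul1r.
  have kk : k%:R * h <= k.+1%:R * h by rewrite ler_pM2r// ler_nat.
  have -> : (g (xk k) - eta) * h =
      intab (fun=> g (xk k) - eta) (k%:R * h) (k.+1%:R * h).
    by rewrite (intab_cst _ kk) hh.
  apply: le_intab; first exact: cont_on_cst.
    exact: cont_onS cg.
  move=> x /andP[x1 x2].
  have xx : 0 <= x <= T by rewrite (le_trans h3)// (le_trans x2).
  have /andP[y1 y2] := xkb k.
  have close : `|xk k - x| < d by apply: le_lt_trans hd; rewrite ler_norml -hh; lra.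
  by have := Hd _ _ (xT k) xx close; rewrite ler_norml => /andP[]; lra.
have big : N%:R * ln (cmod q.[t0]) <= \sum_(k < N) g (xk k).
  rewrite -ler_expR expRM_natl lnK ?posrE// (le_trans Hj)//.
  rewrite expR_sum; apply: ler_prod => k _; rewrite cmod_ge0 /=.
  by rewrite -eiD; exact: (qg _ (xT k)).
rewrite -(ler_pM2l T0) mulrDr /m mulrA divff ?gt_eqF// mul1r.
have : T * ln (cmod q.[t0]) <= h * \sum_(k < N) g (xk k).
  by rewrite -Nh [_ * h]mulrC -mulrA ler_pM2l.
move=> /le_trans; apply; move: sum_le.
rewrite -mulr_suml sumrB sumr_const card_ord -mulr_natl mulrBl.
have -> : N%:R * eta * h = T * eta by rewrite mulrAC Nh.
by rewrite [h * _]mulrC; lra.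
Qed.

End MeanValue.

(** * Regularised logarithms and decreasing limits *)

Section Subharmonic.
Context {R : realType}.
Local Notation C := (CC R).
Local Notation mu := (@lebesgue_measure R).

(** A regularisation of [log |w| ^ 2], continuous across the zero of [w] for positive [e] and
    decreasing to it as [e] tends to [0]. *)
Definition lsq (e : R) (w : C) : R := ln (cmod w ^+ 2 + e).

Lemma lsq_pos e (w : C) : 0 < e -> 0 < cmod w ^+ 2 + e.
Proof. by move=> e0; rewrite ltr_wpDl// exprn_ge0// cmod_ge0. Qed.

Lemma lsq_continuous (T : topologicalType) (f : T -> C) e x : 0 < e ->
  {for x, continuous f} -> {for x, continuous (fun y => lsq e (f y))}.
Proof.
move=> e0 cf.
have c1 : {for x, continuous (fun y => cmod (f y))}.
  by apply: (@continuous_comp _ _ _ f (@cmod R)) => //; exact: cmod_continuous.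
have c2 : {for x, continuous (fun y => cmod (f y) ^+ 2 + e)}.
  by apply: cvgD; [apply: cvgM; exact: c1|exact: cvg_cst].
have c3 := continuous_ln (lsq_pos (f x) e0).
exact: (@continuous_comp _ _ _ (fun y => cmod (f y) ^+ 2 + e) (@ln R) x c2 c3).
Qed.

Lemma horner_ccts (p : {poly C}) (t0 : C) (r : R) : ccts (fun t => p.[t0 + circ r t]).
Proof.
have -> : (fun t => p.[t0 + circ r t]) =
    (fun t => \sum_(i < size p) p`_i * (t0 + circ r t) ^+ i).
  by apply/funext => t; rewrite horner_coef.
apply: ccts_sum => i; apply: cctsM; first exact: cctscst.
by apply: cctsX; apply: cctsD; [exact: cctscst|exact: circ_continuous].
Qed.

Lemma lsq_horner_cont (p : {poly C}) (t0 : C) (r e : R) a b : 0 < e ->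
  cont_on (fun t => lsq e p.[t0 + circ r t]) a b.
Proof.
move=> e0 t _; apply: (@lsq_continuous _ (fun t => p.[t0 + circ r t]) e t e0).
exact: horner_ccts.
Qed.

(* Linearisation: [q = conj (p t0) p + e] has [q t0 = |p t0|^2 + e], and
   [|q|^2 <= (|p t0|^2 + e) (|p|^2 + e)] by Cauchy-Schwarz. *)
Lemma lsq_submean (p : {poly C}) (t0 : C) (r e : R) : 0 < e ->
  lsq e p.[t0] <= (2 * pi)^-1 * intab (fun t => lsq e p.[t0 + circ r t]) 0 (2 * pi).
Proof.
move=> e0; set v := p.[t0]; pose q := (conjc v : C) *: p + (cR e)%:P.
have V0 := lsq_pos v e0; set V := cmod v ^+ 2 + e in V0.
have qt0 : cmod q.[t0] = V.
  rewrite /q hornerD hornerZ hornerC -/v.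
  have -> : conjc v * v + cR e = cR V.
    rewrite /V cRD; congr (_ + _); rewrite cmod_sqr.
    by case: (v) => a b; apply/eqP; rewrite eq_complex /=; apply/andP; split; apply/eqP; ring.
  by rewrite cmodR gtr0_norm.
have cconj : cmod (conjc v : C) = cmod v by case: (v) => a b; rewrite /cmod /= sqrrN.
pose g t := 2^-1 * ln V + 2^-1 * lsq e p.[t0 + circ r t].
have cl : cont_on (fun t => lsq e p.[t0 + circ r t]) 0 (2 * pi) by exact: lsq_horner_cont.
have cg : cont_on g 0 (2 * pi).
  by apply: cont_onD; [exact: cont_on_cst|exact: cont_onZ].
have := @log_mean_le _ q t0 r g cg; rewrite qt0.
have T0 : 0 < 2 * pi :> R by rewrite mulr_gt0// pi_gt0.
have -> : (2 * pi)^-1 * intab g 0 (2 * pi) =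
  2^-1 * ln V + 2^-1 * ((2 * pi)^-1 * intab (fun t => lsq e p.[t0 + circ r t]) 0 (2 * pi)).
  rewrite /g intabD; [|exact: cont_on_cst|exact: cont_onZ].
  rewrite intab_cst ?twopi_ge0// intabZ// subr0.
  by move: T0; move: (2 * pi) => T T0; field; rewrite gt_eqF.
set m := (2 * pi)^-1 * _; move=> H.
have : V <= expR (2^-1 * ln V + 2^-1 * m).
  apply: H => t _; rewrite -/(circ r t) /g; set w := p.[_].
  have W0 := lsq_pos w e0.
  rewrite -mulrDr /lsq -lnM ?posrE//.
  have P0 : 0 < V * (cmod w ^+ 2 + e) by rewrite mulr_gt0.
  have -> : expR (2^-1 * ln (V * (cmod w ^+ 2 + e))) = Num.sqrt (V * (cmod w ^+ 2 + e)).
    apply/eqP; rewrite -(@eqrXn2 _ 2) ?expR_ge0 ?sqrtr_ge0// sqr_sqrtr ?(ltW P0)//.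
    by rewrite -expRM_natl mulrA divff// mul1r lnK ?posrE.
  rewrite -(@ler_pXn2r _ 2) ?nnegrE ?cmod_ge0 ?sqrtr_ge0// sqr_sqrtr ?(ltW P0)//.
  have qw : cmod q.[t0 + circ r t] <= cmod v * cmod w + e.
    rewrite /q hornerD hornerZ hornerC (le_trans (cmodD _ _))//.
    by rewrite cmodM cconj cmodR gtr0_norm.
  apply: (@le_trans _ _ ((cmod v * cmod w + e) ^+ 2)).
    by rewrite lerXn2r ?nnegrE ?cmod_ge0// addr_ge0 ?mulr_ge0 ?cmod_ge0// ltW.
  rewrite /V -subr_ge0.
  have -> : (cmod v ^+ 2 + e) * (cmod w ^+ 2 + e) - (cmod v * cmod w + e) ^+ 2 =
    e * (cmod v - cmod w) ^+ 2 by ring.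
  by rewrite mulr_ge0 ?sqr_ge0// ltW.
rewrite -{1}[V]lnK ?posrE// ler_expR /lsq -/V; lra.
Qed.

Lemma intabE (f : R -> R) a b : cont_on f a b ->
  (\int[mu]_(x in `[a, b]) (f x)%:E)%E = (intab f a b)%:E.
Proof.
move=> cf; rewrite /intab /Rintegral fineK//.
exact: integrable_fin_num (cont_on_integrable cf).
Qed.

Lemma cont_on_bounded (f : R -> R) a b : a <= b -> cont_on f a b ->
  exists A, forall t, a <= t <= b -> f t <= A.
Proof.
move=> ab cf; have [|c cab H] := EVT_max ab (f := f).
  by apply: continuous_in_subspaceT => x /set_mem xab; exact: cf.
by exists (f c) => t tab; apply: H; rewrite in_itv/=.
Qed.

(** Monotone convergence for [A - G k], which is nonnegative and increasing once [A] bounds [G 0].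
    The limit may take infinite values, but the lower bound [c] makes it integrable, so the
    subtraction can be undone. *)
Lemma le_integral_inf (G : nat -> R -> R) (T c : R) : 0 < T ->
  (forall k, cont_on (G k) 0 T) ->
  (forall k t, G k.+1 t <= G k t) ->
  (forall k, c * T <= intab (G k) 0 T) ->
  ((c * T)%:E <= \int[mu]_(t in `[0%R, T]) ereal_inf (range (fun k => (G k t)%:E)))%E.
Proof.
move=> T0 cG dG Hc; have [A HA] := cont_on_bounded (ltW T0) (cG 0%N).
have dGm t i j : (i <= j)%N -> G j t <= G i t.
  elim: j => [|j IH]; first by rewrite leqn0 => /eqP ->.
  by rewrite leq_eqVlt => /predU1P[->//|/IH]; apply: le_trans; exact: dG.
have GA k t : 0 <= t <= T -> G k t <= A.
  by move=> tT; apply: le_trans (HA t tT); exact: dGm.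
pose F (k : nat) (t : measurableTypeR R) : \bar R := (A - G k t)%:E.
have cF k : cont_on (fun t => A - G k t) 0 T by apply: cont_onB; [exact: cont_on_cst|exact: cG].
have mF k := proj1 (elimT (integrableP _ _ _) (cont_on_integrable (cF k))).
have F0 k t : [set` `[0, T]] t -> (0 <= F k t)%E.
  by rewrite /= in_itv/= => tT; rewrite lee_fin subr_ge0; exact: GA.
have ndF t : [set` `[0, T]] t -> nondecreasing_seq (F ^~ t).
  by move=> _ i j ij; rewrite lee_fin lerD2l lerN2; exact: dGm.
pose U (t : measurableTypeR R) := ereal_inf (range (fun k => (G k t)%:E)).
pose Fl (t : measurableTypeR R) := (A%:E - U t)%E.
have cvgF t : [set` `[0, T]] t -> F ^~ t @ \oo --> Fl t.
  move=> tT; apply: (@cvgeB _ _ _ _ (fun=> A%:E) (fun k => (G k t)%:E)) => //.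
    exact: cvg_cst.
  apply: ereal_nonincreasing_cvgn => i j ij; rewrite lee_fin; exact: dGm.
have mFl := @emeasurable_fun_cvg _ _ _ _ F Fl mF cvgF.
have Fl0 t : [set` `[0, T]] t -> (0 <= Fl t)%E.
  move=> tT; rewrite sube_ge0; last by apply/orP; right.
  apply: ereal_inf_le; exists (G 0%N t)%:E; first by exists 0%N.
  by rewrite lee_fin; apply: GA; move: tT; rewrite /= in_itv.
have intFk k : (\int[mu]_(t in `[0%R, T]) F k t <= (T * (A - c))%:E)%E.
  rewrite intabE// lee_fin intabB; [|exact: cont_on_cst|exact: cG].
  by rewrite intab_cst ?(ltW T0)// subr0; have := Hc k; lra.
have intF : (\int[mu]_(t in `[0%R, T]) Fl t <= (T * (A - c))%:E)%E.
  have mI : measurable (`[0, T] : set (measurableTypeR R)) by [].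
  have := @monotone_convergence _ _ R mu _ mI _ mF F0 ndF.
  have -> : (\int[mu]_(t in `[0%R, T]) Fl t)%E =
    (\int[mu]_(t in `[0%R, T]) limn (F ^~ t))%E.
    by apply: eq_integral => t /set_mem tT; apply/esym/cvg_lim => //; exact: cvgF.
  move=> ->; apply: lime_le; last by apply: nearW.
  apply: ereal_nondecreasing_is_cvgn => i j ij; apply: ge0_le_integral => //.
  - by move=> t tT; exact: F0.
  - by move=> t tT; exact: ndF.
have iFl : mu.-integrable `[0, T] Fl.
  apply/integrableP; split => //.
  under eq_integral => t /set_mem tT do rewrite gee0_abs ?Fl0//.
  by apply: le_lt_trans intF _; rewrite ltry.
have iA : mu.-integrable `[0, T] (cst A%:E : measurableTypeR R -> \bar R).
  by have := cont_on_integrable (@cont_on_cst R A 0 T).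
have -> : (\int[mu]_(t in `[0%R, T]) ereal_inf (range (fun k => (G k t)%:E)))%E =
   (\int[mu]_(t in `[0%R, T]) (cst A%:E \- Fl) t)%E.
  apply: eq_integral => t _; rewrite /Fl /= -/(U t).
  by case: (U t) => [u| |] //=; rewrite -EFinB; congr EFin; ring.
rewrite integralB//.
have -> : (\int[mu]_(x in `[0%R, T]) cst A%:E x)%E = (A * T)%:E.
  by rewrite (@intabE (fun=> A)) ?intab_cst ?(ltW T0) ?subr0//; exact: cont_on_cst.
rewrite leeBrDr; last first.
  by rewrite ge0_fin_numE ?integral_ge0// (le_lt_trans intF)// ltry.
apply: (@le_trans _ _ ((c * T)%:E + (T * (A - c))%:E)%E); first exact: leeD2l.
by rewrite -EFinD lee_fin; lra.
Qed.

Lemma line_continuous n (a b : 'rV[C]_n) : continuous (fun t : C => a + t *: b).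
Proof.
move=> t; apply: differentiable_continuous.
apply: differentiableD; first exact: differentiable_cst.
by apply: differentiableZl; apply: ex_diff.
Qed.

(** An infimum of continuous functions is upper semicontinuous, and the mean inequality passes to it
    by [le_integral_inf], with [c] its value at the centre; nothing is to be shown where that value
    is [-oo]. *)
Lemma plurisubharmonic_inf n (phi : nat -> 'rV[C]_n -> R) :
  (forall k z, phi k.+1 z <= phi k z) ->
  (forall k, continuous (phi k)) ->
  (forall k a b t0 r, 0 < r ->
     phi k (a + t0 *: b) <=
       (2 * pi)^-1 * intab (fun t => phi k (a + (t0 + circ r t) *: b)) 0 (2 * pi)) ->
  plurisubharmonic (fun z => ereal_inf (range (fun k => (phi k z)%:E))).
Proof.
move=> dphi cphi Hm; set u := fun z => _.
have uk z k : (u z <= (phi k z)%:E)%E by apply: ereal_inf_lbound; exists k.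
have ufin z : (u z < +oo)%E by apply: le_lt_trans (uk z 0%N) _; rewrite ltry.
have uusc (T : topologicalType) (f : T -> 'rV[C]_n) : continuous f ->
    upper_semicontinuous (u \o f).
  move=> cf x a; rewrite lteNr => /ereal_inf_lt[_ [k _ <-]] ka.
  exists [set y | ((phi k (f y))%:E < - a%:E)%E].
    have c : {for x, continuous (fun y => phi k (f y))}.
      by apply: continuous_comp (cf x) _; exact: cphi.
    have := c _ (open_nbhs_nbhs (conj (@open_lt _ (- a)) _)).
    by move=> /(_ ka).
  by move=> y /= ya; rewrite lteNr; apply: le_lt_trans (uk _ k) ya.
split => //; first exact: (uusc _ id (fun=> cvg_id)).
move=> a b; split => //.
  exact: (uusc _ _ (@line_continuous _ a b)).
move=> z r r0; rewrite /circle_mean.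
have T0 : 0 < 2 * pi :> R by rewrite mulr_gt0// pi_gt0.
have zE t : z + Complex (r * cos t) (r * sin t) = z + circ r t.
  congr (_ + _); apply/eqP; rewrite eq_complex /=.
  by apply/andP; split; apply/eqP; ring.
under eq_integral do rewrite zE.
case E: (u (a + z *: b)) => [v| |]; last by rewrite leNye.
- rewrite lee_pdivlMl// -EFinM mulrC.
  apply: (@le_integral_inf (fun k t => phi k (a + (z + circ r t) *: b))) => //.
  + move=> k t _; apply: (@continuous_comp _ _ _ (fun t => a + (z + circ r t) *: b) (phi k)); last exact: cphi.
    have cc : ccts (fun t => z + circ r t).
      by apply: (@cctsD _ (fun=> z)); [exact: cctscst|exact: circ_continuous].
    exact: (@continuous_comp _ _ _ (fun t => z + circ r t)
      (fun t : C => a + t *: b) t (cc t) (@line_continuous _ a b _)).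
  + move=> k; have := uk (a + z *: b) k; rewrite E lee_fin => vk.
    rewrite -ler_pdivlMr// [X in _ <= X]mulrC; exact: le_trans vk (Hm k a b z r r0).
- by move: (ufin (a + z *: b)); rewrite E ltxx.
Qed.

End Subharmonic.

(** * The potential *)

Section SubmeanClosure.
Context {R : realType}.
Local Notation C := (CC R).

(** Continuity along circles is bundled in, so that means of sums split. *)
Definition submean (f : C -> R) : Prop := forall t0 r,
  cont_on (fun t => f (t0 + circ r t)) 0 (2 * pi) /\
  f t0 <= (2 * pi)^-1 * intab (fun t => f (t0 + circ r t)) 0 (2 * pi).

Let T0 : 0 < 2 * pi :> R.
Proof. by rewrite mulr_gt0// pi_gt0. Qed.

Lemma submean_cst k : submean (fun=> k).
Proof.
move=> t0 r; split; first exact: cont_on_cst.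
rewrite intab_cst ?(ltW T0)// subr0; move: T0; move: (2 * pi) => T T0'.
by rewrite mulrCA mulVf ?mulr1// gt_eqF.
Qed.

Lemma submeanD f g : submean f -> submean g -> submean (fun w => f w + g w).
Proof.
move=> sf sg t0 r; have [cf hf] := sf t0 r; have [cg hg] := sg t0 r.
by split; [exact: cont_onD|rewrite intabD// mulrDr lerD].
Qed.

Lemma submeanZ f k : 0 <= k -> submean f -> submean (fun w => k * f w).
Proof.
move=> k0 sf t0 r; have [cf hf] := sf t0 r.
by split; [exact: cont_onZ|rewrite intabZ// mulrCA ler_wpM2l].
Qed.

Lemma submean_sum (I : Type) (s : seq I) (f : I -> C -> R) :
  (forall i, submean (f i)) -> submean (fun w => \sum_(i <- s) f i w).
Proof.
move=> sf; elim: s => [|i s IH].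
  by under eq_fun do rewrite big_nil; exact: submean_cst.
by under eq_fun do rewrite big_cons; exact: submeanD.
Qed.

Lemma submean_lsq (p : {poly C}) e : 0 < e -> submean (fun w => lsq e p.[w]).
Proof. by move=> e0 t0 r; split; [exact: lsq_horner_cont|exact: lsq_submean]. Qed.

End SubmeanClosure.

(** Uniqueness of digits in base [D]: the substitution of [t ^ (D ^ i)] for the variables sends
    distinct monomials of small degree to distinct powers of [t]. *)
Lemma digits_inj n D (f g : 'I_n -> nat) :
  (forall i, (f i < D)%N) -> (forall i, (g i < D)%N) ->
  (\sum_i f i * D ^ i = \sum_i g i * D ^ i)%N -> f =1 g.
Proof.
elim: n f g => [|n IH] f g fD gD; first by move=> _ [].
have E (h : 'I_n.+1 -> nat) : (\sum_i h i * D ^ i =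
    (\sum_(i < n) h (lift ord0 i) * D ^ i) * D + h ord0)%N.
  rewrite big_ord_recl expn0 muln1 addnC big_distrl /=; congr (_ + _)%N.
  by apply: eq_bigr => i _; rewrite /bump /= add1n expnSr mulnA.
rewrite !E => /eqP; have D0 : (0 < D)%N by apply: leq_ltn_trans (fD ord0).
move=> /eqP H; have h0 : f ord0 = g ord0.
  by have := congr1 (modn^~ D) H; rewrite !modnMDl !modn_small.
have h1 : f \o lift ord0 =1 g \o lift ord0.
  apply: IH => [i|i|]; [exact: fD|exact: gD|].
  by have := congr1 (divn^~ D) H; rewrite !divnMDl// !divn_small// !addn0.
move=> i; case: (unliftP ord0 i) => [j ->|->//]; exact: h1.
Qed.

Section Potential.
Context {R : realType} {n : nat}.
Local Notation C := (CC R).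
Implicit Types z : 'rV[C]_n.

Lemma lsq_ge0 (w : C) : 0 <= lsq 1 w.
Proof. by rewrite /lsq ln_ge0// lerDr exprn_ge0// cmod_ge0. Qed.

Lemma lsq_le (e e' : R) (w : C) : 0 < e -> e <= e' -> lsq e w <= lsq e' w.
Proof.
move=> e0 ee; rewrite /lsq ler_ln ?posrE ?lsq_pos ?(lt_le_trans e0)//.
by rewrite lerD2l.
Qed.

Variables (X : set 'rV[C]_n) (N : nat -> nat).
Variable c : forall j, {ffun {ffun 'I_n -> 'I_(N j)} -> int}.
Hypothesis N0 : forall j, (0 < N j)%N.
Hypothesis c0 : forall j, exists al, c j al != 0.
Hypothesis cN : forall j al, (`|c j al| <= 2 ^ N j)%N.
Hypothesis cX : forall j z, X z -> cmod (ipoly (c j) z) <= expR (- (4 ^ j * N j)%:R).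

(** For each [j < k], [eps k] is at most [exp (- 2 * 4 ^ j N_j)], the bound for [|P_j| ^ 2] on [X],
    so the regularisation preserves smallness there. The [2 * N j] in the weight is twice the degree
    bound because [lsq] is the logarithm of a square; [hh] bounds the logarithms so normalised. *)
Let eps k : R := expR (- (2 * \sum_(j < k) 4 ^ j * N j)%:R).
Let wt j : R := (2 ^ j * (2 * N j))%:R^-1.
Let hh z : R := (n + 2)%:R + 2^-1 * \sum_i lsq 1 (z ord0 i).

(* By [growth], the term indexed by [k] is at most half of the first one, so the
   sequence decreases; its limit is [\sum_j wt j * ln (cmod (ipoly (c j) z) ^+ 2)]. *)
Definition potential k z : R :=
  2 / 2 ^+ k * hh z + \sum_(j < k) wt j * lsq (eps k) (ipoly (c j) z).

Let eps_gt0 k : 0 < eps k. Proof. exact: expR_gt0. Qed.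
Let eps_le1 k : eps k <= 1.
Proof. by rewrite /eps -expR0 ler_expR oppr_le0. Qed.
Let wt_ge0 j : 0 <= wt j. Proof. by rewrite invr_ge0. Qed.
Let hh_ge0 z : 0 <= hh z.
Proof.
by apply: addr_ge0 => //; apply: mulr_ge0 => //; apply: sumr_ge0 => i _; exact: lsq_ge0.
Qed.

(** Each variable is bounded by [b i], the square root of [1 + |z_i| ^ 2]. In the [n + 2] of [hh],
    [n] comes from [N ^ n <= exp (n N)], one unit from the coefficients [2 ^ N], and the last one
    pays for the regularisation. *)
Let growth j z : lsq 1 (ipoly (c j) z) <= (2 * N j)%:R * hh z.
Proof.
pose b i : R := expR (2^-1 * lsq 1 (z ord0 i)).
have b2 i : b i ^+ 2 = cmod (z ord0 i) ^+ 2 + 1.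
  rewrite /b -expRM_natl mulrA mulfV ?pnatr_eq0// mul1r /lsq lnK// posrE.
  exact: lsq_pos.
have b1 i : 1 <= b i.
  rewrite /b -[leLHS]expR0 ler_expR; apply: mulr_ge0; last exact: lsq_ge0.
  by rewrite invr_ge0 ler0n.
have zb i : cmod (z ord0 i) <= b i.
  by rewrite -(@ler_pXn2r _ 2) ?nnegrE ?cmod_ge0 ?expR_ge0// b2 lerDl.
have cB al : `|c j al|%:~R <= 2 ^+ N j :> R.
  by rewrite -natrX -abszE -pmulrn ler_nat cN.
have P2 : 0 <= 2 ^+ N j :> R by rewrite exprn_ge0.
have := ipoly_bound P2 cB b1 zb.
pose Y : R := (N j)%:R * (n%:R + 1 + 2^-1 * \sum_i lsq 1 (z ord0 i)).
have Y0 : 0 <= Y.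
  by rewrite mulr_ge0// !addr_ge0// mulr_ge0// sumr_ge0// => i _; exact: lsq_ge0.
have BY : (N j)%:R ^+ n * (2 ^+ N j * \prod_i b i ^+ N j) <= expR Y.
  have -> : expR Y = expR (N j)%:R ^+ n * (expR 1 ^+ N j * \prod_i b i ^+ N j).
    rewrite prodrXl /b -expR_sum -!expRM_natl -!expRD; congr expR.
    by rewrite /Y -mulr_sumr; ring.
  have p0 : 0 <= \prod_i b i ^+ N j.
    by apply: prodr_ge0 => i _; rewrite exprn_ge0// expR_ge0.
  apply: ler_pM; [by rewrite exprn_ge0|by rewrite mulr_ge0| |].
    apply: lerXn2r; rewrite ?nnegrE ?expR_ge0//.
    by rewrite (le_trans _ (expR_ge1Dx _))// lerDr.
  rewrite ler_wpM2r//; apply: lerXn2r; rewrite ?nnegrE ?expR_ge0//.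
  by have := expR_ge1Dx (1 : R).
move=> /le_trans/(_ BY) PY.
rewrite /lsq -[leRHS]expRK ler_ln ?posrE ?expR_gt0 ?lsq_pos//.
have e1 : 1 <= expR (2 * Y) by rewrite -expR0 ler_expR mulr_ge0.
apply: (@le_trans _ _ (expR (1 + 2 * Y))).
  rewrite expRD; apply: (@le_trans _ _ (2 * expR (2 * Y))).
    rewrite mulr2n mulrDl mul1r lerD//.
    have -> : expR (2 * Y) = expR Y ^+ 2 by rewrite -expRM_natl.
    by apply: lerXn2r; rewrite ?nnegrE ?cmod_ge0 ?expR_ge0.
  by rewrite ler_pM2r ?expR_gt0//; have := expR_ge1Dx (1 : R).
rewrite ler_expR /Y /hh natrM natrD.
have N1 : 1 <= (N j)%:R :> R by rewrite ler1n.
move: (2^-1 * _) => s; nra.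
Qed.

Lemma potential_decr k z : potential k.+1 z <= potential k z.
Proof.
have epsS : eps k.+1 <= eps k.
  by rewrite /eps ler_expR lerN2 ler_nat leq_mul2l big_ord_recr /= leq_addr.
rewrite /potential big_ord_recr /=.
set s1 := \sum_(j < k) wt j * lsq (eps k.+1) _; set s2 := \sum_(j < k) _.
have s12 : s1 <= s2.
  by apply: ler_sum => j _; rewrite ler_wpM2l// lsq_le.
have : wt k * lsq (eps k.+1) (ipoly (c k) z) <= 1 / 2 ^+ k * hh z.
  apply: (@le_trans _ _ (wt k * ((2 * N k)%:R * hh z))).
    by rewrite ler_wpM2l// (le_trans _ (growth k z))// lsq_le.
  have -> // : wt k * ((2 * N k)%:R * hh z) = 1 / 2 ^+ k * hh z.
  have N2 : (2 * N k)%:R != 0 :> R by rewrite pnatr_eq0 muln_eq0 /= -lt0n.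
  by rewrite mulrA /wt natrM natrX invfM -(mulrA (_^-1)) mulVf// mulr1 mul1r.
have -> : 2 / 2 ^+ k.+1 * hh z = 2 / 2 ^+ k * hh z - 1 / 2 ^+ k * hh z.
  by rewrite exprS; field; rewrite expf_neq0.
by move: s12; lra.
Qed.

Lemma potential_le k j z : (j <= k)%N -> potential k z <= potential j z.
Proof.
elim: k => [|k IH]; first by rewrite leqn0 => /eqP ->.
rewrite leq_eqVlt => /predU1P[->//|/IH]; apply: le_trans; exact: potential_decr.
Qed.

(** The exponent [4 ^ j] beats the weight [2 ^- j]: on [X] the term of index [j] is at most
    [1 - 2 ^ j], hence at most [-1] except for [j = 0], where it is at most [0]. *)
Lemma potential_on k z : X z -> potential k z <= 2 * hh z + 1 - k%:R.
Proof.
move=> Xz; have term (j : 'I_k) :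
    wt j * lsq (eps k) (ipoly (c j) z) <= (j == 0 :> nat)%:R - 1.
  have E0 : 0 <= (4 ^ j * N j)%:R :> R by [].
  have lsqB : lsq (eps k) (ipoly (c j) z) <= 1 - (2 * (4 ^ j * N j))%:R.
    rewrite /lsq -[leRHS]expRK ler_ln ?posrE ?expR_gt0 ?lsq_pos// expRD.
    set E := expR (- (2 * _)%:R).
    have h1 : cmod (ipoly (c j) z) ^+ 2 <= E.
      have -> : E = expR (- (4 ^ j * N j)%:R) ^+ 2.
        by rewrite -expRM_natl mulrN -natrM.
      by apply: lerXn2r; rewrite ?nnegrE ?cmod_ge0 ?expR_ge0//; exact: cX.
    have h2 : eps k <= E.
      by rewrite /eps ler_expR lerN2 ler_nat leq_mul2l (bigD1 j)//= leq_addr.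
    have h3 : 2 <= expR 1 :> R by have := expR_ge1Dx (1 : R).
    have E1 : 0 <= E by exact: expR_ge0.
    by nra.
  apply: (@le_trans _ _ (wt j * (1 - (2 * (4 ^ j * N j))%:R))); first by rewrite ler_wpM2l.
  rewrite mulrBr mulr1 lerBlDr.
  have -> : wt j * (2 * (4 ^ j * N j))%:R = 2 ^+ j.
    have -> : (2 * (4 ^ j * N j) = 2 ^ j * (2 ^ j * (2 * N j)))%N.
      by rewrite -[4%N]/(2 * 2)%N expnMn; ring.
    rewrite natrM mulrCA /wt mulVf ?mulr1 ?natrX//.
    by rewrite pnatr_eq0 !muln_eq0 !negb_or -!lt0n expn_gt0 N0.
  have wt1 : wt j <= 1.
    rewrite /wt invf_le1 ?ler1n ?ltr0n// !muln_gt0 ?expn_gt0 ?N0//.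
  case: (j : nat) wt1 => [|i] wt1 /=; first by rewrite expr0; lra.
  have : 2 <= 2 ^+ i.+1 :> R by rewrite exprS ler_peMr// exprn_ege1// ler1n.
  by rewrite sub0r; lra.
rewrite /potential.
have h1 : 2 / 2 ^+ k * hh z <= 2 * hh z.
  by rewrite ler_wpM2r// ler_piMr// invf_le1 ?exprn_gt0// exprn_ege1// ler1n.
have h2 : \sum_(j < k) wt j * lsq (eps k) (ipoly (c j) z) <= 1 - k%:R.
  apply: (@le_trans _ _ (\sum_(j < k) ((j == 0 :> nat)%:R - 1))).
    by apply: ler_sum => j _; exact: term.
  rewrite sumrB sumr_const card_ord lerD2r.
  case: (k) => [|k']; first by rewrite big_ord0.
  by rewrite big_ord_recl /= big1.
by move: h1 h2; lra.
Qed.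

Lemma continuous_sumr (I : Type) (s : seq I) (f : I -> 'rV[C]_n -> R) :
  (forall i, continuous (f i)) -> continuous (fun w => \sum_(i <- s) f i w).
Proof.
move=> cf; elim: s => [|i s IH] z.
  by under eq_fun do rewrite big_nil; exact: cst_continuous.
by under eq_fun do rewrite big_cons; exact: (continuousD (cf i z) (IH z)).
Qed.

Lemma potential_continuous k : continuous (potential k).
Proof.
have clsq e (f : 'rV[C]_n -> C) : 0 < e -> (forall z, differentiable f z) ->
    continuous (fun z => lsq e (f z)).
  move=> e0 df z; apply: lsq_continuous => //.
  exact: differentiable_continuous.
have cD (f g : 'rV[C]_n -> R) :
    continuous f -> continuous g -> continuous (fun z => f z + g z).
  by move=> cf cg z; apply: continuousD; [exact: cf|exact: cg].
have cZ (a : R) (f : 'rV[C]_n -> R) : continuous f -> continuous (fun z => a * f z).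
  by move=> cf z; apply: continuousM; [exact: cst_continuous|exact: cf].
apply: (cD); last first.
  apply: continuous_sumr => j; apply: (cZ); apply: (clsq) => // v.
  exact: ipoly_differentiable.
apply: (cZ); apply: (cD); first exact: cst_continuous.
apply: (cZ); apply: continuous_sumr => i; apply: (clsq) => // v.
exact: differentiable_coord.
Qed.

Lemma potential_submean k (a b : 'rV[C]_n) : submean (fun t => potential k (a + t *: b)).
Proof.
pose L i : {poly C} := (a ord0 i)%:P + b ord0 i *: 'X.
have LE i w : (L i).[w] = (a + w *: b) ord0 i.
  by rewrite lineE hornerD hornerC hornerZ hornerX mulrC.
pose P j : {poly C} := \sum_al ((c j al)%:~R : C)%:P * \prod_i L i ^+ al i.
have PE j w : (P j).[w] = ipoly (c j) (a + w *: b).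
  rewrite horner_sum /ipoly; apply: eq_bigr => al _.
  rewrite hornerM hornerC horner_prod; congr (_ * _).
  by apply: eq_bigr => i _; rewrite horner_exp LE.
have -> : (fun t => potential k (a + t *: b)) =
  (fun t => 2 / 2 ^+ k * ((n + 2)%:R + 2^-1 * \sum_i lsq 1 (L i).[t]) +
     \sum_(j < k) wt j * lsq (eps k) (P j).[t]).
  apply/funext => t; rewrite /potential /hh; congr (_ * (_ + _ * _) + _).
    by apply: eq_bigr => i _; rewrite LE.
  by apply: eq_bigr => j _; rewrite PE.
apply: submeanD.
  apply: submeanZ; first by rewrite divr_ge0// exprn_ge0.
  apply: submeanD; first exact: submean_cst.
  by apply: submeanZ => //; apply: submean_sum => i; exact: submean_lsq.
by apply: submean_sum => j; apply: submeanZ => //; exact: submean_lsq.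
Qed.

(* On the curve [z_i = t ^ (D ^ i)] the polynomials become univariate with the
   same integer coefficients; after division by a power of [t] the value at [0]
   is a nonzero integer, so the mean of [log] on the circle is nonnegative. *)
Lemma potential_torus k : exists z, (forall i, cmod (z ord0 i) <= 1) /\ 0 <= potential k z.
Proof.
(* One base above all the degrees involved, so that the same curve serves every [P_j] with
   [j < k]. *)
pose D := (\sum_(j < k) N j).+1.
pose idx j (al : {ffun 'I_n -> 'I_(N j)}) := (\sum_i al i * D ^ i)%N.
pose p j : {poly int} := \sum_al (c j al)%:P * 'X^(idx j al).
pose gam t : 'rV[C]_n := \row_i ei t ^+ (D ^ i).
have toC j t : (map_poly intr (p j)).[ei t] = ipoly (c j) (gam t) :> C.
  rewrite /p rmorph_sum horner_sum /ipoly; apply: eq_bigr => al _.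
  rewrite rmorphM /= map_polyC /= map_polyXn hornerM hornerC hornerXn; congr (_ * _).
  rewrite /idx expr_sum; apply: eq_bigr => i _.
  by rewrite mxE -exprM mulnC.
have H (j : 'I_k) : exists q : {poly C}, 1 <= cmod q.[0] /\
    forall t, cmod q.[ei t] = cmod (ipoly (c j) (gam t)).
  have pj0 : p j != 0.
    have [al al0] := c0 j; apply: contra al0 => /eqP pj.
    have : (p j)`_(idx j al) = c j al.
      rewrite /p coef_sum (bigD1 al)//= coefCM coefXn eqxx mulr1 big1 ?addr0// => be be_al.
      rewrite coefCM coefXn; case: eqP => [|_]; last by rewrite mulr0.
      have ND (x : {ffun 'I_n -> 'I_(N j)}) i : (x i < D)%N.
        by rewrite ltnS (leq_trans (ltnW (ltn_ord _)))// (bigD1 j)//= leq_addr.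
      move=> /(digits_inj (ND al) (ND be)) E; exfalso; move/eqP: be_al; apply.
      by apply/ffunP => i; apply/val_inj; rewrite /= E.
    by rewrite pj coef0 => <-.
  have [m [q q0 pq]] := multiplicity_XsubC (p j) 0.
  rewrite pj0 /= in q0.
  exists (map_poly intr q); split.
    have -> : (map_poly intr q).[0] = (q.[0])%:~R :> C.
      by rewrite -[0 in LHS](rmorph0 (intr : int -> C)) horner_map.
    rewrite cmod_int -[1]/((1 : int)%:~R) ler_int.
    by move: q0; rewrite /root; case: (q.[0]) => [[|//]|].
  move=> t; rewrite -toC pq rmorphM /= hornerM cmodM rmorphXn /= horner_exp.
  rewrite rmorphB /= map_polyX map_polyC /= hornerXsubC subr0 cmodX cmod_ei.
  by rewrite expr1n mulr1.
pose q j := sval (cid (H j)).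
have q0 j : 1 <= cmod (q j).[0] by have [] := svalP (cid (H j)).
have qE j t : cmod (q j).[ei t] = cmod (ipoly (c j) (gam t)).
  by have [_] := svalP (cid (H j)); exact.
have sub : submean (fun w => \sum_(j < k) wt j * lsq (eps k) (q j).[w]).
  by apply: submean_sum => j; apply: submeanZ => //; exact: submean_lsq.
have [cG] := sub 0 1.
set G := fun t => \sum_(j < k) wt j * lsq (eps k) (q j).[0 + circ 1 t].
have G0 : 0 <= \sum_(j < k) wt j * lsq (eps k) (q j).[0].
  apply: sumr_ge0 => j _; rewrite mulr_ge0// /lsq ln_ge0//.
  rewrite (le_trans (_ : 1 <= cmod (q j).[0] ^+ 2)) ?exprn_ege1//.
  by rewrite lerDl ltW.
move=> /(le_trans G0) Gm.
have T0 : 0 < 2 * pi :> R by rewrite mulr_gt0// pi_gt0.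
(* The maximum over the circle is at least the mean, which is at least the nonnegative value at the
   centre. *)
have [t Gt] : exists t, 0 <= G t.
  have [|t tT Ht] := @EVT_max R G 0 (2 * pi) (ltW T0).
    by apply: continuous_in_subspaceT => x /set_mem xab; exact: cG.
  exists t; move: Gm; rewrite pmulr_rge0 ?invr_gt0// => Gm.
  have := le_trans Gm (le_intab cG (@cont_on_cst R (G t) 0 (2 * pi)) _).
  rewrite intab_cst ?(ltW T0)// subr0 pmulr_lge0//; apply => x xT.
  by apply: Ht; rewrite in_itv.
exists (gam t); split; first by move=> i; rewrite mxE cmodX cmod_ei expr1n.
rewrite /potential addr_ge0//; first by rewrite mulr_ge0// divr_ge0// exprn_ge0.
apply: le_trans Gt _; rewrite /G le_eqVlt; apply/orP; left; apply/eqP.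
by apply: eq_bigr => j _; rewrite add0r /circ cR1 mul1r /lsq qE.
Qed.

(** Otherwise the open sets where some stage is negative cover the closed unit polydisc; by
    compactness and monotonicity a single stage [m] is negative on all of it, against
    [potential_torus]. *)
Lemma potential_bounded_below : exists z, forall k, 0 <= potential k z.
Proof.
pose K : set 'rV[C]_n := [set z | forall i, cmod (z ord0 i) <= 1].
have cK : compact K.
  apply: (@closed_bounded_compact _ _ _ 1) => //.
  have -> : K = \bigcap_(i in setT) [set z | (fun z => cmod (z ord0 i)) z <= 1].
    by apply/seteqP; split => z /= Hz i => [_|]; exact: Hz.
  apply: closed_bigI => i _.
  have cc : continuous (fun z : 'rV[C]_n => cmod (z ord0 i)).
    move=> z; apply: (@continuous_comp _ _ _ (fun z : 'rV[C]_n => z ord0 i)).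
      exact: coord_continuous.
    exact: cmod_continuous.
  exact: (proj1 (continuous_closedP _) cc _ (@closed_le _ 1)).
apply: contrapT => nex; move: cK; rewrite compact_cover => cK.
have [||s _ Ks] := cK nat setT (fun k => [set z | potential k z < 0]).
- move=> k _.
  exact: (proj1 (continuousP _) (@potential_continuous k) _ (@open_lt _ 0)).
- move=> z _; have [k Hk] : exists k, potential k z < 0.
    apply: contrapT => nk; apply: nex; exists z => k; rewrite leNgt; apply/negP => h.
    by apply: nk; exists k.
  by exists k.
pose m := (\max_(k <- finmap.enum_fset s) k)%N.
have [z [zK mz]] := potential_torus m.
have [k ks Hk] := Ks z zK.
have km : (k <= m)%N by exact: leq_bigmax_seq.
by have := potential_le z km; move: Hk => /=; lra.
Qed.

Lemma potential_pluripolar : X !=set0 -> pluripolar X.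
Proof.
move=> [x Xx]; exists (fun z => ereal_inf (range (fun k => (potential k z)%:E))).
have XNy z : X z -> ereal_inf (range (fun k => (potential k z)%:E)) = -oo%E.
  move=> Xz; set u := ereal_inf _.
  suff uA A : (u <= A%:E)%E.
    case: u uA => [r /(_ (r - 1)%R)|/(_ 0%R)|//]; last by rewrite leye_eq.
    by rewrite lee_fin => ?; exfalso; lra.
  pose k := (Num.trunc (`|2 * hh z + 1 - A|)).+1.
  apply: (@le_trans _ _ (potential k z)%:E); first by apply: ereal_inf_lbound; exists k.
  rewrite lee_fin (le_trans (potential_on k Xz))//.
  have : `|2 * hh z + 1 - A| < k%:R by exact: truncnS_gt.
  by rewrite ltr_norml => /andP[_]; lra.
split.
- apply: plurisubharmonic_inf.
  + exact: potential_decr.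
  + exact: potential_continuous.
  + by move=> k a b t0 r _; have [_] := potential_submean k a b t0 r.
- have [z Hz] := potential_bounded_below; exists x, z; rewrite XNy// => E.
  have : (0 <= ereal_inf (range (fun k => (potential k z)%:E)))%E.
    by apply: le_ereal_inf_tmp => _ [k _ <-]; rewrite lee_fin.
  by rewrite -E leeNy_eq.
- exact: XNy.
Qed.

End Potential.

(** * From small entropy to pluripolarity *)

Section Pluripolar.
Context {R : realType}.
Local Notation C := (CC R).

Lemma Kdim_lt_pluripolar n (X : set 'rV[C]_n) : X !=set0 -> compact X ->
  (Kdim X < n%:R%:E)%E -> pluripolar X.
Proof.
move=> X0 cX Xn; have Kge := Kdim_ge0 X0.
have [s [s0 sn Xs]] : exists s : R, [/\ -1 <= s, s < n%:R & (Kdim X < s%:E)%E].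
  move: Kge Xn; case: (Kdim X) => [d| |]//; rewrite lee_fin lte_fin => d0 dn.
  (* A midpoint leaves room on both sides: above the dimension for the growth condition, below [n]
     for the pigeonhole. *)
  by exists ((d + n%:R) / 2); rewrite lte_fin; split; lra.
have [M M0 XM] := compact_coord_bounded cX.
have XP : X `<=` polydisc 0 M by move=> z Xz i; rewrite mxE subr0; exact: XM.
have [E [_ bE XE EX]] := KdimE M0 XM; rewrite EX in Xs.
have eX := ent_growth_id s0 cX (@polydisc_open R n 0 M) XP bE (Psi_lt_ent s0 Xs).
have H j := small_integer_poly (4 ^ j) M0 XM s0 sn eX.
pose N j := sval (cid (H j)).
have HN j : exists c : {ffun {ffun 'I_n -> 'I_(N j)} -> int},
    [/\ (0 < N j)%N, exists al, c al != 0, forall al, (`|c al| <= 2 ^ N j)%N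
      & forall z, X z -> cmod (ipoly c z) <= expR (- (4 ^ j * N j)%:R)].
  exact: (svalP (cid (H j))).
pose c j := sval (cid (HN j)).
have cP j : [/\ (0 < N j)%N, exists al, c j al != 0, forall al, (`|c j al| <= 2 ^ N j)%N
      & forall z, X z -> cmod (ipoly (c j) z) <= expR (- (4 ^ j * N j)%:R)].
  exact: (svalP (cid (HN j))).
by apply: (@potential_pluripolar R n X N c) X0 => j; have [] := cP j.
Qed.

End Pluripolar.

Theorem theorem4p6 (R : realType) (n : nat) (X : set 'rV[CC R]_n)
    (X0 : X !=set0) (cX : compact X) :
  [/\ (0 <= Kdim X <= n%:R%:E)%E,
      forall z : 'rV[CC R]_n, Kdim [set z] = 0%E,
      Kdim (poly_hull X) = Kdim X
    & forall Y : set 'rV[CC R]_n, Y `<=` X -> Y !=set0 -> compact Y ->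
        (Kdim Y <= Kdim X)%E] /\
  [/\ forall (m : nat) (Xs : 'I_m.+1 -> set 'rV[CC R]_n),
        (forall j, Xs j !=set0) -> (forall j, compact (Xs j)) ->
        Kdim (\bigcup_j Xs j) = \big[maxe/-oo%E]_(j < m.+1) Kdim (Xs j),
      forall (D : set 'rV[CC R]_n) (k : nat) (phi : 'rV[CC R]_n -> 'rV[CC R]_k),
        domain D -> X `<=` D -> holomorphic_on D phi ->
        (Kdim (phi @` X) <= Kdim X)%E
    & (Kdim X < n%:R%:E)%E -> pluripolar X].
Proof.
have [M M0 XM] := compact_coord_bounded cX.
split; split.
- by apply/andP; split; [exact: Kdim_ge0|exact: Kdim_le].
- exact: Kdim_set1.
- exact: Kdim_poly_hull.
- by move=> Y YX Y0 cY; exact: Kdim_sub M0 XM YX Y0 cY.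
- exact: Kdim_bigcup.
- move=> D k phi [oD _] XD hphi; exact: Kdim_map.
- exact: Kdim_lt_pluripolar.
Qed.
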